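(* Let $X$ be a locally compact roughly starlike Gromov $\delta$-hyperbolic space with base point $z_0$, let $1\le p<\infty$, and let $\mu$ be a Borel measure on $X$ which is doubling (with constant $C_d$) and supports a $p$-Poincaré inequality, both for balls of radii at most $R_0$. Let $0<\varepsilon\le\varepsilon_0(\delta)$, $\beta>\beta_0:=17\log C_d/(3R_0)$ and $\lambda>1$. Then $\mu_\beta$ is globally doubling and supports a global $p$-Poincaré inequality on $\overline{X}_\varepsilon$ with dilation $1$, and on $X_\varepsilon$ with dilation $\lambda$.
   Context: Gromov $\delta$-hyperbolic: a complete unbounded geodesic metric space in which for all geodesics $[x,y],[y,z],[z,x]$, every point of $[x,y]$ lies within distance $\delta$ of $[y,z]\cup[z,x]$. Roughly starlike with respect to $z_0$: there is $M>0$ such that every point lies within distance $M$ of a geodesic ray from $z_0$. Uniformization: $\rho_\varepsilon(x)=e^{-\varepsilon d(x,z_0)}$, $d_\varepsilon(x,y)=\inf_\gamma\int_\gamma\rho_\varepsilon\,ds$ over rectifiable curves joining $x,y$; $X_\varepsilon=(X,d_\varepsilon)$, $\overline{X}_\varepsilon$ its completion, $\partial_\varepsilon X=\overline{X}_\varepsilon\setminus X_\varepsilon$. Known fact (Bonk–Heinonen–Koskela): there is $\varepsilon_0(\delta)>0$ such that for $0<\varepsilon\le\varepsilon_0(\delta)$, $X_\varepsilon$ is a uniform space and $\overline X_\varepsilon$ is compact and geodesic. $d\mu_\beta=e^{-\beta d(\cdot,z_0)}d\mu$ on $X$, extended by $\mu_\beta(\partial_\varepsilon X)=0$. Doubling for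 balls of radii at most $R_0$ with constant $C_d$: $0<\nu(B(x,2r))\le C_d\nu(B(x,r))<\infty$ for all $x$, $0<r\le R_0$; globally doubling if for all $r$. A Borel function $g\ge0$ is an upper gradient of $u$ if $|u(\gamma(0))-u(\gamma(l_\gamma))|\le\int_\gamma g\,ds$ for every arc-length parametrized rectifiable curve $\gamma:[0,l_\gamma]\to Y$ (left side $=\infty$ if either value is infinite). $\nu$ supports a $p$-Poincaré inequality with dilation $\lambda\ge1$ (for balls of radii at most $R_0$) if there is $C_{PI}$ such that for all balls $B$ (of radius $\le R_0$), all bounded measurable $u$ and all upper gradients $g$ of $u$, \[ \frac{1}{\nu(B)}\int_B|u-u_B|\,d\nu\le C_{PI}\operatorname{diam}(B)\Big(\frac1{\nu(\lambda B)}\int_{\lambda B}g^p\,d\nu\Big)^{1/p},\quad u_B=\frac1{\nu(B)}\int_Bu\,d\nu; \] ''global'' means for all balls. *)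

(* Defs.v *)
From HB Require Import structures.
From mathcomp Require Import all_boot all_order all_algebra.
From mathcomp Require Import all_classical all_reals all_analysis.
Set Implicit Arguments. Unset Strict Implicit. Unset Printing Implicit Defensive.
Import Order.TTheory GRing.Theory Num.Theory.
Import numFieldNormedType.Exports.
Local Open Scope classical_set_scope.
Local Open Scope ring_scope.

Section MetricNotions.
Variable R : realType.

Section Gen.
Variable Y : Type.
Variable dY : Y -> Y -> R.

Definition is_metric :=
  [/\ (forall x y, 0 <= dY x y), (forall x y, dY x y = 0 <-> x = y),
      (forall x y, dY x y = dY y x) & (forall x y z, dY x z <= dY x y + dY y z)].

Definition dball (x : Y) (r : R) : set Y := [set y | dY x y < r].

Definition dopen (U : set Y) :=
  forall x, U x -> exists r, 0 < r /\ dball x r `<=` U.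

Definition dborel : set (set Y) := <<s [set U | dopen U] >>.

Definition dmeasR (u : Y -> R) :=
  forall V : set R, open V -> dborel (u @^-1` V).
Definition dmeasE (g : Y -> \bar R) :=
  forall V : set (\bar R), open V -> dborel (g @^-1` V).

Definition dconverges (u : nat -> Y) (x : Y) :=
  forall e, 0 < e -> exists N, forall n, (N <= n)%N -> dY (u n) x < e.
Definition dcauchy (u : nat -> Y) :=
  forall e, 0 < e -> exists N, forall m n, (N <= m)%N -> (N <= n)%N ->
    dY (u m) (u n) < e.
Definition dcomplete := forall u, dcauchy u -> exists x, dconverges u x.
(* (sequential) compactness, equivalent to compactness in metric spaces *)
Definition dcompact (K : set Y) :=
  forall u : nat -> Y, (forall n, K (u n)) ->
    exists (phi : nat -> nat) (x : Y),
      [/\ (forall n, (phi n < phi n.+1)%N), K x & dconverges (u \o phi) x].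
Definition dlocally_compact :=
  forall x, exists K, dcompact K /\ exists r, 0 < r /\ dball x r `<=` K.
Definition dunbounded := forall x (M : R), exists y, M < dY x y.

Definition geodesic (g : R -> Y) (a b : Y) :=
  [/\ g 0 = a, g (dY a b) = b &
      forall s t, 0 <= s <= dY a b -> 0 <= t <= dY a b ->
        dY (g s) (g t) = `|s - t|].
Definition gseg (g : R -> Y) (a b : Y) : set Y :=
  [set g t | t in `[0, dY a b]%classic].
Definition geodesic_space := forall a b, exists g, geodesic g a b.

Definition gromov_hyperbolic (delta : R) :=
  forall (x y z : Y) (g1 g2 g3 : R -> Y),
    geodesic g1 x y -> geodesic g2 y z -> geodesic g3 z x ->
    forall w, gseg g1 x y w ->
      exists v, (gseg g2 y z `|` gseg g3 z x) v /\ dY w v <= delta.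

Definition geodesic_ray (g : R -> Y) (z0 : Y) :=
  g 0 = z0 /\ forall s t, 0 <= s -> 0 <= t -> dY (g s) (g t) = `|s - t|.

Definition roughly_starlike (z0 : Y) :=
  exists M, 0 < M /\ forall x, exists g t,
    [/\ geodesic_ray g z0, 0 <= t & dY x (g t) <= M].

Fixpoint polyl (g : R -> Y) (a : R) (s : seq R) : R :=
  match s with
  | [::] => 0
  | b :: s' => dY (g a) (g b) + polyl g b s'
  end.

Definition curve_length (g : R -> Y) (a b : R) : \bar R :=
  ereal_sup [set (polyl g a (rcons s b))%:E | s in
             [set s : seq R | path <=%R a (rcons s b)]].

Definition arclength (g : R -> Y) (l : R) :=
  0 <= l /\ forall s t, 0 <= s -> s <= t -> t <= l ->
    curve_length g s t = (t - s)%:E.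

Definition line_int (rho : Y -> \bar R) (g : R -> Y) (l : R) : \bar R :=
  (\int[@lebesgue_measure R]_(t in `[0%R, l]%classic) rho (g t))%E.

Definition upper_gradient (u : Y -> R) (gr : Y -> \bar R) :=
  forall (g : R -> Y) (l : R), arclength g l ->
    ((`|u (g 0) - u (g l)|)%:E <= line_int gr g l)%E.

Definition ddiam (B : set Y) : \bar R :=
  ereal_sup [set (dY y z)%:E | y in B & z in B].

(* ---------- doubling and Poincare for a measure given by its volume and
   integration functionals ---------- *)
Variable vol : set Y -> \bar R.
Variable integ : set Y -> (Y -> \bar R) -> \bar R.

Definition doubling (C : R) (rad : R -> Prop) :=
  forall x r, 0 < r -> rad r ->
    [/\ (0 < vol (dball x (2 * r)))%E,
        (vol (dball x (2 * r)) <= C%:E * vol (dball x r))%E &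
        (vol (dball x (2 * r)) < +oo)%E].

Definition poincare (p lam C : R) (rad : R -> Prop) :=
  forall x r, 0 < r -> rad r ->
  forall (u : Y -> R) (gr : Y -> \bar R),
    dmeasR u -> (exists M, forall y, `|u y| <= M) ->
    dmeasE gr -> (forall y, (0 <= gr y)%E) -> upper_gradient u gr ->
    let B := dball x r in
    let lB := dball x (lam * r) in
    let uB := fine (integ B (fun y => (u y)%:E)) / fine (vol B) in
    (((fine (vol B))^-1)%:E * integ B (fun y => (`|u y - uB|)%:E)
     <= C%:E * ddiam B *
        poweR (((fine (vol lB))^-1)%:E * integ lB (fun y => poweR (gr y) p))
              p^-1)%E.

End Gen.

Section Weighted.
Context (dd : measure_display) (X : measurableType dd) (Y : Type).
Variable mu : {measure set X -> \bar R}.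
Variable w : X -> R.
Variable iota : X -> Y.

Definition wvol (A : set Y) : \bar R :=
  (\int[mu]_(x in iota @^-1` A) (w x)%:E)%E.
Definition wint (A : set Y) (f : Y -> \bar R) : \bar R :=
  (\int[mu]_(x in iota @^-1` A) (f (iota x) * (w x)%:E))%E.
End Weighted.

Section Unif.
Variable X : Type.
Variable d : X -> X -> R.
Variables (z0 : X) (eps : R).
Definition rho_eps (x : X) : R := expR (- (eps * d x z0)).
Definition d_eps (x y : X) : R :=
  fine (ereal_inf [set v | exists (g : R -> X) (l : R),
     [/\ arclength d g l, g 0 = x, g l = y &
         v = line_int (fun z => (rho_eps z)%:E) g l]]).
End Unif.

Definition is_completion (X Y : Type) (dX : X -> X -> R) (dY : Y -> Y -> R)
  (iota : X -> Y) :=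
  [/\ is_metric dY, dcomplete dY,
      (forall x y, dY (iota x) (iota y) = dX x y) &
      (forall y e, 0 < e -> exists x, dY (iota x) y < e)].

End MetricNotions.

(* Main.v *)
(* Hyperbolicity enters only through Frink's chain lemma: for small eps the function
   exp(-eps (x|y)) is a quasimetric with constant at most sqrt 2, hence it is comparable to
   d_eps, and points whose d_eps-distance is at most C min(rho x, rho y) lie at bounded
   d-distance.

   Doubling: a d_eps-ball that is small compared with rho at its center is comparable to a
   d-ball of bounded radius.  Otherwise the ball lies, up to bounded error, behind an ancestor
   of its center (a point of the geodesic towards z0), and as beta beats the exponential growth
   of mu its measure is comparable to that of a unit d-ball around the ancestor.

   Poincare: in a d_eps-ball every point is joined to a central point by a chain that climbs
   towards the center of the ball and towards z0, with steps of bounded d-length (a John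
   domain).  The Poincare inequality of (X, d, mu) applies on the d-balls of a Whitney cover, on
   which the weights are essentially constant; telescoping along the chains and exchanging the
   summations bounds the oscillation by sums over Whitney balls of their shadows, which doubling
   controls.  Linearizing x^(1/p) <= tau^(1/p) (1 + x / tau) at the average tau of g^p replaces
   the Hoelder inequality.

   Only the density of X in the completion matters, so X_eps and its completion are both
   instances of an isometry iota : (X, d_eps) -> (Y, dY) with dense range. *)
Require Import Defs.
From HB Require Import structures.
From mathcomp Require Import all_boot all_order all_algebra.
From mathcomp Require Import all_classical all_reals all_analysis.
From mathcomp Require Import finmap measurable_realfun ring lra zify.
Set Implicit Arguments. Unset Strict Implicit. Unset Printing Implicit Defensive.
Import Order.TTheory GRing.Theory Num.Theory.
Import numFieldNormedType.Exports.
Local Open Scope classical_set_scope.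
Local Open Scope ring_scope.

(** * Curves and length *)

(** The obstacle is dilation 1. The given inequality has its own dilation [lam0] and is limited to
    radii up to R0, so a ball must be filled by d-balls whose dilated copies stay inside it. Hence
    the scale [s = c * D / rho] with [D = min (rho, theta * depth)]: [D] stands for the
    d_eps-distance to the complement of the ball and to the boundary of X_eps together, and dividing
    by rho makes it a d-radius. The dilation is absorbed in [Lam = 16 * lam0], and [c] is chosen
    after [Lam]. The bound on eps is what the chain lemma asks of the Gromov product: its inequality
    has defect 3 delta + 1, so exp(eps (3 delta + 1)) must be at most sqrt 2. The rate 4 log Cd /
    R0, which lies below 17 log Cd / (3 R0), is the growth rate of mu: enlarging a radius by R0 / 2
    costs a factor Cd ^ 2. An upper gradient g for d_eps becomes g * rho for d; for this, curves are
    reparametrized by their d_eps-length. Almost minimizing curves take the place of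
    d_eps-geodesics, and chains follow d-geodesics of bounded length. *)

Section Curves.
Context {R : realType} {Y : Type} (d : Y -> Y -> R).
Hypothesis md : is_metric d.

Lemma mdist_ge0 x y : 0 <= d x y. Proof. by case: md. Qed.
Lemma mdist0 x : d x x = 0. Proof. by case: md => _ H _ _; apply/H. Qed.
Lemma mdist_eq0 x y : d x y = 0 -> x = y. Proof. by case: md => _ H _ _ /H. Qed.
Lemma mdistC x y : d x y = d y x. Proof. by case: md. Qed.
Lemma mdist_tri x y z : d x z <= d x y + d y z. Proof. by case: md. Qed.

Lemma mdist_lip z x y : `|d x z - d y z| <= d x y.
Proof.
have := mdist_tri x y z; have := mdist_tri y x z.
by rewrite (mdistC y x) ler_norml => h1 h2; apply/andP; split; lra.
Qed.

Lemma polyl_cat (g : R -> Y) a s1 s2 :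
  polyl d g a (s1 ++ s2) = polyl d g a s1 + polyl d g (last a s1) s2.
Proof. by elim: s1 a => [|x s1 IH] a /=; rewrite ?add0r // IH addrA. Qed.

Lemma polyl_map (phi : R -> R) (g : R -> Y) a s :
  polyl d g (phi a) (map phi s) = polyl d (g \o phi) a s.
Proof. by elim: s a => [|x s IH] a //=; rewrite IH. Qed.

Lemma path_le_last (a b : R) s : path <=%R a (rcons s b) -> a <= b.
Proof.
by elim: s a => [|x s IH] a /=; [rewrite andbT|case/andP=> ax /IH; exact: le_trans].
Qed.

Lemma eq_polyl (g g' : R -> Y) a b s :
  (forall t, a <= t -> t <= b -> g t = g' t) -> path <=%R a (rcons s b) ->
  polyl d g a (rcons s b) = polyl d g' a (rcons s b).
Proof.
elim: s a => [|x s IH] a H /=.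
  by rewrite andbT => ab; rewrite !H.
case/andP=> ax p; have xb := path_le_last p.
by rewrite (H x)// (H a)// ?(le_trans ax)// (IH x)// => t xt; apply: H; exact: le_trans xt.
Qed.

Lemma polyl_le (g : R -> Y) a b s :
  (forall s t, a <= s -> s <= t -> t <= b -> d (g s) (g t) <= t - s) ->
  path <=%R a (rcons s b) -> polyl d g a (rcons s b) <= b - a.
Proof.
elim: s a => [|x s IH] a H /=.
  by rewrite andbT addr0 => ab; apply: H.
case/andP=> ax p; have xb := path_le_last p.
rewrite -(subrKA x b) [leRHS]addrC lerD ?H//.
by apply: IH => // u v xu uv vb; apply: H => //; exact: le_trans xu.
Qed.

Lemma polyl_rev (g : R -> Y) a b s :
  polyl d g b (rcons (rev s) a) = polyl d g a (rcons s b).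
Proof.
elim: s a => [|x s IH] a /=; first by rewrite mdistC.
by rewrite rev_cons -cats1 polyl_cat IH last_rcons /= addr0 addrC mdistC.
Qed.

(** A lower bound for the length of [g] on [a, b] that stays in the reals: some polygonal sum comes
    within [e] of [c]. In this form it is additive and transports well along reparametrizations. *)
Definition length_ge (g : R -> Y) a b c := forall e, 0 < e ->
  exists s, path <=%R a (rcons s b) /\ c - e <= polyl d g a (rcons s b).

Lemma length_ge_cat g a b c x y : length_ge g a b x -> length_ge g b c y ->
  length_ge g a c (x + y).
Proof.
move=> H1 H2 e e0; have e2 : 0 < e / 2 by rewrite divr_gt0.
have [s1 [p1 l1]] := H1 _ e2; have [s2 [p2 l2]] := H2 _ e2.
exists (rcons s1 b ++ s2); rewrite rcons_cat cat_path polyl_cat last_rcons p1 p2.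
by split => //; lra.
Qed.

Lemma length_ge_ext (g g' : R -> Y) a b x :
  (forall t, a <= t -> t <= b -> g t = g' t) -> length_ge g a b x -> length_ge g' a b x.
Proof.
move=> E H e e0; have [s [p l]] := H _ e0.
by exists s; split => //; rewrite -(eq_polyl E).
Qed.

Lemma length_ge_dist g a b : a <= b -> length_ge g a b (d (g a) (g b)).
Proof. by move=> ab e e0; exists [::]; rewrite /= ab addr0; split => //; lra. Qed.

Lemma length_ge_comp (phi : R -> R) (g : R -> Y) a b c :
  {homo phi : x y / x <= y} -> length_ge (g \o phi) a b c -> length_ge g (phi a) (phi b) c.
Proof.
move=> mon H e e0; have [s [p l]] := H _ e0.
exists (map phi s); rewrite -map_rcons polyl_map; split => //.
rewrite path_map; apply: sub_path p => x y; exact: mon.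
Qed.

Lemma length_ge_rev (g : R -> Y) a b c : length_ge g a b c ->
  length_ge (fun t => g (- t)) (- b) (- a) c.
Proof.
move=> H e e0; have [s [p l]] := H _ e0.
exists (map -%R (rev s)); rewrite -map_rcons polyl_map; split; last first.
  rewrite (_ : _ \o _ = g) ?polyl_rev//.
  by apply/funext => t /=; rewrite opprK.
rewrite path_map.
have := rev_path (fun x y : R => y <= x) a (rcons s b).
rewrite last_rcons belast_rcons rev_cons (@eq_path _ _ <=%R _ a)// p => E.
by apply: sub_path E => x y /=; rewrite lerN2.
Qed.

(** The partition without interior points gives the Lipschitz bound; conversely this bound caps
    every polygonal sum by [t - s]. So arc length splits into an upper and a lower estimate that can
    be checked separately. *)
Lemma arclengthP (g : R -> Y) l : 0 <= l -> arclength d g l <->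
  (forall s t, 0 <= s -> s <= t -> t <= l -> d (g s) (g t) <= t - s) /\
  (forall s t, 0 <= s -> s <= t -> t <= l -> length_ge g s t (t - s)).
Proof.
move=> l0; split.
  case=> _ H; split=> s t s0 st tl; have {}H := H s t s0 st tl.
    rewrite -lee_fin -H; apply: ereal_sup_ubound; exists [::] => /=.
      by rewrite st.
    by rewrite addr0.
  move=> e e0.
  have /ub_ereal_sup_adherent : (curve_length d g s t \is a fin_num) by rewrite H.
  move=> /(_ _ e0) [_ [u pu <-]]; rewrite -/(curve_length d g s t) H -EFinB lte_fin => L.
  by exists u; split => //; exact: ltW.
case=> H1 H2; split => // s t s0 st tl; apply/eqP; rewrite eq_le; apply/andP; split.
  apply: ge_ereal_sup => _ [u pu <-]; rewrite lee_fin; apply: polyl_le => // a b sa ab bt.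
  apply: H1 => //; [exact: le_trans sa|exact: le_trans tl].
apply/lee_addgt0Pr => e e0; have [u [pu lu]] := H2 s t s0 st tl e e0.
rewrite (@le_trans _ _ ((polyl d g s (rcons u t))%:E + e%:E)%E)//.
  by rewrite -EFinD lee_fin -lerBlDr.
by rewrite leeD2r//; apply: ereal_sup_ubound; exists u.
Qed.

Lemma arclength_ge0 (g : R -> Y) l : arclength d g l -> 0 <= l. Proof. by case. Qed.

Lemma arclength_lip (g : R -> Y) l : arclength d g l ->
  forall s t, 0 <= s -> s <= t -> t <= l -> d (g s) (g t) <= t - s.
Proof. by move=> /[dup] [[l0 _]] /(arclengthP _ l0) []. Qed.

Lemma arclength_length (g : R -> Y) l : arclength d g l ->
  forall s t, 0 <= s -> s <= t -> t <= l -> length_ge g s t (t - s).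
Proof. by move=> /[dup] [[l0 _]] /(arclengthP _ l0) []. Qed.

Lemma arclength_sub (g : R -> Y) (l a b : R) : arclength d g l -> 0 <= a -> a <= b -> b <= l ->
  arclength d (fun t => g (a + t)) (b - a).
Proof.
move=> H a0 ab bl; apply/arclengthP; first by rewrite subr_ge0.
split => s t s0 st tl.
  have -> : t - s = a + t - (a + s) by lra.
  by apply: (arclength_lip H); lra.
have L : length_ge g (a + s) (a + t) (t - s).
  have -> : t - s = a + t - (a + s) by lra.
  by apply: (arclength_length H); lra.
have -> : s = -a + (a + s) by lra.
have -> : t = -a + (a + t) by lra.
apply: (@length_ge_comp (fun t => -a + t)) => [x y xy|]; first by rewrite lerD2l.
have -> : - a + (a + t) - (- a + (a + s)) = t - s by lra.
apply: length_ge_ext L => u _ _ /=; congr g; lra.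
Qed.

Lemma arclength_rev (g : R -> Y) l : arclength d g l -> arclength d (fun t => g (l - t)) l.
Proof.
move=> H; have l0 := arclength_ge0 H; apply/arclengthP => //; split => s t s0 st tl.
  rewrite mdistC; have -> : t - s = (l - s) - (l - t) by lra.
  apply: (arclength_lip H); lra.
have L : length_ge g (l - t) (l - s) (t - s).
  have -> : t - s = (l - s) - (l - t) by lra.
  apply: (arclength_length H); lra.
have := length_ge_rev L => {}L.
have Es : s = l + - (l - s) by lra.
have Et : t = l + - (l - t) by lra.
rewrite [X in length_ge _ X _]Es [X in length_ge _ _ X]Et.
apply: (@length_ge_comp (fun t => l + t)) => [x y xy|]; first by rewrite lerD2l.
by apply: length_ge_ext L => u _ _ /=; congr g; lra.
Qed.

Definition glue (g1 g2 : R -> Y) (l : R) t := if t <= l then g1 t else g2 (t - l).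

Lemma glue_l g1 g2 l t : t <= l -> glue g1 g2 l t = g1 t.
Proof. by rewrite /glue => ->. Qed.
Lemma glue_r g1 g2 l t : g1 l = g2 0 -> l <= t -> glue g1 g2 l t = g2 (t - l).
Proof.
rewrite /glue => E; rewrite le_eqVlt => /predU1P[<-|lt].
  by rewrite lexx subrr.
by rewrite leNgt lt.
Qed.

Lemma arclength_glue (g1 g2 : R -> Y) l1 l2 : arclength d g1 l1 -> arclength d g2 l2 ->
  g1 l1 = g2 0 -> arclength d (glue g1 g2 l1) (l1 + l2).
Proof.
move=> H1 H2 E; have l10 := arclength_ge0 H1; have l20 := arclength_ge0 H2.
have gl := @glue_l g1 g2 l1; have gr t := @glue_r g1 g2 l1 t E.
have Lip2 s t : l1 <= s -> s <= t -> t <= l1 + l2 ->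
    d (glue g1 g2 l1 s) (glue g1 g2 l1 t) <= t - s.
  move=> ? ? ?; rewrite !gr; try lra.
  have -> : t - s = (t - l1) - (s - l1) by lra.
  by apply: (arclength_lip H2); lra.
have Len2 s t : l1 <= s -> s <= t -> t <= l1 + l2 ->
    length_ge (glue g1 g2 l1) s t (t - s).
  move=> ? ? ?.
  have L : length_ge g2 (s - l1) (t - l1) ((t - l1) - (s - l1)) by apply: (arclength_length H2); lra.
  have Es : s = l1 + (s - l1) by lra.
  have Et : t = l1 + (t - l1) by lra.
  rewrite [X in length_ge _ X _]Es [X in length_ge _ _ X]Et.
  apply: (@length_ge_comp (fun t => l1 + t)) => [x y xy|]; first by rewrite lerD2l.
  have -> : t - s = (t - l1) - (s - l1) by lra.
  apply: length_ge_ext L => u ? ? /=; rewrite gr; last lra.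
  by congr g2; lra.
have Lip1 s t : 0 <= s -> s <= t -> t <= l1 ->
    d (glue g1 g2 l1 s) (glue g1 g2 l1 t) <= t - s.
  by move=> ? ? ?; rewrite !gl; [apply: (arclength_lip H1)| |]; lra.
have Len1 s t : 0 <= s -> s <= t -> t <= l1 -> length_ge (glue g1 g2 l1) s t (t - s).
  move=> s0 st tl1; have L := arclength_length H1 s0 st tl1.
  by apply: length_ge_ext L => u ? ?; rewrite gl//; lra.
apply/arclengthP; first exact: addr_ge0.
split=> s t s0 st tl; case: (leP t l1) => tl1; [exact: Lip1| |exact: Len1|].
  case: (leP l1 s) => sl1; first exact: Lip2.
  apply: le_trans (mdist_tri _ (glue g1 g2 l1 l1) _) _.
  rewrite -(subrKA l1 t) [leRHS]addrC lerD//; [apply: Lip1|apply: Lip2]; lra.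
case: (leP l1 s) => sl1; first exact: Len2.
rewrite -(subrKA l1 t) [X in length_ge _ _ _ X]addrC.
by apply: (length_ge_cat (b := l1)); [apply: Len1|apply: Len2]; lra.
Qed.

Lemma geodesic_arclength (g : R -> Y) x y : geodesic d g x y -> arclength d g (d x y).
Proof.
case=> g0 g1 H; have H' s t : 0 <= s -> s <= t -> t <= d x y -> d (g s) (g t) = t - s.
  move=> s0 st tl; rewrite H; [rewrite distrC ger0_norm// subr_ge0//|apply/andP; lra..].
apply/arclengthP; first exact: mdist_ge0.
split=> s t s0 st tl; rewrite -H'//; exact: length_ge_dist.
Qed.

End Curves.

Lemma dball_dopen {R : realType} {Y : Type} (dY : Y -> Y -> R) x r : is_metric dY ->
  dopen dY (dball dY x r).
Proof.
move=> md y; rewrite /dball /= => xy; exists (r - dY x y); split; first by rewrite subr_gt0.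
by move=> z /=; rewrite /dball /= => yz; have := mdist_tri md x y z; lra.
Qed.

(** * Measures with a density *)

Section Density.
Context dd (T : measurableType dd) (R : realType).
Variables (mu : {measure set T -> \bar R}) (w : T -> R).
Hypothesis mw : measurable_fun [set: T] w.
Hypothesis w0 : forall x, 0 <= w x.

Definition dens (A : set T) : \bar R := (\int[mu]_(x in A) (w x)%:E)%E.

Let dens0 : dens set0 = 0%E. Proof. by rewrite /dens integral_set0. Qed.

Let dens_ge0 A : (0 <= dens A)%E.
Proof. by apply: integral_ge0 => x _; rewrite lee_fin. Qed.

Let dens_sigma_additive : semi_sigma_additive dens.
Proof.
move=> /= F mF tF mUF; rewrite /dens; apply: cvg_toP.
  apply: ereal_nondecreasing_is_cvgn => m n mn.
  by apply: lee_sum_nneg_natr => // k _ _; exact: dens_ge0.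
rewrite ge0_integral_bigcup//.
- by apply/measurable_EFinP; exact: measurable_funTS.
- by move=> x _; rewrite lee_fin.
Qed.

HB.instance Definition _ := isMeasure.Build _ _ _ dens dens0 dens_ge0 dens_sigma_additive.

Definition density : {measure set T -> \bar R} := dens.

Import HBNNSimple.
Local Open Scope ereal_scope.

(** True for indicators by definition of [dens], for simple functions by additivity, and in general
    by monotone convergence along [nnsfun_approx]. *)
Lemma ge0_integral_density (f : T -> \bar R) E : measurable E ->
  (forall x, 0 <= f x)%E -> measurable_fun E f ->
  (\int[density]_(x in E) f x = \int[mu]_(x in E) (f x * (w x)%:E))%E.
Proof.
move=> mE f0 mf; pose h := nnsfun_approx mE mf.
have mwE : measurable_fun E (EFin \o w) by apply/measurable_EFinP; exact: measurable_funTS.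
transitivity (lim (\int[density]_(x in E) (EFin \o h n) x @[n --> \oo])).
  have fE x : E x -> f x = lim ((EFin \o h n) x @[n --> \oo]).
    by move=> Ex; apply/esym/cvg_lim => //; exact: cvg_nnsfun_approx.
  under eq_integral => x /[!in_setE] /fE -> //.
  apply: monotone_convergence => //.
  - move=> n; apply/measurable_EFinP.
    by apply: (measurable_funS measurableT) => //; exact/measurable_funP.
  - by move=> n x Ex //=; rewrite lee_fin.
  - by move=> x Ex a b ab; rewrite lee_fin; exact/lefP/nd_nnsfun_approx.
apply/esym; transitivity (lim ((\int[mu]_(x in E) ((EFin \o h n) x * (w x)%:E)) @[n --> \oo])).
  have fg x : E x -> (f x * (w x)%:E)%E = lim (((EFin \o h n) x * (w x)%:E) @[n --> \oo]).
    by move=> Ex; apply/esym/cvg_lim => //; apply: cvgeZr => //; exact: cvg_nnsfun_approx.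
  under eq_integral => x /[!in_setE] /fg -> //.
  apply: monotone_convergence => [//| | |].
  - by move=> n; apply/emeasurable_funM => //; apply/measurable_EFinP; exact: measurable_funTS.
  - by move=> n x Ex /=; rewrite mule_ge0 ?lee_fin.
  - by move=> x Ex a b ab/=; rewrite lee_wpmul2r ?lee_fin//; exact/lefP/nd_nnsfun_approx.
suff suf n : (\int[mu]_(x in E) ((EFin \o h n) x * (w x)%:E) =
    \int[density]_(x in E) (EFin \o h n) x)%E.
  by under eq_fun do rewrite suf.
transitivity (\int[density]_(x in E)
   (\sum_(y \in range (h n)) (y * \1_(h n @^-1` [set y]) x)%:E))%E; last first.
  by apply: eq_integral => t tE; rewrite /= fimfunE -fsumEFin.
have indich m r : measurable_fun E (fun x => (r * \1_(h m @^-1` [set r]) x)%:E).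
  by apply: (measurable_comp measurableT) => //; exact: measurable_funM.
rewrite ge0_integral_fsum//; last by move=> m y Ey; exact: nnfun_muleindic_ge0.
transitivity (\int[mu]_(x in E) (\sum_(y \in range (h n))
   ((y * \1_(h n @^-1` [set y]) x)%:E * (w x)%:E)))%E.
  apply: eq_integral => t tE; rewrite /= fimfunE -fsumEFin//.
  rewrite ge0_mule_fsuml// => y; exact: nnfun_muleindic_ge0.
rewrite ge0_integral_fsum//; last 2 first.
  - by move=> y; apply: emeasurable_funM.
  - by move=> m y Ey; rewrite mule_ge0 ?lee_fin//; exact: nnfun_muleindic_ge0.
apply: eq_fsbigr => r rh.
rewrite integralZl_indic_nnsfun//=.
rewrite [RHS](_ : _ = r%:E * dens (h n @^-1` [set r] `&` E))%E; last first.
  by congr (_ * _)%E; rewrite integral_indic.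
under eq_integral do rewrite EFinM -muleA.
have [r0|r0] := leP 0%R r; last first.
  rewrite preimage_nnfun0// set0I /dens integral_set0 mule0.
  by apply: integral0_eq => x _; rewrite indicE in_set0 mul0e mule0.
rewrite ge0_integralZl_EFin//; last 2 first.
- by move=> x _; rewrite mule_ge0 ?lee_fin.
- by apply: emeasurable_funM => //; apply/measurable_EFinP; exact: measurable_indic.
congr (_ * _); rewrite /dens integral_mkcondl; apply: eq_integral => x _.
by rewrite patchE indicE; case: ifP => xr; rewrite ?mul1e ?mul0e.
Qed.

End Density.

(** * Change of variables on the line and integrals of bounded functions over intervals *)

Section ChangeOfVariables.
Context {R : realType}.
Notation lam := (@lebesgue_measure R).

(** The image under [S] of the measure with density [f] agrees with Lebesgue measure on half-open
    intervals, hence on all Borel sets by uniqueness. [S] need not be differentiated: it will be a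
    shift, a reflection, or a primitive of [f]. *)
Lemma change_of_var (S f : R -> R) (h : R -> \bar R) :
  measurable_fun [set: R] S -> measurable_fun [set: R] f -> (forall x, 0 <= f x) ->
  (forall a b : R, a < b ->
    (\int[lam]_(t in S @^-1` `]a, b]%classic) (f t)%:E = (b - a)%:E)%E) ->
  measurable_fun [set: R] h -> (forall x, 0 <= h x)%E ->
  forall D, measurable D ->
  (\int[lam]_(t in S @^-1` D) (h (S t) * (f t)%:E) = \int[lam]_(s in D) h s)%E.
Proof.
move=> mS mf f0 H mh h0 D mD.
have mS' : measurable_fun [set: R] (S : R -> measurableTypeR R) by [].
pose m := density lam mf f0.
have E A : measurable A -> lam A = pushforward m (S : R -> measurableTypeR R) A.
  move=> mA; apply: lebesgue_measure_unique => // _ [[a b] _ <-] /=.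
  rewrite lebesgue_measure_itv /= lte_fin /pushforward /m /density /= /dens.
  case: ltP => ab; first by rewrite H// EFinB.
  by rewrite set_itv_ge ?bnd_simp -?leNgt// preimage_set0 integral_set0.
rewrite -[RHS](@eq_measure_integral _ _ _ _ _ (pushforward m (S : R -> measurableTypeR R))); last first.
  by move=> A mA _; apply/esym; apply: E.
rewrite ge0_integral_pushforward//; last exact: measurable_funTS.
rewrite ge0_integral_density//.
- by rewrite -[X in measurable X]setTI; apply: mS.
- by move=> x /=.
- move=> mSD B mB; apply: measurableI => //.
  by have := measurableT_comp mh mS measurableT mB; rewrite setTI.
Qed.

End ChangeOfVariables.

Section BoundedIntegral.
Context {R : realType}.
Notation lam := (@lebesgue_measure R).
Variables (f : R -> R) (M : R).
Hypothesis mf : measurable_fun [set: R] f.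
Hypothesis f0 : forall x, 0 <= f x.
Hypothesis fM : forall x, f x <= M.

Definition Jint (f : R -> R) (a b : R) : R :=
  fine (\int[lam]_(t in `[a, b]%classic) (f t)%:E)%E.

Lemma integral_itv_cst (a b m : R) : a <= b ->
  (\int[lam]_(t in `[a, b]%classic) (cst m%:E t))%E = (m * (b - a))%:E.
Proof.
move=> ab; rewrite integral_cst//= lebesgue_measure_itv /= lte_fin EFinM.
case: ltP => [_|ba]; first by rewrite EFinB.
have -> : b = a by apply/eqP; rewrite eq_le ba ab.
by rewrite subrr.
Qed.

Lemma integral_itv_one (i : interval R) :
  (\int[lam]_(t in [set` i]) (cst 1 t)%:E)%E = lam [set` i].
Proof. by rewrite -[LHS]/(\int[lam]_(t in [set` i]) (cst 1%:E t))%E integral_cst// mul1e. Qed.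

Lemma JintE (a b : R) : (\int[lam]_(t in `[a, b]%classic) (f t)%:E)%E = (Jint f a b)%:E.
Proof.
rewrite /Jint fineK// ge0_fin_numE; last by apply: integral_ge0 => x _; rewrite lee_fin.
case: (leP a b) => ab; last first.
  by rewrite set_itv_ge ?integral_set0// bnd_simp -ltNge.
apply: (@le_lt_trans _ _ (\int[lam]_(t in `[a, b]%classic) (cst M%:E t))%E).
  apply: ge0_le_integral => //.
  - by move=> x _; rewrite lee_fin.
  - by apply/measurable_EFinP; exact: measurable_funTS.
  - by move=> x _; rewrite lee_fin.
by rewrite integral_itv_cst// ltry.
Qed.

Lemma Jint_ub (a b m : R) : a <= b -> (forall t, a <= t -> t <= b -> f t <= m) ->
  Jint f a b <= m * (b - a).
Proof.
move=> ab H; rewrite -lee_fin -JintE.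
have m0 : 0 <= m by apply: le_trans (f0 a) (H a _ _).
apply: (@le_trans _ _ (\int[lam]_(t in `[a, b]%classic) (cst m%:E t))%E).
  apply: ge0_le_integral => //.
  - by move=> x _; rewrite lee_fin.
  - by apply/measurable_EFinP; exact: measurable_funTS.
  - by move=> x /=; rewrite in_itv/= => /andP[ax xb]; rewrite lee_fin H.
by rewrite integral_itv_cst.
Qed.

Lemma Jint_lb (a b m : R) : 0 <= m -> a <= b -> (forall t, a <= t -> t <= b -> m <= f t) ->
  m * (b - a) <= Jint f a b.
Proof.
move=> m0 ab H; rewrite -lee_fin -JintE.
apply: (@le_trans _ _ (\int[lam]_(t in `[a, b]%classic) (cst m%:E t))%E).
  by rewrite integral_itv_cst.
apply: ge0_le_integral => //.
- by apply/measurable_EFinP; exact: measurable_funTS.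
- by move=> x /=; rewrite in_itv/= => /andP[ax xb]; rewrite lee_fin H.
Qed.

Lemma Jint_split (a b c : R) : a <= b -> b <= c -> Jint f a c = Jint f a b + Jint f b c.
Proof.
move=> ab bc; apply/EFin_inj; rewrite EFinD -!JintE.
have E : `[a, c]%classic = `[a, b]%classic `|` `]b, c]%classic.
  by rewrite -itv_bndbnd_setU//= bnd_simp.
have mfE D : measurable_fun D (EFin \o f).
  by apply/measurable_EFinP; exact: measurable_funTS.
rewrite E ge0_integral_setU//.
- by congr (_ + _)%E; rewrite integral_itv_obnd_cbnd.
- exact: mfE.
- by move=> x _; rewrite lee_fin.
- rewrite disj_set2E; apply/eqP/seteqP; split => // x /=; rewrite !in_itv/=.
  by case=> /andP[_ xb] /andP[bx _]; move: bx; rewrite ltNge xb.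
Qed.

Lemma Jint_shift (a b c : R) : Jint (fun t => f (c + t)) a b = Jint f (c + a) (c + b).
Proof.
have H := @change_of_var R (fun t => c + t) (cst 1) (EFin \o f).
rewrite /Jint; congr fine; rewrite -H//.
- rewrite (_ : (fun t => c + t) @^-1` _ = `[a, b]%classic).
    by apply: eq_integral => t _ /=; rewrite mule1.
  by apply/seteqP; split => x /=; rewrite !in_itv/= !lerD2l.
- exact: measurable_funD.
- move=> u v uv; rewrite (_ : _ @^-1` _ = `]u - c, v - c]%classic).
    rewrite integral_itv_one lebesgue_measure_itv/= lte_fin ltrD2r uv -EFinB.
    by congr (_ %:E); lra.
  by apply/seteqP; split => x /=; rewrite !in_itv/=; lra.
- exact/measurable_EFinP.
Qed.

Lemma Jint_rev (a b c : R) : Jint (fun t => f (c - t)) a b = Jint f (c - b) (c - a).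
Proof.
have H := @change_of_var R (fun t => c - t) (cst 1) (EFin \o f).
rewrite /Jint; congr fine; rewrite -H//.
- rewrite (_ : (fun t => c - t) @^-1` _ = `[a, b]%classic).
    by apply: eq_integral => t _ /=; rewrite mule1.
  by apply/seteqP; split => x /=; rewrite !in_itv/= !lerD2l !lerN2 andbC.
- exact: measurable_funB.
- move=> u v uv; rewrite (_ : _ @^-1` _ = `[c - v, c - u[%classic).
    rewrite integral_itv_one lebesgue_measure_itv/= lte_fin.
    have -> : c - v < c - u by lra.
    by rewrite -EFinB; congr (_ %:E); lra.
  by apply/seteqP; split => x /=; rewrite !in_itv/=; lra.
- exact/measurable_EFinP.
Qed.

Lemma eq_Jint (g : R -> R) a b : (forall t, a <= t -> t <= b -> g t = f t) ->
  Jint g a b = Jint f a b.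
Proof.
move=> H; rewrite /Jint; congr fine; apply: eq_integral => t; rewrite in_setE /= in_itv/=.
by case/andP=> ? ?; rewrite H.
Qed.

End BoundedIntegral.

(** * The metric d_eps *)

Lemma lipschitz_continuous {R : realType} (F : R -> R) (K : R) : 0 < K ->
  (forall s t, `|F s - F t| <= K * `|s - t|) -> continuous F.
Proof.
move=> K0 H x; apply/cvgrPdist_lt => e e0.
near=> t; apply: le_lt_trans (H _ _) _; rewrite mulrC -ltr_pdivlMr//.
by near: t; apply: cvgr_dist_lt => //; exact: divr_gt0.
Unshelve. all: by end_near. Qed.

(** Curves are controlled on [0, l] only; composing with [clamp l] extends what depends on them to a
    function on the whole line, where continuity and measurability are stated. *)
Definition clamp {R : realType} (l t : R) : R := Num.max 0 (Num.min t l).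

Lemma clamp_id {R : realType} (l t : R) : 0 <= t -> t <= l -> clamp l t = t.
Proof. by move=> t0 tl; rewrite /clamp min_l// max_r. Qed.

Lemma clamp_itv {R : realType} (l t : R) : 0 <= l -> 0 <= clamp l t <= l.
Proof. by move=> l0; rewrite /clamp le_max lexx/= ge_max l0 ge_min lexx orbT. Qed.

Lemma clamp_lip {R : realType} (l s t : R) : 0 <= l -> s <= t ->
  clamp l s <= clamp l t /\ clamp l t - clamp l s <= t - s.
Proof.
move=> l0 st; rewrite /clamp; case: (leP t l) => tl.
  rewrite (min_l (le_trans st tl)); case: (leP 0 s) => s0.
    by rewrite (max_r (le_trans s0 st)).
  by case: (leP 0 t) => t0; split; lra.
rewrite (max_r l0); case: (leP s l) => sl; last by rewrite (max_r l0) subrr subr_ge0.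
by case: (leP 0 s) => s0; split; lra.
Qed.

Section Uniformization.
Context {R : realType} {X : Type} (d : X -> X -> R) (z0 : X) (eps : R).
Hypothesis md : is_metric d.
Hypothesis eps0 : 0 < eps.
Notation rho := (rho_eps d z0 eps).
Notation lam := (@lebesgue_measure R).

Lemma rho_gt0 x : 0 < rho x. Proof. exact: expR_gt0. Qed.
Lemma rho_ge0 x : 0 <= rho x. Proof. exact: expR_ge0. Qed.
Lemma rho_le1 x : rho x <= 1.
Proof. by rewrite /rho_eps -expR0 ler_expR oppr_le0 mulr_ge0 ?(mdist_ge0 md)// ltW. Qed.
Lemma rho_mul x y : rho y <= expR (eps * d x y) * rho x.
Proof.
rewrite /rho_eps -expRD ler_expR -mulrN -mulrN -mulrDr ler_pM2l//.
by have := mdist_tri md x y z0; lra.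
Qed.

Lemma rho_mulN x y : expR (- (eps * d x y)) * rho x <= rho y.
Proof.
rewrite expRN -ler_pdivlMl ?invr_gt0 ?expR_gt0// invrK.
by have := rho_mul y x; rewrite (mdistC md).
Qed.

Lemma rho_lip x y : `|rho x - rho y| <= eps * d x y.
Proof.
suff H a b : rho a - rho b <= eps * d a b.
  by have := H x y; have := H y x; rewrite (mdistC md y x) ler_norml => ? ?; apply/andP; split; lra.
have := rho_mulN a b; have := expR_ge1Dx (- (eps * d a b)).
have : 0 <= eps * d a b by rewrite mulr_ge0 ?(mdist_ge0 md)// ltW.
have := rho_le1 a; have := rho_ge0 a; move: (eps * d a b) => q r0 r1 q0 E F.
have : (1 - q) * rho a <= expR (- q) * rho a by apply: ler_wpM2r.
have : q * rho a <= q * 1 by rewrite ler_wpM2l.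
lra.
Qed.

Definition rlen (g : R -> X) (l : R) : R :=
  fine (line_int (fun z => (rho z)%:E) g l).

Let fc (g : R -> X) (l : R) t := rho (g (clamp l t)).

Lemma clampE g l t : 0 <= t -> t <= l -> fc g l t = rho (g t).
Proof. by move=> t0 tl; rewrite /fc clamp_id. Qed.

Let mfc g l : arclength d g l -> measurable_fun [set: R] (fc g l).
Proof.
move=> H; have l0 := arclength_ge0 H; apply: continuous_measurable_fun; apply: (lipschitz_continuous eps0) => s t.
wlog st : s t / s <= t.
  by move=> W; case: (leP s t) => [/W//|/ltW/W]; rewrite distrC (distrC t).
apply: le_trans (rho_lip _ _) _; rewrite ler_pM2l//.
have [c1 c2] := clamp_lip l0 st; rewrite (distrC s) (ger0_norm (x := t - s)) ?subr_ge0//.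
apply: le_trans c2; have /andP[a1 a2] := clamp_itv s l0; have /andP[b1 b2] := clamp_itv t l0.
exact: arclength_lip H _ _ _ _ _.
Qed.

Let fc0 g l t : 0 <= fc g l t. Proof. exact: rho_ge0. Qed.
Let fc1 g l t : fc g l t <= 1. Proof. exact: rho_le1. Qed.

Lemma rlen_clamp g l : rlen g l = Jint (fc g l) 0 l.
Proof.
rewrite /rlen /line_int /Jint; congr fine; apply: eq_integral => t.
by rewrite in_setE /= in_itv/= => /andP[? ?]; rewrite clampE.
Qed.

Lemma rlenE g l : arclength d g l ->
  line_int (fun z => (rho z)%:E) g l = (rlen g l)%:E.
Proof.
move=> H; rewrite rlen_clamp -(JintE (mfc H) (@fc0 g l) (@fc1 g l)).
apply: eq_integral => t; rewrite in_setE /= in_itv/= => /andP[? ?].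
by rewrite clampE.
Qed.

Lemma rlen_ge0 g l : 0 <= rlen g l.
Proof. by apply: fine_ge0; apply: integral_ge0 => t _; rewrite lee_fin rho_ge0. Qed.

Lemma rlen_ub g l m : arclength d g l ->
  (forall t, 0 <= t -> t <= l -> rho (g t) <= m) -> rlen g l <= m * l.
Proof.
move=> H B; rewrite rlen_clamp -[X in m * X]subr0.
apply: (Jint_ub (M := 1)) => //; [exact: mfc|exact: arclength_ge0 H|].
by move=> t t0 tl; rewrite clampE// B.
Qed.

Lemma rlen_lb g l m : arclength d g l -> 0 <= m ->
  (forall t, 0 <= t -> t <= l -> m <= rho (g t)) -> m * l <= rlen g l.
Proof.
move=> H m0 B; rewrite rlen_clamp -[X in m * X]subr0.
apply: (Jint_lb (M := 1)) => //; [exact: mfc|exact: arclength_ge0 H|].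
by move=> t t0 tl; rewrite clampE// B.
Qed.

Lemma eq_rlen g g' l : (forall t, 0 <= t -> t <= l -> g t = g' t) -> rlen g l = rlen g' l.
Proof.
move=> H; rewrite !rlen_clamp; apply: eq_Jint => t t0 tl.
by rewrite !clampE// H.
Qed.

Lemma rlen_split g l a : arclength d g l -> 0 <= a -> a <= l ->
  rlen g l = rlen g a + rlen (fun t => g (a + t)) (l - a).
Proof.
move=> H a0 al; rewrite !rlen_clamp (Jint_split (mfc H) (@fc0 _ _) (@fc1 _ _) a0 al).
apply: (congr2 +%R).
  by apply: eq_Jint => t t0 ta; rewrite (clampE g t0 ta) (clampE g t0 (le_trans ta al)).
have -> : Jint (fc g l) a l = Jint (fc g l) (a + 0) (a + (l - a)).
  by rewrite addr0 [a + (l - a)]addrC subrK.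
rewrite -(Jint_shift (mfc H) (@fc0 _ _)).
by apply: eq_Jint => t t0 ta; rewrite !clampE ?addr_ge0// -lerBrDl.
Qed.

Lemma rlen_rev g l : arclength d g l -> rlen (fun t => g (l - t)) l = rlen g l.
Proof.
move=> H; rewrite !rlen_clamp; have := Jint_rev (mfc H) (@fc0 _ _) 0 l l.
rewrite subrr subr0 => <-; by apply: eq_Jint => t t0 ta; rewrite !clampE// ?subr_ge0// gerBl.
Qed.

Lemma rlen_glue g1 l1 g2 l2 : arclength d g1 l1 -> arclength d g2 l2 -> g1 l1 = g2 0 ->
  rlen (glue g1 g2 l1) (l1 + l2) = rlen g1 l1 + rlen g2 l2.
Proof.
move=> H1 H2 E; have l10 := arclength_ge0 H1; have l20 := arclength_ge0 H2.
have l12 : l1 <= l1 + l2 by rewrite lerDl.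
rewrite (rlen_split (arclength_glue md H1 H2 E) l10 l12).
apply: (congr2 +%R); first by apply: eq_rlen => t t0 tl; rewrite glue_l.
rewrite [l1 + _]addrC addrK; apply: eq_rlen => t t0 tl; rewrite (glue_r E); last by rewrite lerDl.
by rewrite [l1 + t]addrC addrK.
Qed.

Hypothesis geo : geodesic_space d.
Notation de := (d_eps d z0 eps).

Let curves x y : set (\bar R) := [set v | exists (g : R -> X) (l : R),
     [/\ arclength d g l, g 0 = x, g l = y &
         v = line_int (fun z => (rho z)%:E) g l]].

Let inf_fin x y : ereal_inf (curves x y) \is a fin_num.
Proof.
rewrite ge0_fin_numE; last first.
  by apply: le_ereal_inf_tmp => _ [g [l [H _ _ ->]]]; rewrite rlenE// lee_fin rlen_ge0.
have [g /[dup] [[g0 g1 _]] /(geodesic_arclength md) H] := geo x y.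
apply: (@le_lt_trans _ _ (line_int (fun z => (rho z)%:E) g (d x y))).
  by apply: ereal_inf_lbound; exists g, (d x y).
by rewrite rlenE// ltry.
Qed.

Lemma de_le g l : arclength d g l -> de (g 0) (g l) <= rlen g l.
Proof.
move=> H; rewrite -lee_fin -rlenE// /d_eps fineK ?inf_fin//.
by apply: ereal_inf_lbound; exists g, l.
Qed.

Lemma de_lb x y c :
  (forall g l, arclength d g l -> g 0 = x -> g l = y -> c <= rlen g l) -> c <= de x y.
Proof.
move=> B; rewrite -lee_fin /d_eps fineK ?inf_fin//.
apply: le_ereal_inf_tmp => _ [g [l [H g0 gl ->]]]; rewrite rlenE// lee_fin; exact: B.
Qed.

Lemma de_approx x y e : 0 < e ->
  exists g l, [/\ arclength d g l, g 0 = x, g l = y & rlen g l < de x y + e].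
Proof.
move=> e0; apply: contrapT => N.
suff : de x y + e <= de x y by lra.
apply: de_lb => g l H g0 gl; rewrite leNgt; apply/negP => L.
by apply: N; exists g, l.
Qed.

Lemma de_ge0 x y : 0 <= de x y.
Proof. by apply: de_lb => g l _ _ _; exact: rlen_ge0. Qed.

(** Every curve from [x] to [y] has d-length at least [L], and on its initial piece of length [L]
    the density has dropped by at most exp(-eps L). Used with [L = d x y] for close points and with
    [L = eps^-1] for distant ones. *)
Lemma de_initial x y L : 0 <= L -> L <= d x y -> L * expR (- (eps * L)) * rho x <= de x y.
Proof.
move=> L0 Ld; apply: de_lb => g l H g0 gl.
have l0 := arclength_ge0 H.
have dl : d x y <= l by rewrite -g0 -gl -[leRHS]subr0; apply: (arclength_lip H).
rewrite (rlen_split H (a := L))//; last lra.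
apply: (@le_trans _ _ (rlen g L)); last by rewrite lerDl rlen_ge0.
rewrite -mulrA mulrC; apply: rlen_lb.
- have := arclength_sub H (a := 0) (b := L).
  rewrite subr0 => /(_ (lexx _) L0 (le_trans Ld dl)); congr arclength.
  by apply/funext => t; rewrite add0r.
- by rewrite mulr_ge0 ?expR_ge0.
- move=> t t0 tL; apply: le_trans (rho_mulN (g 0) (g t)).
  rewrite g0 ler_wpM2r ?rho_ge0// ler_expR lerN2 ler_pM2l// -g0.
  apply: (le_trans _ tL); rewrite -[leRHS]subr0; apply: (arclength_lip H) => //; lra.
Qed.

Lemma de_sym x y : de x y = de y x.
Proof.
apply/eqP; rewrite eq_le.
suff S a b : de a b <= de b a by rewrite !S.
apply: de_lb => g l H g0 gl; rewrite -rlen_rev// -{1}gl -g0.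
by have := de_le (arclength_rev md H); rewrite subrr subr0.
Qed.

Lemma de_tri x y z : de x z <= de x y + de y z.
Proof.
apply/ler_addgt0Pr => e e0; have e2 : 0 < e / 2 by rewrite divr_gt0.
have [g1 [l1 [H1 a1 b1 L1]]] := de_approx x y e2.
have [g2 [l2 [H2 a2 b2 L2]]] := de_approx y z e2.
have E : g1 l1 = g2 0 by rewrite b1 a2.
have l10 := arclength_ge0 H1; have l20 := arclength_ge0 H2.
have := de_le (arclength_glue md H1 H2 E); rewrite rlen_glue// glue_l// a1.
rewrite (glue_r E); last by rewrite lerDl.
rewrite [l1 + _]addrC addrK b2; lra.
Qed.

Lemma de_metric : is_metric de.
Proof.
split; [exact: de_ge0| |exact: de_sym|exact: de_tri] => x y; split=> [E|->].
  apply: (mdist_eq0 md); apply/eqP; rewrite eq_le (mdist_ge0 md) andbT leNgt; apply/negP => D.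
  have := de_initial (ltW D) (lexx (d x y)); rewrite E leNgt; apply/negP; rewrite negbK.
  by rewrite !mulr_gt0 ?expR_gt0 ?rho_gt0.
apply/eqP; rewrite eq_le de_ge0 andbT.
have [g G] := geo y y; have := G => -[g0 g1 _].
have := de_le (geodesic_arclength md G); rewrite g0 g1 => /le_trans; apply.
apply: le_trans (rlen_ub (m := 1) (geodesic_arclength md G) _) _.
  by move=> t _ _; exact: rho_le1.
by rewrite (mdist0 md) mulr0.
Qed.

Lemma arclength_take g l b : arclength d g l -> 0 <= b -> b <= l -> arclength d g b.
Proof.
move=> H b0 bl; have := arclength_sub H (lexx 0) b0 bl.
by rewrite subr0; congr arclength; apply/funext => t; rewrite add0r.
Qed.

Lemma rlen_sub g l a b : arclength d g l -> 0 <= a -> a <= b -> b <= l ->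
  [/\ de (g a) (g b) <= rlen g b - rlen g a, rlen g b - rlen g a <= b - a &
      forall m, 0 <= m -> (forall t, a <= t -> t <= b -> m <= rho (g t)) ->
        m * (b - a) <= rlen g b - rlen g a].
Proof.
move=> H a0 ab bl; have Hb := arclength_take H (le_trans a0 ab) bl.
rewrite (rlen_split Hb a0 ab) addrC addKr.
have A := arclength_sub Hb a0 ab (lexx b); split.
- by have := de_le A; rewrite addr0 [a + _]addrC subrK.
- rewrite -[leRHS]mul1r; apply: rlen_ub => // t _ _; exact: rho_le1.
- move=> m m0 B; apply: rlen_lb => // t t0 tb; apply: B; lra.
Qed.

Lemma rlen_continuous g l : arclength d g l -> continuous (fun s => rlen g (clamp l s)).
Proof.
move=> H; have l0 := arclength_ge0 H; apply: (@lipschitz_continuous _ _ 1) => // s t.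
wlog st : s t / s <= t.
  by move=> W; case: (leP s t) => [/W//|/ltW/W]; rewrite distrC (distrC t).
have [c1 c2] := clamp_lip l0 st.
have /andP[a1 a2] := clamp_itv s l0; have /andP[b1 b2] := clamp_itv t l0.
have [_ u /(_ 0)] := rlen_sub H a1 c1 b2; rewrite mul0r => v.
have {}v : 0 <= rlen g (clamp l t) - rlen g (clamp l s) by apply: v => // ? _ _; exact: rho_ge0.
rewrite mul1r distrC ger0_norm// distrC ger0_norm ?subr_ge0//; lra.
Qed.

Lemma rlen0 g : rlen g 0 = 0.
Proof. by rewrite /rlen /line_int set_itv1 integral_set1. Qed.

Lemma rlen_value g l v : arclength d g l -> 0 <= v -> v <= rlen g l ->
  exists s, [/\ 0 <= s, s <= l & rlen g s = v].
Proof.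
move=> H v0 vl; have l0 := arclength_ge0 H.
have [||c] := @IVT R (fun s => rlen g (clamp l s)) 0 l v l0.
- by apply: continuous_subspaceT; exact: rlen_continuous.
- by rewrite !clamp_id// rlen0 min_l ?rlen_ge0// max_r ?rlen_ge0// v0.
- by rewrite in_itv/= => /andP[c0 cl]; rewrite clamp_id// => E; exists c.
Qed.

(** Substitute for a point on a d_eps-geodesic: an almost minimizing curve is cut where its
    d_eps-length reaches [t]. *)
Lemma de_between x y t e : 0 <= t -> t <= de x y -> 0 < e ->
  exists z, de x z <= t /\ de z y <= de x y - t + e.
Proof.
move=> t0 td e0; have [g [l [H g0 gl L]]] := de_approx x y e0.
have [||s [s0 sl E]] := rlen_value (v := t) H => //.
  by apply: le_trans td _; have := de_le H; rewrite g0 gl.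
have l0 := arclength_ge0 H; exists (g s); split.
  by have [+ _ _] := rlen_sub H (lexx 0) s0 sl; rewrite g0 rlen0 subr0 E.
have [+ _ _] := rlen_sub H s0 sl (lexx l); rewrite gl E; lra.
Qed.

Lemma de_geod_ub g x y m : geodesic d g x y ->
  (forall t, 0 <= t -> t <= d x y -> rho (g t) <= m) -> de x y <= m * d x y.
Proof.
move=> G B; have := G => -[g0 g1 _].
have := de_le (geodesic_arclength md G); rewrite g0 g1 => /le_trans; apply.
exact: rlen_ub (geodesic_arclength md G) B.
Qed.

Lemma geod_dist g x y t : geodesic d g x y -> 0 <= t -> t <= d x y ->
  d x (g t) = t /\ d (g t) y = d x y - t.
Proof.
move=> [g0 g1 H] t0 td; split.
  rewrite -{1}g0 H ?sub0r ?normrN ?ger0_norm//; apply/andP; split => //; exact: mdist_ge0.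
rewrite -{1}g1 H ?lexx ?(mdist_ge0 md)//; last by rewrite t0.
by rewrite distrC ger0_norm// subr_ge0.
Qed.

Lemma de_ub x y : de x y <= d x y * expR (eps * d x y) * rho x.
Proof.
have [g G] := geo x y; rewrite -mulrA mulrC; apply: (de_geod_ub G) => t t0 td.
apply: le_trans (rho_mul x _) _; rewrite ler_wpM2r ?rho_ge0// ler_expR ler_pM2l//.
by rewrite (geod_dist G t0 td).1.
Qed.

End Uniformization.

(** * Consequences of hyperbolicity *)

(* Frink's chain lemma for quasimetrics with constant at most [sqrt 2]: split the chain
   at the first index where the partial sum reaches one half of the total. *)
Lemma frink_chain {R : realType} {T : Type} (q : T -> T -> R) (K : R) (x : nat -> T) :
  (forall a b, 0 <= q a b) -> 1 <= K -> K * K <= 2 ->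
  (forall a b c B, 0 <= B -> q a b <= B -> q b c <= B -> q a c <= K * B) ->
  forall i j, (i < j)%N -> q (x i) (x j) <= 2 * \sum_(i <= k < j) q (x k) (x k.+1).
Proof.
move=> q0 K1 K2 H.
have H2 a b c B : 0 <= B -> q a b <= B -> q b c <= B -> q a c <= 2 * B.
  move=> B0 h1 h2; apply: le_trans (H _ _ _ _ B0 h1 h2) _; apply: ler_wpM2r => //; nra.
have H3 a b c e B : 0 <= B -> q a b <= B -> q b c <= B -> q c e <= B -> q a e <= 2 * B.
  move=> B0 h1 h2 h3; have h := H _ _ _ _ B0 h1 h2.
  have BK : B <= K * B by rewrite ler_peMl.
  have := H _ _ _ _ (le_trans B0 BK) h (le_trans h3 BK).
  move/le_trans; apply; rewrite mulrA ler_wpM2r//.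
have S0 i j : 0 <= \sum_(i <= k < j) q (x k) (x k.+1) by apply: sumr_ge0.
move=> i j; move: {2}(j - i)%N (leqnn (j - i)) => n.
elim: n i j => [|n IH] i j nij ij; first by move: nij; rewrite leqn0 subn_eq0 leqNgt ij.
set S := \sum_(i <= k < j) _.
have ex : exists m, (i < m)%N && (S <= 2 * \sum_(i <= k < m) q (x k) (x k.+1)).
  by exists j; rewrite ij /=; have := S0 i j; rewrite -/S; lra.
(* As [m] is least, the links before the one ending at [m] sum to less than S / 2, and those after
   it to at most S / 2. By induction both parts have [q] at most S, as has the middle link, and
   joining three pieces costs K * K <= 2. *)
case: (ex_minnP ex) => m /andP[im Sm] mmin.
have mj : (m <= j)%N by apply: mmin; rewrite ij /=; have := S0 i j; rewrite -/S; lra.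
have Sle a b : (i <= a)%N -> (a <= b)%N -> (b <= j)%N ->
    \sum_(a <= k < b) q (x k) (x k.+1) <= S.
  move=> ia ab bj; rewrite /S (big_cat_nat (m := i) (n := a) (p := j))//=; last exact: leq_trans ab bj.
  by rewrite (big_cat_nat (m := a) (n := b) (p := j))//= addrCA lerDl addr_ge0.
case: m im Sm mmin mj => // m im Sm mmin mj.
have mid : q (x m) (x m.+1) <= S.
  by have := Sle m m.+1; rewrite big_nat1; apply.
have left_ : (i < m)%N -> q (x i) (x m) <= S.
  move=> im'; apply: le_trans (IH i m _ im') _; first by lia.
  rewrite leNgt; apply/negP => L; have := mmin m; rewrite im' ltW//= => /(_ isT); lia.
have right_ : (m.+1 < j)%N -> q (x m.+1) (x j) <= S.
  move=> mj'; apply: le_trans (IH _ _ _ mj') _; first by lia.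
  have E : S = \sum_(i <= k < m.+1) q (x k) (x k.+1) + \sum_(m.+1 <= k < j) q (x k) (x k.+1).
    exact: (big_cat_nat (ltnW im) mj).
  by move: Sm E; lra.
have SS : 0 <= S := S0 _ _.
move: im; rewrite ltnS leq_eqVlt => /predU1P[E|im].
  move: mj; rewrite leq_eqVlt => /predU1P[Ej|mj].
    by rewrite E -Ej; lra.
  by rewrite E; apply: H2 SS mid (right_ mj).
move: mj; rewrite leq_eqVlt => /predU1P[Ej|mj].
  by rewrite -{1}Ej; apply: H2 SS (left_ im) mid.
by apply: H3 SS (left_ im) mid (right_ mj).
Qed.

Section Hyperbolic.
Context {R : realType} {X : Type} (d : X -> X -> R) (z0 : X) (delta : R).
Hypothesis md : is_metric d.
Hypothesis geo : geodesic_space d.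
Hypothesis delta0 : 0 <= delta.
Hypothesis hyp : gromov_hyperbolic d delta.

(** The Gromov product (x|y) based at [z0]. *)
Definition gprod x y : R := (d x z0 + d y z0 - d x y) / 2.

Lemma gprod_le_seg g x y w : geodesic d g x y -> gseg d g x y w -> gprod x y <= d w z0.
Proof.
move=> G [t /=]; rewrite in_itv/= => /andP[t0 td] <-.
have [E1 E2] := geod_dist md G t0 td.
have := mdist_tri md x (g t) z0; have := mdist_tri md y (g t) z0.
rewrite /gprod (mdistC md y (g t)) E1 E2; lra.
Qed.

(** [P] collects the parameters of points of [x, y] that are delta-close to [z0, x]. Around its
    supremum there are [t1] in [P] and, at distance at most 1, a [t2] whose point is delta-close to
    [y, z0]. So w = g t1 satisfies d(w,z0) <= d(x,z0) - d(w,x) + 2 delta and d(w,z0) <= d(y,z0) -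
    d(w,y) + 2 delta + 2; the claim is the average of the two. *)
Lemma gprod_seg g x y : geodesic d g x y ->
  exists w, gseg d g x y w /\ d w z0 <= gprod x y + 2 * delta + 1.
Proof.
move=> G; have [g2 G2] := geo y z0; have [g3 G3] := geo z0 x.
have thin := hyp G G2 G3; set D := d x y.
have D0 : 0 <= D := mdist_ge0 md x y.
pose P := [set t | [/\ 0 <= t, t <= D & exists v, gseg d g3 z0 x v /\ d (g t) v <= delta]].
have [gx gy _] := G.
have P0 : P 0.
  split => //; exists x; rewrite gx (mdist0 md); split => //.
  by exists (d z0 x) => /=; [rewrite in_itv/= lexx (mdist_ge0 md)|case: G3].
have supP : has_sup P by split; [exists 0|exists D => t []].
have s0 : 0 <= sup P by apply: ub_le_sup => //; case: supP.
have sD : sup P <= D by apply: ge_sup; [exists 0|move=> t []].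
have half : (0 : R) < 2^-1 by rewrite invr_gt0.
have [t1 [t10 t1D [v [v3 vd]]] t1s] := sup_adherent half supP.
have t1le : t1 <= sup P by apply: ub_le_sup; [case: supP|split => //; exists v].
pose t2 := Num.min D (sup P + 2^-1).
have t2D : t2 <= D by rewrite /t2 ge_min lexx.
have t20 : 0 <= t2 by rewrite /t2 le_min D0 /=; lra.
have t12 : `|t1 - t2| <= 1.
  rewrite /t2; case: (leP D (sup P + 2^-1)) => ?; rewrite ler_norml; apply/andP; split; lra.
have [b [b2 bd]] : exists b, gseg d g2 y z0 b /\ d (g t2) b <= delta.
  case: (ltP (sup P) t2) => st2; last first.
    have -> : t2 = D by move: st2; rewrite /t2; case: (leP D (sup P + 2^-1)) => ? ?; lra.
    exists y; rewrite gy (mdist0 md); split => //.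
    by exists 0 => /=; [rewrite in_itv/= lexx (mdist_ge0 md)|case: G2].
  have [|b [[b2|b3] bd]] := thin (g t2).
  - by exists t2 => //=; rewrite in_itv/= t20.
  - by exists b.
  - exfalso; have : t2 <= sup P; last by lra.
    by apply: ub_le_sup; [case: supP|split => //; exists b].
have Pw : gseg d g x y (g t1) by exists t1 => //=; rewrite in_itv/= t10.
exists (g t1); split => //.
have [E1 E2] := geod_dist md G t10 t1D.
have dt : d (g t1) (g t2) <= 1.
  by case: G => _ _ ->//; [rewrite t10|rewrite t20].
case: v3 => s3 /=; rewrite in_itv/= => /andP[s30 s3l] Ev.
have [F1 F2] := geod_dist md G3 s30 s3l; rewrite Ev in F1 F2.
case: b2 => s2 /=; rewrite in_itv/= => /andP[s20 s2l] Eb.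
have [F3 F4] := geod_dist md G2 s20 s2l; rewrite Eb in F3 F4.
have := mdist_tri md (g t1) v z0; have := mdist_tri md (g t1) v x.
have := mdist_tri md (g t1) b z0; have := mdist_tri md (g t1) b y.
have := mdist_tri md (g t1) (g t2) b.
rewrite /gprod (mdistC md v z0) (mdistC md b y) (mdistC md x z0) (mdistC md (g t1) x).
move: E1 E2 F1 F2 F3 F4 vd bd dt; rewrite -/D (mdistC md z0 x); lra.
Qed.

(** The point of [x, z] found by [gprod_seg] is delta-close to one of the other two sides, all of
    whose points are at least as far from [z0] as the Gromov product of its ends. The defect is (2
    delta + 1) + delta. *)
Lemma gprod_hyp x y z : Num.min (gprod x y) (gprod y z) <= gprod x z + (3 * delta + 1).
Proof.
have [g G] := geo x z; have [g2 G2] := geo z y; have [g3 G3] := geo y x.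
have [w [ws wd]] := gprod_seg G.
have [v [vs vd]] := hyp G G2 G3 ws.
have wv := mdist_tri md v w z0; rewrite (mdistC md v w) in wv.
have gC a b : gprod a b = gprod b a by rewrite /gprod (mdistC md a b) [d a z0 + _]addrC.
rewrite ge_min; apply/orP; case: vs => [/(gprod_le_seg G2)|/(gprod_le_seg G3)] h.
  by right; rewrite gC; lra.
by left; rewrite gC; lra.
Qed.

Variable eps : R.
Hypothesis eps0 : 0 < eps.
Hypothesis eps_le : expR (eps * (3 * delta + 1)) * expR (eps * (3 * delta + 1)) <= 2.
Notation rho := (rho_eps d z0 eps).
Notation de := (d_eps d z0 eps).

Let q x y := expR (- (eps * gprod x y)).

Let q_chain (x : nat -> X) i j : (i < j)%N ->
  q (x i) (x j) <= 2 * \sum_(i <= k < j) q (x k) (x k.+1).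
Proof.
apply: (frink_chain (K := expR (eps * (3 * delta + 1)))) => //.
- by move=> a b; exact: expR_ge0.
- by rewrite -[leLHS]expR0 ler_expR !(mulr_ge0, addr_ge0)// ltW.
- move=> a b c B B0; rewrite /q => h1 h2.
  apply: (@le_trans _ _ (expR (eps * (3 * delta + 1)) * expR (- (eps * Num.min (gprod a b) (gprod b c))))).
    rewrite -expRD ler_expR -!mulrN -mulrDr ler_pM2l//.
    by have := gprod_hyp a b c; rewrite [gprod a c]/gprod; lra.
  by rewrite ler_wpM2l ?expR_ge0//; case: (leP (gprod a b) (gprod b c)).
Qed.

(** A curve is cut into [n] pieces of d-length [tau] with 1 <= eps * tau <= 2, which is possible
    because its length is at least 1 / eps. On each piece q is at most exp(eps tau) rho, while the
    d_eps-length is at least tau exp(-eps tau) rho; their ratio is within exp 4 * eps, and the chain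
    lemma sums over the pieces. *)
Lemma gprod_de x y : eps^-1 <= d x y ->
  expR (- (eps * gprod x y)) <= 2 * expR 4 * eps * de x y.
Proof.
move=> dxy.
have C0 : 0 < 2 * expR 4 * eps by rewrite !mulr_gt0// expR_gt0.
rewrite -ler_pdivrMl//; apply: (de_lb md eps0 geo) => g l H g0 gl.
rewrite ler_pdivrMl//.
have dl : d x y <= l by rewrite -g0 -gl -[leRHS]subr0; apply: (arclength_lip H); have := arclength_ge0 H.
have l1 : 1 <= l * eps by rewrite -ler_pdivrMr// mul1r (le_trans dxy).
have l0 : 0 <= l * eps by lra.
pose n := Num.truncn (l * eps).
have n1 : (1 <= n)%N by rewrite truncn_ge_nat.
have nr1 : 1 <= n%:R :> R by rewrite ler1n.
have /andP[nl nu] : n%:R <= l * eps < n.+1%:R by apply: truncn_itv.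
pose tau := l / n%:R.
have n0 : 0 < n%:R :> R by lra.
have tau1 : 1 <= eps * tau by rewrite /tau mulrA ler_pdivlMr// mul1r mulrC.
have tau2 : eps * tau <= 2.
  by rewrite /tau mulrA ler_pdivrMr// mulrC; move: nu; rewrite -natr1; lra.
have tau0 : 0 < tau by rewrite -(pmulr_rgt0 _ eps0); lra.
have ntau : n%:R * tau = l by rewrite /tau mulrC divfK// gt_eqF.
pose x_ k := g (k%:R * tau).
have -> : x = x_ 0 by rewrite /x_ mul0r.
have -> : y = x_ n by rewrite /x_ ntau.
apply: le_trans (q_chain x_ n1) _.
rewrite -!mulrA ler_pM2l// mulrA.
have -> : rlen d z0 eps g l = \sum_(0 <= k < n)
    (rlen d z0 eps g (k.+1%:R * tau) - rlen d z0 eps g (k%:R * tau)).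
  by rewrite telescope_sumr// mul0r rlen0 subr0 ntau.
rewrite mulr_sumr; apply: ler_sum_nat => k /andP[_ kn].
have k0 : 0 <= k%:R * tau by rewrite mulr_ge0// ltW.
have k1 : k%:R * tau <= k.+1%:R * tau by rewrite ler_wpM2r ?(ltW tau0)// ler_nat.
have k2 : k.+1%:R * tau <= l by rewrite -ntau ler_wpM2r ?(ltW tau0)// ler_nat.
have kk : k.+1%:R * tau - k%:R * tau = tau by rewrite -mulrBl -natr1 addrC addKr mul1r.
have := arclength_lip H k0 k1 k2; rewrite kk -/(x_ k) -/(x_ k.+1) => lip.
have [_ _ lb] := rlen_sub z0 md eps0 geo H k0 k1 k2.
have m0 : 0 <= expR (- (eps * tau)) * rho (x_ k) by rewrite mulr_ge0 ?expR_ge0.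
have {}lb := lb _ m0 _.
have {}lb : expR (- (eps * tau)) * rho (x_ k) * tau <=
    rlen d z0 eps g (k.+1%:R * tau) - rlen d z0 eps g (k%:R * tau).
  rewrite -{2}kk; apply: lb => t t1 t2.
  apply: le_trans (rho_mulN z0 md eps0 (x_ k) _); rewrite ler_wpM2r ?rho_ge0//.
  rewrite ler_expR lerN2 ler_pM2l//; apply: (le_trans (arclength_lip H k0 t1 _)); lra.
apply: (@le_trans _ _ (expR 4 * eps * (expR (- (eps * tau)) * rho (x_ k) * tau))); last first.
  by rewrite ler_pM2l// mulr_gt0// expR_gt0.
have -> : expR 4 * eps * (expR (- (eps * tau)) * rho (x_ k) * tau) =
   (eps * tau) * (expR (4 - eps * tau) * rho (x_ k)) by rewrite (expRD 4 (- (eps * tau))); ring.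
apply: (@le_trans _ _ (expR (eps * tau) * rho (x_ k))).
  rewrite /q /rho_eps -expRD ler_expR -!mulrN -mulrDr ler_pM2l// /gprod.
  have := mdist_tri md (x_ k) (x_ k.+1) z0; lra.
apply: (@le_trans _ _ (expR (4 - eps * tau) * rho (x_ k))).
  by rewrite ler_wpM2r ?rho_ge0// ler_expR; lra.
by rewrite ler_peMl// mulr_ge0 ?expR_ge0.
Qed.

(* The lower bound on [d_eps] that needs hyperbolicity and the smallness of [eps]. *)
Lemma de_close C x y : de x y <= C * rho x -> de x y <= C * rho y ->
  expR (eps * d x y) <= Num.max (expR 1) ((2 * expR 4 * eps * C) ^+ 2).
Proof.
move=> hx hy; rewrite le_max; case: (leP (d x y) eps^-1) => dxy; apply/orP; [left|right].
  by rewrite ler_expR -(mulfV (lt0r_neq0 eps0)) ler_pM2l.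
have := gprod_de (ltW dxy); set A := 2 * expR 4 * eps => qd.
have A0 : 0 <= A by rewrite !mulr_ge0 ?expR_ge0 ?ltW.
have q0 : 0 <= expR (- (eps * gprod x y)) by exact: expR_ge0.
have qx : expR (- (eps * gprod x y)) <= A * C * rho x.
  by apply: le_trans qd _; rewrite -mulrA ler_wpM2l.
have qy : expR (- (eps * gprod x y)) <= A * C * rho y.
  by apply: le_trans qd _; rewrite -mulrA ler_wpM2l.
have := ler_pM q0 q0 qx qy.
(* The identity exp(-2 eps (x|y)) = exp(eps d(x,y)) rho(x) rho(y): multiplying the bound by [rho x]
   with the bound by [rho y] lets both weights cancel. *)
have -> : expR (- (eps * gprod x y)) * expR (- (eps * gprod x y)) =
  expR (eps * d x y) * (rho x * rho y).
  by rewrite /rho_eps -!expRD; congr expR; rewrite /gprod; lra.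
have -> : A * C * rho x * (A * C * rho y) = (A * C) ^+ 2 * (rho x * rho y) by ring.
by rewrite ler_pM2r// mulr_gt0 ?rho_gt0.
Qed.

End Hyperbolic.

Lemma expR1_le4 (R : realType) : expR 1 <= 4 :> R.
Proof.
have h := expR_ge1Dx (- 2^-1 : R).
have : expR 2^-1 * expR (- 2^-1) = 1 :> R by rewrite -expRD subrr expR0.
have -> : expR 1 = expR 2^-1 * expR 2^-1 :> R by rewrite -expRD; congr expR; lra.
have := expR_gt0 (2^-1 : R); move: (expR 2^-1) (expR (- 2^-1)) h => u v h u0 uv.
have u2 : u <= 2 by nra.
by nra.
Qed.

(** * Comparison of d and d_eps, and ancestors *)

Section Comparison.
Context {R : realType} {X : Type} (d : X -> X -> R) (z0 : X) (eps : R).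
Hypothesis md : is_metric d.
Hypothesis geo : geodesic_space d.
Hypothesis eps0 : 0 < eps.
Notation rho := (rho_eps d z0 eps).
Notation de := (d_eps d z0 eps).

Lemma de_geK K x y : expR (eps * d x y) <= K -> d x y * rho x <= K * de x y.
Proof.
move=> H; have K0 : 0 < K by apply: lt_le_trans H; exact: expR_gt0.
have := de_initial z0 md eps0 geo (mdist_ge0 md x y) (lexx _).
rewrite -(ler_pM2l K0); apply: le_trans.
have -> : K * (d x y * expR (- (eps * d x y)) * rho x) =
  (K * expR (- (eps * d x y))) * (d x y * rho x) by ring.
rewrite ler_peMl ?mulr_ge0 ?(mdist_ge0 md) ?rho_ge0//.
by rewrite expRN ler_pdivlMr ?expR_gt0// mul1r.
Qed.

Lemma de_leK K x y : expR (eps * d x y) <= K -> de x y <= K * (d x y * rho x).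
Proof.
move=> H; apply: le_trans (de_ub z0 md eps0 geo x y) _.
rewrite [d x y * _]mulrC -mulrA; apply: ler_wpM2r => //.
by rewrite mulr_ge0 ?rho_ge0// (mdist_ge0 md).
Qed.

Lemma rho_leK K x y : expR (eps * d x y) <= K -> rho x <= K * rho y.
Proof.
move=> H; apply: le_trans (rho_mul z0 md eps0 y x) _; rewrite ler_wpM2r ?rho_ge0//.
by rewrite (mdistC md).
Qed.

Lemma geod_leK K g x y t : expR (eps * d x y) <= K -> geodesic d g x y ->
  0 <= t -> t <= d x y -> expR (eps * d x (g t)) <= K /\ de x (g t) <= K ^+ 2 * de x y.
Proof.
move=> H G t0 td; have [E _] := geod_dist md G t0 td.
have H' : expR (eps * d x (g t)) <= K.
  by apply: le_trans H; rewrite ler_expR ler_pM2l// E.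
split => //; apply: le_trans (de_leK H') _.
have K0 : 0 <= K by apply: le_trans H; exact: expR_ge0.
rewrite expr2 -mulrA; apply: ler_wpM2l => //; apply: le_trans (de_geK H).
by rewrite ler_wpM2r ?rho_ge0// E.
Qed.

(** Below d-distance 1 / eps the drop of rho is at most eps d rho, beyond it at most rho itself;
    both are eps L rho for the truncated distance [L], to which [de_initial] applies. The factor 4
    bounds e. *)
Lemma rho_de_lip x y : `|rho x - rho y| <= 4 * eps * de x y.
Proof.
have md' := de_metric z0 md eps0 geo.
suff H a b : rho a - rho b <= 4 * eps * de a b.
  by have := H x y; have := H y x; rewrite (mdistC md' y x) ler_norml => ? ?; apply/andP; split; lra.
pose L := Num.min (d a b) eps^-1.
have L0 : 0 <= L by rewrite le_min (mdist_ge0 md) invr_ge0 ltW.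
have Ld : L <= d a b by rewrite ge_min lexx.
have Le : eps * L <= 1 by rewrite -(mulfV (lt0r_neq0 eps0)) ler_pM2l// ge_min lexx orbT.
have := de_initial z0 md eps0 geo L0 Ld.
have e4 := expR1_le4 R.
have h1 : 1 <= 4 * expR (- (eps * L)).
  rewrite expRN ler_pdivlMr ?expR_gt0// mul1r; apply: le_trans e4; rewrite ler_expR//.
have r0 := rho_ge0 d z0 eps a.
have main : rho a - rho b <= eps * L * rho a.
  rewrite /L; case: (leP (d a b) eps^-1) => dab; last first.
    rewrite mulfV ?lt0r_neq0// mul1r; have := rho_ge0 d z0 eps b; lra.
  have := rho_mulN z0 md eps0 a b; have := expR_ge1Dx (- (eps * d a b)) => u v.
  have := ler_wpM2r r0 u; lra.
move=> h; apply: le_trans main _.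
apply: (@le_trans _ _ (4 * eps * (L * expR (- (eps * L)) * rho a))); last first.
  by rewrite ler_wpM2l// mulr_ge0// ltW.
have -> : 4 * eps * (L * expR (- (eps * L)) * rho a) =
  (4 * expR (- (eps * L))) * (eps * L * rho a) by ring.
by rewrite ler_peMl// !mulr_ge0// ltW.
Qed.

(** Along a geodesic from [z0] the density is exp(-eps u). Pieces of length 1 / eps contribute a
    geometric series of ratio at most 1/2, whence the factor 2. *)
Lemma de_radial g x s t : geodesic d g z0 x -> 0 <= s -> s <= t -> t <= d z0 x ->
  de (g s) (g t) <= 2 / eps * expR (- (eps * s)).
Proof.
move=> G s0 st tx; have H := geodesic_arclength md G.
have C0 : 0 < 2 / eps by rewrite divr_gt0.
have rg u : 0 <= u -> u <= d z0 x -> rho (g u) = expR (- (eps * u)).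
  by move=> u0 ux; rewrite /rho_eps (mdistC md) (geod_dist md G u0 ux).1.
have piece a b : 0 <= a -> a <= b -> b <= d z0 x -> de (g a) (g b) <= expR (- (eps * a)) * (b - a).
  move=> a0 ab bx; have A := arclength_sub H a0 ab bx.
  have := de_le z0 md eps0 geo A; rewrite addr0 [a + (b - a)]addrC subrK => /le_trans; apply.
  apply: (rlen_ub md eps0 A) => u u0 ub; rewrite rg; [|lra|lra].
  by rewrite ler_expR lerN2 ler_pM2l//; lra.
have [n nb] : exists n : nat, (t - s) * eps <= n%:R.
  by exists (Num.truncn ((t - s) * eps)).+1; rewrite ltW// truncnS_gt.
elim: n s s0 st nb => [|m IH] s s0 st nb.
  have -> : s = t.
    move: nb; rewrite pmulr_lle0// => ?; lra.
  rewrite (mdist0 (de_metric z0 md eps0 geo)) mulr_ge0 ?expR_ge0 ?ltW//.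
have e0 := expR_ge0 (- (eps * s)).
have ie : 0 < eps^-1 by rewrite invr_gt0.
case: (leP (t - s) eps^-1) => ts.
  apply: le_trans (piece s t s0 st tx) _; rewrite mulrC ler_wpM2r//; lra.
have sm : s + eps^-1 <= t by lra.
have h : de (g (s + eps^-1)) (g t) <= 2 / eps * (expR (- (eps * s)) * expR (- 1)).
  have -> : expR (- (eps * s)) * expR (- 1) = expR (- (eps * (s + eps^-1))).
    by rewrite -expRD; congr expR; rewrite mulrDr mulfV ?lt0r_neq0//; lra.
  apply: IH => //; first lra.
  have -> : (t - (s + eps^-1)) * eps = (t - s) * eps - eps^-1 * eps by ring.
  by move: nb; rewrite mulVf ?lt0r_neq0// -natr1; lra.
have e12 : expR (- 1) <= 2^-1 :> R.
  by rewrite expRN lef_pV2 ?posrE ?expR_gt0//; have := expR_ge1Dx (1 : R); lra.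
apply: le_trans (mdist_tri (de_metric z0 md eps0 geo) _ (g (s + eps^-1)) _) _.
have h2 : de (g s) (g (s + eps^-1)) <= expR (- (eps * s)) * eps^-1.
  by rewrite -{2}(addrK s eps^-1) [eps^-1 + s]addrC; apply: piece => //; lra.
have := ler_wpM2l e0 e12; set E := expR (- (eps * s)) in h h2 e0 *; set F := expR (-1) in h *.
have : 2 / eps * (E * F) <= 2 / eps * (E * 2^-1) by rewrite ler_wpM2l ?(ltW C0)// ler_wpM2l.
lra.
Qed.

(** The point of a geodesic from [z0] to [x] at distance -ln v / eps from [z0]. *)
Lemma ancestor x v : rho x <= v -> v <= 1 ->
  exists a, [/\ rho a = v, d x z0 = d a z0 + d a x & de x a <= 2 / eps * v].
Proof.
move=> xv v1; have v0 : 0 < v by apply: lt_le_trans xv; exact: rho_gt0.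
have [g G] := geo z0 x; pose s := - ln v / eps.
have es : expR (- (eps * s)) = v.
  by rewrite /s mulrC divfK ?lt0r_neq0// opprK lnK.
have s0 : 0 <= s by rewrite divr_ge0 ?(ltW eps0)// oppr_ge0 ln_le0.
have sx : s <= d z0 x.
  rewrite -(ler_pM2l eps0) -lerN2 -ler_expR es; move: xv.
  by rewrite /rho_eps (mdistC md x).
have [E1 E2] := geod_dist md G s0 sx.
exists (g s); split.
- by rewrite /rho_eps (mdistC md) E1 es.
- by rewrite E2 (mdistC md (g s) z0) E1 (mdistC md x z0); lra.
- rewrite (mdistC (de_metric z0 md eps0 geo)) -es.
  by have := de_radial G s0 sx (lexx _); case: (G) => _ -> _.
Qed.

End Comparison.

(** * John chains *)

(** Discrete John curves. The telescoping will only look at the Whitney balls met at the vertices,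
    so nothing is required between them. *)
Inductive linked {R : realType} {X : Type} (d : X -> X -> R) (P : X -> Prop) (s : X -> R) :
    X -> X -> Prop :=
| linked_nil x : P x -> linked d P s x x
| linked_cons x y z : P x -> d x y <= s x -> linked d P s y z -> linked d P s x z.

Lemma linked_sub {R : realType} {X : Type} (d : X -> X -> R) (P Q : X -> Prop) s x y :
  (forall z, P z -> Q z) -> linked d P s x y -> linked d Q s x y.
Proof.
move=> PQ; elim=> [z /PQ|{x y} x y z /PQ Qx dxy _ IH]; first exact: linked_nil.
exact: linked_cons dxy IH.
Qed.

Lemma linked_trans {R : realType} {X : Type} (d : X -> X -> R) (P : X -> Prop) s x y z :
  linked d P s x y -> linked d P s y z -> linked d P s x z.
Proof. by elim=> // {x y} x y w Px dxy _ IH /IH; exact: linked_cons. Qed.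

Lemma linked_geodesic {R : realType} {X : Type} (d : X -> X -> R) (P : X -> Prop) s g x y
    (sigma : R) : is_metric d -> 0 < sigma -> geodesic d g x y ->
  (forall t, 0 <= t -> t <= d x y -> P (g t) /\ sigma <= s (g t)) -> linked d P s x y.
Proof.
move=> md s0 G H; have [gx gy Hg] := G.
suff L (n : nat) t : 0 <= t -> t <= d x y -> d x y - t <= n%:R * sigma -> linked d P s (g t) y.
  rewrite -{1}gx; apply: (L (Num.truncn (d x y / sigma)).+1) => //.
    exact: mdist_ge0.
  by rewrite subr0 -ler_pdivrMr// ltW// truncnS_gt.
elim: n t => [|n IH] t t0 td.
  rewrite mul0r => h; have -> : t = d x y by lra.
  by rewrite gy; apply: linked_nil; rewrite -gy; apply: (H _ _ _).1 => //; exact: mdist_ge0.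
move=> h; have [Pt st] := H t t0 td.
case: (leP (d x y - t) sigma) => ts.
  apply: (linked_cons Pt (y := y)); first by rewrite (geod_dist md G t0 td).2 (le_trans ts).
  by apply: linked_nil; rewrite -gy; apply: (H _ _ _).1 => //; exact: mdist_ge0.
have t1 : 0 <= t + sigma by lra.
have t2 : t + sigma <= d x y by lra.
apply: (linked_cons Pt (y := g (t + sigma))).
  rewrite Hg ?t0 ?td ?t1 ?t2//; apply: le_trans st.
  by rewrite opprD addrA subrr sub0r normrN gtr0_norm.
apply: IH => //; move: h; rewrite -natr1; lra.
Qed.

Section John.
Context {R : realType} {X Y : Type} (d : X -> X -> R) (z0 : X) (eps : R).
Hypothesis md : is_metric d.
Hypothesis geo : geodesic_space d.
Hypothesis eps0 : 0 < eps.
Notation rho := (rho_eps d z0 eps).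
Notation de := (d_eps d z0 eps).
Variables (dY : Y -> Y -> R) (iota : X -> Y).
Hypothesis mdY : is_metric dY.
Hypothesis iso : forall x y, dY (iota x) (iota y) = de x y.
Hypothesis dense : forall y e, 0 < e -> exists x, dY (iota x) y < e.
Variables (K C eta rmax : R).
Hypothesis K2 : 2 <= K.
Hypothesis C_ge : 1600 <= C.
Hypothesis closeK : forall x y, de x y <= C / eps * rho x -> de x y <= C / eps * rho y ->
  expR (eps * d x y) <= K.
Hypothesis eta0 : 0 < eta.
Hypothesis etaK : eta * (32 * K ^+ 2) <= 1.
Let theta := eta * eps / 100.
Hypothesis theta_rmax : theta * rmax <= 4^-1.

Let mde : is_metric de := de_metric z0 md eps0 geo.
Let th0 : 0 < theta. Proof. by rewrite /theta divr_gt0// mulr_gt0. Qed.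
Let K20 : 4 <= K ^+ 2. Proof. by have := K2; nra. Qed.
Let eta1 : eta <= 32^-1. Proof. by have := etaK; have := K20; have := eta0; nra. Qed.

Definition depth (xi : Y) (r : R) (x : X) : R := r - dY xi (iota x).
(** Plays the role of the distance to the boundary of the ball in a John domain; [rho] accounts for
    the boundary of X_eps. With [theta] of order eta * eps, raising [rho] to 2 theta * depth by
    passing to an ancestor consumes only a small multiple of eta * depth. *)
Definition jdist (xi : Y) (r : R) (x : X) : R := Num.min (rho x) (theta * depth xi r x).

Lemma depth_lip xi r x y : depth xi r x - de x y <= depth xi r y.
Proof. by have := mdist_tri mdY xi (iota x) (iota y); rewrite iso /depth; lra. Qed.

Section Ball.
Variables (xi : Y) (r : R).
Hypothesis r0 : 0 < r.
Hypothesis rm : r <= rmax.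
Notation b := (depth xi r).
Notation D := (jdist xi r).

Lemma depth_le x : b x <= r.
Proof. by rewrite /depth; have := mdist_ge0 mdY xi (iota x); lra. Qed.

Lemma jdist_gt0 x : 0 < b x -> 0 < D x.
Proof. by move=> bx; rewrite lt_min rho_gt0 mulr_gt0. Qed.

Lemma jdist_lerho x : D x <= rho x. Proof. by rewrite ge_min lexx. Qed.
Lemma jdist_ledepth x : D x <= theta * b x. Proof. by rewrite ge_min lexx orbT. Qed.

Let thb x : theta * b x <= 4^-1.
Proof. by apply: le_trans theta_rmax; rewrite ler_pM2l// (le_trans (depth_le x)). Qed.

Definition central x := dY xi (iota x) <= eta * r /\ theta * r / 8 <= rho x.

Let C1 := C * K ^+ 2 / eps.

Let C4 : 4 <= C. Proof. by have := C_ge; lra. Qed.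
Let C1600 : 1 <= C / 1600. Proof. by have := C_ge; lra. Qed.
Let C400 : 4 <= C / 400. Proof. by have := C_ge; lra. Qed.
Let C0 : 0 < C. Proof. by have := C4; lra. Qed.
Let Ce0 : 0 < C / eps. Proof. exact: divr_gt0. Qed.

(* Away from the center the John distance can be increased by a fixed factor along a
   geodesic of comparable size: deep points move towards [xi] and then towards [z0],
   points close to the boundary of [X_eps] only towards [z0]. *)
Lemma jdist_improve y : 0 < b y -> central y \/
  exists y', [/\ 0 < b y', (1 + eta / 2) * D y <= D y' &
    forall g t, geodesic d g y y' -> 0 <= t -> t <= d y y' ->
      [/\ 0 < b (g t), D y <= K * D (g t) & de y (g t) <= C1 * D y]].
Proof.
have r0_ := r0; have eta0_ := eta0; have eps0_ := eps0; have K2_ := K2; have C_ := C4.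
move=> by0; have ry0 := rho_gt0 d z0 eps y.
have tb0 : 0 < theta * b y by rewrite mulr_gt0.
have K0 : 0 < K by have := K2; lra.
have e1 : eps^-1 * eps = 1 by rewrite mulVf ?lt0r_neq0.
have ie0 : 0 < eps^-1 by rewrite invr_gt0.
have tE : theta / eps = eta / 100 by rewrite /theta; field; rewrite lt0r_neq0.
have KK := K20.
(* One verification for all moves: on a d-geodesic with exp(eps d) <= K, rho drops at most by the
   factor K and the d_eps-distance from [y] stays below K ^ 2 times that of the end point, hence
   below a quarter of the depth. *)
have conn y' m : expR (eps * d y y') <= K -> de y y' <= m -> K ^+ 2 * m <= b y / 4 ->
    K ^+ 2 * m <= C1 * D y -> forall g t, geodesic d g y y' -> 0 <= t -> t <= d y y' ->
    [/\ 0 < b (g t), D y <= K * D (g t) & de y (g t) <= C1 * D y].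
  move=> HK dm mb mC g t G t0 td.
  have [HK' dz] := geod_leK z0 md geo eps0 HK G t0 td.
  have dz' : de y (g t) <= K ^+ 2 * m by apply: le_trans dz _; rewrite ler_pM2l//; lra.
  have bz := depth_lip xi r y (g t).
  have rz := rho_leK z0 md eps0 HK'.
  split; [lra| |exact: le_trans mC].
  rewrite [D (g t)]/jdist minr_pMr ?(ltW K0)// le_min; apply/andP; split.
    by apply: le_trans rz; exact: jdist_lerho.
  apply: le_trans (jdist_ledepth y) _; rewrite mulrCA ler_pM2l//.
  have : 2 * b (g t) <= K * b (g t) by rewrite ler_pM2r//; lra.
  lra.
case: (leP (rho y) (theta * b y / 4)) => yA.
  have DE : D y = rho y by rewrite /jdist min_l//; lra.
  (* Close to the boundary of X_eps: moving to the ancestor with twice the [rho] costs at most 4 rho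
     / eps <= eta * b / 100, which leaves at least 31/32 of the depth. *)
  right; have tb := thb y; have [|| y' [ry' yy' dy']] := @ancestor _ _ d z0 eps md geo eps0 y (2 * rho y); try lra.
  have dy2 : de y y' <= 4 / eps * rho y by move: dy'; rewrite mulrCA !mulrA; lra.
  have small : K ^+ 2 * (4 / eps * rho y) <= b y / 32.
    have h1 : 4 / eps * rho y <= 4 / eps * (theta * b y / 4).
      by rewrite ler_wpM2l// divr_ge0// ltW.
    have h2 : 4 / eps * (theta * b y / 4) = theta / eps * b y by field; rewrite lt0r_neq0.
    rewrite h2 tE in h1.
    have h3 : K ^+ 2 * (4 / eps * rho y) <= K ^+ 2 * (eta / 100 * b y) by rewrite ler_pM2l//; lra.
    apply: le_trans h3 _.
    have -> : K ^+ 2 * (eta / 100 * b y) = (eta * (32 * K ^+ 2)) * (b y / 3200) by field.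
    apply: le_trans (ler_wpM2r _ etaK) _; lra.
  have K1 : 4 / eps * rho y <= K ^+ 2 * (4 / eps * rho y).
    by rewrite ler_peMl//; [rewrite mulr_ge0 ?divr_ge0 ?ltW|lra].
  have b' := depth_lip xi r y y'.
  exists y'; split; first lra.
    rewrite DE /jdist ry' le_min; apply/andP; split.
      by rewrite ler_pM2r//; have := eta1; lra.
    have : theta * (b y * (31 / 32)) <= theta * b y' by rewrite ler_pM2l//; lra.
    have : (1 + eta / 2) * rho y <= 2 * rho y by rewrite ler_pM2r//; have := eta1; lra.
    lra.
  apply: (conn y' (4 / eps * rho y)) => //; [|lra|].
    apply: le_trans K2; have : rho y = expR (- (eps * d y y')) * rho y'.
      rewrite /rho_eps -expRD yy' (mdistC md y y'); congr expR; ring.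
    rewrite ry' expRN => /(congr1 (fun u => expR (eps * d y y') / rho y * u)).
    rewrite divfK ?gt_eqF// => ->.
    by rewrite le_eqVlt; apply/orP; left; apply/eqP; field; rewrite !gt_eqF// expR_gt0.
  rewrite DE /C1; have -> : C * K ^+ 2 / eps * rho y = K ^+ 2 * (C * (eps^-1 * rho y)) by ring.
  by rewrite ler_pM2l -?mulrA ?ler_pM2r ?mulr_gt0//; lra.
case: (leP (dY xi (iota y)) (eta * r)) => yr.
  left; split => //; have : eta * r <= 32^-1 * r by rewrite ler_pM2r//; exact: eta1.
  move=> h; have : r / 2 <= b y by rewrite /depth; lra.
  rewrite -(ler_pM2l th0); lra.
right; have bler := depth_le y.
have eb : eta * b y <= eta * r by rewrite ler_pM2l.
have eb0 : 0 < eta * b y by rewrite mulr_gt0.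
(* [w] approximates [xi] within [sg]. Going 9 [sg] towards [w] gains at least 6 [sg] of depth, since
   the approximations lose 3; a possible ancestor step loses one more. The net gain 5 [sg] = eta * b
   / 2 is the factor 1 + eta / 2. *)
pose sg := eta * b y / 10.
have sg0 : 0 < sg by rewrite /sg; lra.
have [w dw] := dense xi sg0.
have h1 := mdist_tri mdY xi (iota w) (iota y).
have h2 := mdist_tri mdY (iota y) xi (iota w).
rewrite (mdistC mdY xi (iota w)) (mdistC mdY (iota w) (iota y)) iso in h1.
rewrite (mdistC mdY xi (iota w)) (mdistC mdY (iota y) xi) iso in h2.
have [|| y2 [dy2 dy2w]] := @de_between _ _ d z0 eps md eps0 geo y w (9 * sg) sg _ _ sg0.
- lra.
- by rewrite /sg; move: dw h1; rewrite /sg; lra.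
have h3 := mdist_tri mdY xi (iota w) (iota y2).
rewrite (mdistC mdY xi (iota w)) (mdistC mdY (iota w) (iota y2)) iso in h3.
have by2 : b y + 6 * sg <= b y2 by rewrite /depth; lra.
have [y' [ry' dy' bb']] : exists y', [/\ 2 * (theta * b y) <= rho y',
    de y y' <= eta * b y & b y + 5 * sg <= b y'].
  case: (leP (2 * (theta * b y)) (rho y2)) => ry2.
    by exists y2; split => //; [move: dy2; rewrite /sg; lra|lra].
  have [|| y' [ry' _ d']] := @ancestor _ _ d z0 eps md geo eps0 y2 (2 * (theta * b y)).
  - exact: ltW.
  - by have := thb y; lra.
  have {}d' : de y2 y' <= sg.
    apply: le_trans d' _; have -> : 2 / eps * (2 * (theta * b y)) = 4 * (theta / eps) * b y by ring.
    by rewrite tE /sg; lra.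
  exists y'; split; first by rewrite ry'.
    by have := mdist_tri mde y y2 y'; move: dy2 d'; rewrite /sg; lra.
  have := depth_lip xi r y2 y'; lra.
have K2m : K ^+ 2 * (eta * b y) <= b y / 32.
  have -> : K ^+ 2 * (eta * b y) = (eta * (32 * K ^+ 2)) * (b y / 32) by field.
  apply: le_trans (ler_wpM2r _ etaK) _; lra.
exists y'; split; first lra.
  apply: (@le_trans _ _ ((1 + eta / 2) * (theta * b y))).
    by rewrite ler_pM2l ?jdist_ledepth//; have := eta0; lra.
  rewrite /jdist le_min; apply/andP; split.
    apply: le_trans ry'; rewrite ler_pM2r//; have := eta1; lra.
  rewrite mulrCA ler_pM2l//; move: bb'; rewrite /sg; lra.
have E : eta * b y <= C / eps * (theta * b y / 4).
  have -> : C / eps * (theta * b y / 4) = C / 400 * (eta * b y).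
    by rewrite /theta; field; rewrite lt0r_neq0.
  by rewrite ler_peMl ?(ltW eb0)//; have := C400; lra.
apply: (conn y' (eta * b y)) => //; [|lra|].
  by apply: closeK; apply: le_trans dy' _; apply: le_trans E _; rewrite ler_pM2l//; lra.
rewrite /C1; have -> : C * K ^+ 2 / eps * D y = K ^+ 2 * (C / eps * D y) by ring.
rewrite ler_pM2l; last by lra.
apply: le_trans E _; rewrite ler_pM2l//.
by rewrite /jdist le_min; apply/andP; split; lra.
Qed.

Let L := 2 * C1 / eta.
Let M' := K * (C1 + L).

Let C10 : 0 < C1.
Proof. by rewrite /C1 divr_gt0// mulr_gt0//; have := K20; lra. Qed.
Let L0 : 0 < L. Proof. by rewrite /L divr_gt0// mulr_gt0. Qed.

(** The summand [L * D y] is a potential: an improving step travels at most [C1 * D y], and by the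
    choice of [L] it raises L D by at least that amount. The bound thus passes from the rest of the
    chain to the whole chain with the same constant. *)
Definition john_pt y z := [/\ 0 < b z, D y <= K * D z & de y z + L * D y <= M' * D z].

Variables (s : X -> R) (c : R).
Hypothesis c0 : 0 < c.
Hypothesis sc : forall x, 0 < b x -> c * D x <= s x.

(** Improving steps are iterated. Each raises [D] by at least eta / 2 times a fixed lower bound [m],
    whereas [D] never exceeds theta * r; so the iteration ends, and it can only end at a central
    point. *)
Lemma john_to_central y : 0 < b y ->
  exists e, [/\ 0 < b e, central e & linked d (john_pt y) s y e].
Proof.
have r0_ := r0; have eta0_ := eta0; have eps0_ := eps0; have K2_ := K2; have C_ := C4.
move=> by0; have K0 : 0 < K by have := K2; lra.
have [m [m0 mD]] : exists m, 0 < m /\ m <= D y by exists (D y); split => //; exact: jdist_gt0.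
have um0 : 0 < eta / 2 * m by rewrite mulr_gt0 ?divr_gt0.
have [n nb] : exists n : nat, theta * r < D y + n%:R * (eta / 2 * m).
  exists (Num.truncn (theta * r / (eta / 2 * m))).+1.
  have := truncnS_gt (theta * r / (eta / 2 * m)); rewrite ltr_pdivrMr//.
  by have := jdist_gt0 by0; lra.
elim: n y by0 mD nb => [|n IH] y by0 mD nb.
  exfalso; move: nb; rewrite mul0r addr0 ltNge => /negP; apply.
  by apply: le_trans (jdist_ledepth y) _; rewrite ler_pM2l// depth_le.
have Dy0 := jdist_gt0 by0.
have base z : 0 < b z -> D y <= K * D z -> de y z <= C1 * D y -> john_pt y z.
  move=> bz DK dz; split => //; rewrite /M'.
  apply: (@le_trans _ _ ((C1 + L) * D y)); first by rewrite mulrDl lerD2r.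
  by rewrite -mulrA mulrCA ler_pM2l// addr_gt0.
have [yc|[y' [by' Dy' seg]]] := jdist_improve by0.
  exists y; split => //; apply: linked_nil; apply: base => //.
    by rewrite ler_peMl ?(ltW Dy0)//; have := K2; lra.
  by rewrite (mdist0 mde) mulr_ge0 ?ltW.
have Dyy : D y + eta / 2 * D y <= D y' by move: Dy'; rewrite mulrDl mul1r.
have em : eta / 2 * m <= eta / 2 * D y by rewrite ler_pM2l// divr_gt0.
have [|| e [be ce le]] := IH y' by'; first lra.
  by move: nb; rewrite -natr1 mulrDl mul1r; lra.
have [g G] := geo y y'; have [gy gy' _] := G.
exists e; split => //; apply: (linked_trans (y := y')).
  apply: (linked_geodesic (sigma := c * (D y / K)) md _ G) => [|t t0 td].
    by rewrite mulr_gt0// divr_gt0.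
  have [bz DK dz] := seg g t G t0 td; split; first exact: base.
  by apply: le_trans (sc bz); rewrite ler_pM2l// ler_pdivrMr// mulrC.
apply: linked_sub le => z [bz DK dz]; split => //.
  have : 0 < eta / 2 * D y by rewrite mulr_gt0 ?divr_gt0.
  lra.
have [_ _ dy'] := seg g _ G (mdist_ge0 md y y') (lexx _); rewrite gy' in dy'.
have := mdist_tri mde y y' z.
have : L * ((1 + eta / 2) * D y) <= L * D y' by rewrite ler_pM2l.
have -> : L * ((1 + eta / 2) * D y) = L * D y + C1 * D y.
  by rewrite /L; field; rewrite lt0r_neq0.
lra.
Qed.

(** [M'] serves the climb to a central point. The other terms serve the passage between central
    points, where D >= theta * r / (8 K): they dominate D y <= theta * r and the trivial distance
    bound 2 r. *)
Definition john_const := M' + 8 * K + 16 * K / theta.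

Lemma john_const_gt0 : 0 < john_const.
Proof.
have r0_ := r0; have eta0_ := eta0; have eps0_ := eps0; have K2_ := K2; have C_ := C4.
have K0 : 0 < K by lra.
by rewrite /john_const /M' !addr_gt0// ?mulr_gt0 ?addr_gt0 ?invr_gt0.
Qed.

(** The end [xs] is one central point, reached from any point of the ball. Two central points are at
    bounded d-distance, so a geodesic joins the central point reached from [y] to [xs]. *)
Lemma john_linked : exists xs, 0 < b xs /\ forall y, 0 < b y ->
  linked d (fun z => [/\ 0 < b z, D y <= john_const * D z & de y z <= john_const * D z]) s y xs.
Proof.
have r0_ := r0; have eta0_ := eta0; have eps0_ := eps0; have K2_ := K2; have C_ := C4.
have K0 : 0 < K by lra.
have M'0 : 0 < M' by rewrite /M' mulr_gt0// addr_gt0.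
have q0 : 0 < 16 * K / theta by rewrite divr_gt0// mulr_gt0.
have [x0 hx0] := dense xi r0.
have bx0 : 0 < b x0 by rewrite /depth (mdistC mdY); lra.
have [xs [bxs [cxs1 cxs2] _]] := john_to_central bx0.
exists xs; split => // y by0.
have [e [be [ce1 ce2] le]] := john_to_central by0.
apply: (linked_trans (y := e)).
  apply: linked_sub le => z [bz DK dz]; have Dz := jdist_gt0 bz.
  have Dy := jdist_gt0 by0; split => //; rewrite /john_const !mulrDl.
    have : 0 < M' * D z by rewrite mulr_gt0.
    have : 0 < 16 * K / theta * D z by rewrite mulr_gt0.
    have : 0 < K * D z by rewrite mulr_gt0.
    by lra.
  have : 0 < L * D y by rewrite mulr_gt0.
  have : 0 < 16 * K / theta * D z by rewrite mulr_gt0.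
  have : 0 < 8 * K * D z by rewrite !mulr_gt0.
  by lra.
have [g G] := geo e xs; have [ge gx _] := G.
have tr0 : 0 < theta * r by rewrite mulr_gt0.
have dex : de e xs <= 2 * eta * r.
  have := mdist_tri mdY (iota e) xi (iota xs); rewrite iso (mdistC mdY _ xi).
  by rewrite -[2 * eta * r]mulrA; lra.
have HK : expR (eps * d e xs) <= K.
  have er0 : 0 <= eta * r by rewrite mulr_ge0 ?ltW.
  (* Origin of the bound 1600 for [C]: central points are 2 eta r apart and have rho at least theta
     r / 8 = eta eps r / 800. *)
  have E : 2 * eta * r <= C / eps * (theta * r / 8).
    have -> : C / eps * (theta * r / 8) = C / 1600 * (2 * eta * r).
      by rewrite /theta; field; rewrite lt0r_neq0.
    by rewrite ler_peMl ?C1600//; lra.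
  by apply: closeK; apply: le_trans dex _; apply: le_trans E _; rewrite ler_pM2l.
have pt t : 0 <= t -> t <= d e xs -> 0 < b (g t) /\ theta * r / 8 / K <= D (g t).
  move=> t0 td; have [HK' dz] := geod_leK z0 md geo eps0 HK G t0 td.
  have dz' : de e (g t) <= r / 16.
    apply: le_trans dz _; apply: (@le_trans _ _ (K ^+ 2 * (2 * eta * r))).
      by rewrite ler_pM2l//; have := K20; lra.
    have -> : K ^+ 2 * (2 * eta * r) = eta * (32 * K ^+ 2) * (r / 16) by field.
    by apply: le_trans (ler_wpM2r _ etaK) _; lra.
  have bz := depth_lip xi r e (g t).
  have rz := rho_leK z0 md eps0 HK'.
  have er : eta * r <= 32^-1 * r by rewrite ler_pM2r//; exact: eta1.
  have bz2 : r / 2 <= b (g t) by move: bz; rewrite {1}/depth; lra.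
  split; first lra.
  rewrite /jdist le_min; apply/andP; split.
    by rewrite ler_pdivrMr// [rho _ * K]mulrC; apply: le_trans rz.
  have : theta * (r / 2) <= theta * b (g t) by rewrite ler_pM2l.
  have : theta * r / 8 / K <= theta * r / 8.
    by rewrite ler_pdivrMr// ler_peMr//; have := K2; lra.
  lra.
apply: (linked_geodesic (sigma := c * (theta * r / 8 / K)) md _ G) => [|t t0 td].
  by rewrite mulr_gt0// !divr_gt0.
have [bz Dz] := pt t t0 td; split; last first.
  by apply: le_trans (sc bz); rewrite ler_pM2l.
have Dz0 := jdist_gt0 bz.
have rD : theta * r <= 8 * K * D (g t).
  by move: Dz; rewrite ler_pdivrMr// ler_pdivrMr//; lra.
have r2 : 2 * r <= 16 * K / theta * D (g t).
  have -> : 16 * K / theta * D (g t) = 2 / theta * (8 * K * D (g t)) by field; rewrite lt0r_neq0.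
  have -> : 2 * r = 2 / theta * (theta * r) by field; rewrite lt0r_neq0.
  by rewrite ler_pM2l// divr_gt0.
have MD : 0 < M' * D (g t) by rewrite mulr_gt0.
split => //; rewrite /john_const !mulrDl.
  have := jdist_ledepth y; have : theta * b y <= theta * r by rewrite ler_pM2l// depth_le.
  lra.
have := mdist_tri mdY (iota y) xi (iota (g t)); rewrite iso (mdistC mdY _ xi).
move: by0 bz; rewrite /depth; lra.
Qed.

End Ball.
End John.

(** * Upper gradients under the change of metric *)

Section BorelTransport.
Context {R : realType}.

Lemma open_emeasurable (V : set (\bar R)) : open V -> measurable V.
Proof.
move=> oV; exists (EFin @^-1` V).
  apply: open_measurable; rewrite openE => x Vx.
  have := oV; rewrite openE => /(_ _ Vx) /= [e e0 h].
  by exists e => // y xy; apply: h.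
exists (V `&` [set -oo%E; +oo%E]).
  by apply/ps_inftyP => x [].
apply/seteqP; split => [_ [[x Vx <-]//|[]//]|[x| |] Vx].
- by left; exists x.
- by right; split => //; right.
- by right; split => //; left.
Qed.

Context {dd : measure_display} {T : measurableType dd} {Y : Type} (dY : Y -> Y -> R).
Variable c : T -> Y.
Hypothesis cc : forall U, dopen dY U -> measurable (c @^-1` U).

Lemma dborel_preimage A : dborel dY A -> measurable (c @^-1` A).
Proof.
move: A; apply: smallest_sub => [|U oU]; last exact: cc.
split; first by rewrite /= preimage_set0.
  by move=> A mA /=; rewrite setTD -preimage_setC; exact: measurableC.
by move=> F mF /=; rewrite preimage_bigcup; exact: bigcup_measurable.
Qed.

Lemma dmeasE_comp (gr : Y -> \bar R) : dmeasE dY gr -> measurable_fun [set: T] (gr \o c).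
Proof.
move=> H; apply: (measurability _ (ErealGenOInfty.measurableE R)) => //.
move=> _ [_ [r ->] <-]; rewrite setTI comp_preimage; apply: dborel_preimage; apply: H.
have -> : `]r%:E, +oo[%classic = [set y | (r%:E < y)%E].
  by apply/seteqP; split => x /=; rewrite in_itv/= andbT.
exact: open_ereal_gt_ereal.
Qed.

Lemma dmeasR_comp (u : Y -> R) : dmeasR dY u -> measurable_fun [set: T] (u \o c).
Proof.
move=> H; apply: (measurability _ (RGenOInfty.measurableE R)) => //.
move=> _ [_ [r ->] <-]; rewrite setTI comp_preimage; apply: dborel_preimage; apply: H.
exact: interval_open.
Qed.

End BorelTransport.

Lemma measurable_dmeasE {R : realType} {dd : measure_display} {X : measurableType dd}
    (d : X -> X -> R) : @measurable _ X = dborel d ->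
  forall gr : X -> \bar R, measurable_fun [set: X] gr -> dmeasE d gr.
Proof.
move=> E gr mg V oV; rewrite -E -[X in measurable X]setTI; apply: mg => //.
exact: open_emeasurable.
Qed.

Lemma measurable_dmeasR {R : realType} {dd : measure_display} {X : measurableType dd}
    (d : X -> X -> R) : @measurable _ X = dborel d ->
  forall u : X -> R, measurable_fun [set: X] u -> dmeasR d u.
Proof.
move=> E u mg V oV; rewrite -E -[X in measurable X]setTI; apply: mg => //.
exact: open_measurable.
Qed.

(** * Reparametrization of curves by their length in d_eps *)

Section Reparametrization.
Context {R : realType} {X Y : Type} (d : X -> X -> R) (z0 : X) (eps : R).
Hypothesis md : is_metric d.
Hypothesis geo : geodesic_space d.
Hypothesis eps0 : 0 < eps.
Notation rho := (rho_eps d z0 eps).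
Notation de := (d_eps d z0 eps).
Notation lam := (@lebesgue_measure R).
Variables (dY : Y -> Y -> R) (iota : X -> Y).
Hypothesis mdY : is_metric dY.
Hypothesis iso : forall x y, dY (iota x) (iota y) = de x y.

Section Curve.
Variables (g : R -> X) (l : R).
Hypothesis H : arclength d g l.
Notation S t := (rlen d z0 eps g t).

Let l0 : 0 <= l. Proof. exact: arclength_ge0 H. Qed.

Lemma rlen_short_ub a b : 0 <= a -> a <= b -> b <= l ->
  S b - S a <= expR (eps * (b - a)) * rho (g a) * (b - a).
Proof.
move=> a0 ab bl; have Hb := arclength_take H (le_trans a0 ab) bl.
rewrite (rlen_split z0 md eps0 Hb a0 ab) addrC addKr.
apply: (rlen_ub md eps0 (arclength_sub Hb a0 ab (lexx b))) => t t0 tb.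
apply: le_trans (rho_mul z0 md eps0 (g a) _) _.
rewrite ler_wpM2r ?rho_ge0// ler_expR ler_pM2l//; apply: (le_trans _ tb).
have -> : t = a + t - a by ring.
have -> : a + (a + t - a) = a + t by ring.
by apply: (arclength_lip H); lra.
Qed.

Lemma polyl_de_lb a h (s : seq R) b : 0 <= a -> b <= l -> b - a <= h ->
  path <=%R a (rcons s b) -> forall a', 0 <= a' -> a' <= a -> b - a' <= h ->
  expR (- (2 * (eps * h))) * rho (g a') * polyl d g a (rcons s b) <=
  polyl dY (iota \o g) a (rcons s b).
Proof.
move=> a0 bl bah p a' a'0; elim: s a a0 bah p => [|x s IH] a a0 bah /=.
  rewrite andbT !addr0 => ab a'a bah'.
  rewrite iso; apply: le_trans (de_initial z0 md eps0 geo (mdist_ge0 md _ _) (lexx _)).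
  have := arclength_lip H a0 ab bl; have := arclength_lip H a'0 a'a (le_trans ab bl) => u v.
  have d0 := mdist_ge0 md (g a) (g b).
  rewrite [leRHS](_ : _ = (expR (- (eps * d (g a) (g b))) * rho (g a)) * d (g a) (g b)); last by ring.
  apply: ler_wpM2r => //.
  have -> : - (2 * (eps * h)) = - (eps * h) + - (eps * h) by ring.
  rewrite expRD -mulrA; apply: ler_pM; rewrite ?expR_ge0 ?mulr_ge0 ?expR_ge0//.
    rewrite ler_expR lerN2 ler_pM2l//; lra.
  apply: le_trans (rho_mulN z0 md eps0 (g a') (g a)); rewrite ler_wpM2r ?rho_ge0//.
  by rewrite ler_expR lerN2 ler_pM2l//; lra.
case/andP=> ax p a'a bah'; rewrite mulrDr lerD//; last first.
  have xb := path_le_last p.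
  by apply: IH => //; lra.
have xb := path_le_last p.
rewrite iso; apply: le_trans (de_initial z0 md eps0 geo (mdist_ge0 md _ _) (lexx _)).
have := arclength_lip H a0 ax (le_trans xb bl).
have := arclength_lip H a'0 a'a (le_trans ax (le_trans xb bl)) => u v.
have d0 := mdist_ge0 md (g a) (g x).
rewrite [leRHS](_ : _ = (expR (- (eps * d (g a) (g x))) * rho (g a)) * d (g a) (g x)); last by ring.
apply: ler_wpM2r => //.
have -> : - (2 * (eps * h)) = - (eps * h) + - (eps * h) by ring.
rewrite expRD -mulrA; apply: ler_pM; rewrite ?expR_ge0 ?mulr_ge0 ?expR_ge0//.
  rewrite ler_expR lerN2 ler_pM2l//; lra.
apply: le_trans (rho_mulN z0 md eps0 (g a') (g a)); rewrite ler_wpM2r ?rho_ge0//.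
by rewrite ler_expR lerN2 ler_pM2l//; lra.
Qed.

Lemma length_ge_rlen_short a b h : 0 <= a -> a <= b -> b <= l -> b - a <= h ->
  length_ge dY (iota \o g) a b (expR (- (3 * (eps * h))) * (S b - S a)).
Proof.
move=> a0 ab bl bah e e0.
have [s [p L]] := arclength_length H a0 ab bl e0; exists s; split => //.
have := polyl_de_lb a0 bl bah p a0 (lexx a) bah.
have E0 := expR_ge0 (- (2 * (eps * h))); have E1 : expR (- (2 * (eps * h))) <= 1.
  by rewrite -[leRHS]expR0 ler_expR oppr_le0 mulr_ge0// mulr_ge0 ?(ltW eps0)//; lra.
have r0 := rho_ge0 d z0 eps (g a); have r1 := rho_le1 z0 md eps0 (g a).
apply: le_trans.
apply: (@le_trans _ _ (expR (- (2 * (eps * h))) * rho (g a) * (b - a - e))); last first.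
  by rewrite ler_wpM2l// mulr_ge0.
have ub := rlen_short_ub a0 ab bl.
have ub2 : S b - S a <= expR (eps * h) * (rho (g a) * (b - a)).
  apply: le_trans ub _; rewrite -mulrA ler_wpM2r ?mulr_ge0 ?subr_ge0//.
  by rewrite ler_expR ler_pM2l.
have E3 : expR (- (3 * (eps * h))) = expR (- (2 * (eps * h))) * expR (- (eps * h)).
  by rewrite -expRD; congr expR; ring.
have : expR (- (3 * (eps * h))) * (S b - S a) <=
    expR (- (3 * (eps * h))) * (expR (eps * h) * (rho (g a) * (b - a))).
  by rewrite ler_wpM2l ?expR_ge0.
rewrite {2}E3 -mulrA [expR (- (eps * h)) * _]mulrA -expRD addNr expR0 mul1r => h1.
have h2 : expR (- (2 * (eps * h))) * rho (g a) * e <= 1 * e.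
  by rewrite ler_wpM2r ?(ltW e0)// mulr_ile1.
lra.
Qed.

(** On pieces of d-length [h] the d_eps-length is at least exp(-3 eps h) times the integral of rho;
    pieces add up, and [h] is small. *)
Lemma length_ge_rlen a b : 0 <= a -> a <= b -> b <= l ->
  length_ge dY (iota \o g) a b (S b - S a).
Proof.
move=> a0 ab bl e e0.
have ep := eps0.
have D0 : 0 <= S b - S a.
  have [_ _ /(_ 0 (lexx 0))] := rlen_sub z0 md eps0 geo H a0 ab bl.
  by rewrite mul0r; apply=> t _ _; exact: rho_ge0.
(* Makes the loss 3 eps h (S b - S a) at most e / 2; the extra [eps] keeps the denominator
   positive. *)
pose h := e / (2 * (3 * eps * (S b - S a) + eps)).
have q0 : 0 < 2 * (3 * eps * (S b - S a) + eps).
  by rewrite mulr_gt0// ltr_wpDl// mulr_ge0// mulr_ge0// ltW.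
have h0 : 0 < h by rewrite divr_gt0.
suff L : length_ge dY (iota \o g) a b (expR (- (3 * (eps * h))) * (S b - S a)).
  have e2 : 0 < e / 2 by rewrite divr_gt0.
  have [s [p Ls]] := L _ e2; exists s; split => //; apply: le_trans Ls.
  have := ler_wpM2r D0 (expR_ge1Dx (- (3 * (eps * h)))).
  have : 3 * (eps * h) * (S b - S a) <= e / 2.
    have -> : e / 2 = h * (3 * eps * (S b - S a) + eps).
      rewrite /h; field; have := q0; rewrite pmulr_rgt0// => q1.
      by rewrite gt_eqF.
    have : 0 <= h * eps by rewrite mulr_ge0 ?ltW.
    lra.
  lra.
suff Ln (n : nat) a' : a <= a' -> a' <= b -> b - a' <= n%:R * h ->
    length_ge dY (iota \o g) a' b (expR (- (3 * (eps * h))) * (S b - S a')).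
  apply: (Ln (Num.truncn ((b - a) / h)).+1) => //.
  by rewrite -ler_pdivrMr// ltW// truncnS_gt.
elim: n a' => [|n IH] a' aa ab' nb.
  rewrite mul0r in nb; apply: length_ge_rlen_short; lra.
case: (leP (b - a') h) => bh; first by apply: length_ge_rlen_short => //; lra.
have -> : expR (- (3 * (eps * h))) * (S b - S a') =
   expR (- (3 * (eps * h))) * (S (a' + h) - S a') + expR (- (3 * (eps * h))) * (S b - S (a' + h)).
  by ring.
apply: (length_ge_cat (b := a' + h)).
  by apply: length_ge_rlen_short; lra.
by apply: IH; [lra|lra|move: nb; rewrite -natr1; lra].
Qed.

Let f t := rho (g (clamp l t)).

Let mf : measurable_fun [set: R] f.
Proof.
apply: continuous_measurable_fun; apply: (lipschitz_continuous eps0) => s t.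
wlog st : s t / s <= t.
  by move=> W; case: (leP s t) => [/W//|/ltW/W]; rewrite distrC (distrC t).
apply: le_trans (rho_lip z0 md eps0 _ _) _; rewrite ler_pM2l//.
have [c1 c2] := clamp_lip l0 st; rewrite (distrC s) (ger0_norm (x := t - s)) ?subr_ge0//.
apply: le_trans c2; have /andP[a1 a2] := clamp_itv s l0; have /andP[b1 b2] := clamp_itv t l0.
exact: arclength_lip H _ _ _ _ _.
Qed.
Let f0 t : 0 <= f t. Proof. exact: rho_ge0. Qed.
Let f1 t : f t <= 1. Proof. exact: rho_le1. Qed.

(** Positive lower bound for the density on the curve; it makes the length function strictly
    increasing with Lipschitz inverse [T]. *)
Let m := expR (- (eps * l)) * rho (g 0).
Let m0 : 0 < m. Proof. by rewrite mulr_gt0 ?expR_gt0 ?rho_gt0. Qed.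
Let fm t : m <= f t.
Proof.
have /andP[a1 a2] := clamp_itv t l0.
apply: le_trans (rho_mulN z0 md eps0 (g 0) _); rewrite ler_wpM2r ?rho_ge0//.
rewrite ler_expR lerN2 ler_pM2l//; apply: (le_trans _ a2); rewrite -[leRHS]subr0.
exact: arclength_lip H _ _ (lexx 0) a1 a2.
Qed.

(* The arc length function of [g] in [d_eps], continued to a bijection of the line. *)
Let S' t := Jint f 0 t - Jint f t 0.

Let Jempty a b : b <= a -> Jint f a b = 0.
Proof.
rewrite le_eqVlt => /predU1P[->|ba]; rewrite /Jint.
  by rewrite set_itv1 integral_set1.
by rewrite set_itv_ge ?integral_set0// bnd_simp -ltNge.
Qed.

Let S'_sub s t : s <= t -> S' t - S' s = Jint f s t.
Proof.
move=> st; rewrite /S'; case: (leP 0 s) => s0.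
  rewrite !(Jempty (b := 0))//; last exact: le_trans st.
  by rewrite (Jint_split mf f0 f1 s0 st); ring.
case: (leP 0 t) => t0.
  rewrite (Jempty (a := t))// (Jempty (b := s)) ?(ltW s0)//.
  by rewrite (Jint_split mf f0 f1 (ltW s0) t0); ring.
rewrite (Jempty (b := t)) ?(ltW t0)// (Jempty (b := s)) ?(ltW s0)//.
by rewrite (Jint_split mf f0 f1 st (ltW t0)); ring.
Qed.

Let S'_lb s t : s <= t -> m * (t - s) <= S' t - S' s.
Proof. by move=> st; rewrite S'_sub//; apply: (Jint_lb mf f0 f1) => //; exact: ltW. Qed.

Let S'_ub s t : s <= t -> S' t - S' s <= t - s.
Proof.
by move=> st; rewrite S'_sub// -[leRHS]mul1r; apply: (Jint_ub mf f0 f1).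
Qed.

Let S'_mono s t : s <= t -> S' s <= S' t.
Proof.
move=> st; have := S'_lb st; have : 0 <= m * (t - s) by rewrite mulr_ge0 ?subr_ge0// (ltW m0).
lra.
Qed.

Let S'0 : S' 0 = 0. Proof. by rewrite /S' subrr. Qed.

Let S'_rlen t : 0 <= t -> t <= l -> S' t = S t.
Proof.
move=> t0 tl; rewrite /S' (Jempty (a := t))// subr0 rlen_clamp.
by apply: eq_Jint => u u0 ut; rewrite /f !clamp_id//; lra.
Qed.

Let S'_cont : continuous S'.
Proof.
apply: (@lipschitz_continuous _ _ 1) => // s t; rewrite mul1r.
wlog st : s t / s <= t.
  by move=> W; case: (leP s t) => [/W//|/ltW/W]; rewrite distrC (distrC t).
by rewrite distrC (distrC s) !ger0_norm ?subr_ge0// ?S'_ub// S'_mono.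
Qed.

Let S'_surj v : exists t, S' t = v.
Proof.
pose t := `|v| / m; have t0 : 0 <= t by rewrite divr_ge0// ltW.
have a1 := S'_lb t0; have a2 : - t <= 0 by rewrite oppr_le0.
have {}a2 := S'_lb a2.
have E : m * t = `|v| by rewrite /t mulrC divfK// gt_eqF.
have := ler_norm v; have := ler_norm (- v); rewrite normrN => n1 n2.
rewrite subr0 S'0 E in a1; rewrite sub0r opprK S'0 E in a2.
have tt : - t <= t by lra.
have [||c _ <-] := @IVT R S' (- t) t v tt; last by exists c.
- exact: continuous_subspaceT.
- by rewrite ge_min le_max; apply/andP; split; apply/orP; [left|right]; lra.
Qed.

Let T v := projT1 (cid (S'_surj v)).
Let S'T v : S' (T v) = v. Proof. exact: projT2 (cid (S'_surj v)). Qed.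

Let S'_inj s t : S' s = S' t -> s = t.
Proof.
wlog st : s t / s <= t.
  by move=> W E; case: (leP s t) => [/W/(_ E)//|/ltW/W/(_ (esym E))].
move=> E; have := S'_lb st; rewrite E subrr pmulr_rle0// subr_le0 => ts.
by apply/eqP; rewrite eq_le st.
Qed.

Let TS' t : T (S' t) = t. Proof. by apply: S'_inj; rewrite S'T. Qed.

Let S'_le s t : (S' s <= S' t) = (s <= t).
Proof.
apply/idP/idP; last exact: S'_mono.
move=> h; rewrite leNgt; apply/negP => ts.
have := S'_lb (ltW ts); have : 0 < m * (s - t) by rewrite mulr_gt0// subr_gt0.
lra.
Qed.

Let T_mono u v : u <= v -> T u <= T v.
Proof. by move=> uv; rewrite -S'_le !S'T. Qed.

Let T_lip u v : u <= v -> T v - T u <= m^-1 * (v - u).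
Proof.
move=> uv; rewrite ler_pdivlMl// -{2}(S'T v) -{2}(S'T u); apply: S'_lb; exact: T_mono.
Qed.

Lemma arclength_reparam : arclength dY (fun v => iota (g (T v))) (S l).
Proof.
have Sl0 : 0 <= S l by rewrite rlen_ge0.
have T0 : T 0 = 0 by rewrite -{1}S'0 TS'.
have Tl : T (S l) = l by rewrite -S'_rlen// TS'.
apply/arclengthP => //; split => s t s0 st tl.
  have Ts : 0 <= T s by rewrite -T0 T_mono.
  have Tt : T t <= l by rewrite -Tl T_mono.
  have Tst := T_mono st; have Tsl := le_trans Tst Tt; have Tt0 := le_trans Ts Tst.
  rewrite iso; have [+ _ _] := rlen_sub z0 md eps0 geo H Ts Tst Tt.
  by rewrite -(S'_rlen Ts Tsl) -(S'_rlen Tt0 Tt) !S'T.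
have Ts : 0 <= T s by rewrite -T0 T_mono.
have Tt : T t <= l by rewrite -Tl T_mono.
have Tst := T_mono st; have Tsl := le_trans Tst Tt; have Tt0 := le_trans Ts Tst.
have := length_ge_rlen Ts Tst Tt.
rewrite -(S'_rlen Ts Tsl) -(S'_rlen Tt0 Tt) !S'T => L.
rewrite -[X in length_ge _ _ X _](S'T s) -[X in length_ge _ _ _ X](S'T t).
apply: (length_ge_comp (phi := S')); first exact: S'_mono.
apply: length_ge_ext L => u _ _ /=; by rewrite TS'.
Qed.

(** Change of variables by the primitive [S'] of [f]. The reparametrized curve [c] is Lipschitz on
    the whole line, so [gr] composed with it is Borel. *)
Lemma line_int_reparam (gr : Y -> \bar R) : dmeasE dY gr -> (forall y, 0 <= gr y)%E ->
  line_int gr (fun v => iota (g (T v))) (S l) =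
  line_int (fun x => gr (iota x) * (rho x)%:E)%E g l.
Proof.
move=> mg g0.
have T0 : T 0 = 0 by rewrite -{1}S'0 TS'.
have Tl : T (S l) = l by rewrite -S'_rlen// TS'.
have Sl0 : 0 <= S l by rewrite rlen_ge0.
pose c v := iota (g (clamp l (T v))).
have cLip u v : dY (c u) (c v) <= m^-1 * `|u - v|.
  wlog uv : u v / u <= v.
    by move=> W; case: (leP u v) => [/W//|/ltW/W]; rewrite (mdistC mdY) distrC.
  have Tuv := T_mono uv; have [c1 c2] := clamp_lip l0 Tuv.
  have /andP[a1 a2] := clamp_itv (T u) l0; have /andP[b1 b2] := clamp_itv (T v) l0.
  rewrite iso; have [h1 h2 _] := rlen_sub z0 md eps0 geo H a1 c1 b2.
  rewrite distrC ger0_norm ?subr_ge0//; have := T_lip uv; lra.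
have cc U : dopen dY U -> measurable (c @^-1` U).
  move=> oU; apply: open_measurable; rewrite openE => u /= Uu.
  have [r [r0 rU]] := oU _ Uu.
  exists (r * m) => /=; first by rewrite mulr_gt0.
  move=> v /= uv; apply: rU; apply: le_lt_trans (cLip _ _) _.
  by rewrite -ltr_pdivlMl ?invr_gt0// invrK mulrC.
have mh : measurable_fun [set: R] (gr \o c) by apply: (dmeasE_comp cc).
have mS : measurable_fun [set: R] S' by exact: continuous_measurable_fun.
have D : measurable `[0, S l]%classic by [].
have := change_of_var mS mf f0 _ mh (fun v => g0 (c v)) D.
have pre a b : S' @^-1` [set` Interval (BSide a (S' 0)) (BSide b (S' l))] =
   [set` Interval (BSide a 0) (BSide b l)].
  by apply/seteqP; split => x /=; rewrite !in_itv/=; case: a; case: b; rewrite /= !(S'_le, ltNge).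
have -> : line_int gr (fun v => iota (g (T v))) (S l) = (\int[lam]_(s in `[0%R, S l]%classic) (gr \o c) s)%E.
  apply: eq_integral => v; rewrite in_setE /= in_itv/= => /andP[v0 vl].
  by rewrite /c clamp_id//; [rewrite -T0 T_mono|rewrite -Tl T_mono].
have -> : line_int (fun x => gr (iota x) * (rho x)%:E)%E g l =
   (\int[lam]_(t in S' @^-1` `[0%R, S l]%classic) ((gr \o c) (S' t) * (f t)%:E))%E.
  rewrite -{1}S'0 -(S'_rlen l0 (lexx l)) pre; apply: eq_integral => t.
  rewrite in_setE /= in_itv/= => /andP[t0 tl].
  by rewrite /c /f TS' clamp_id.
move=> -> // a b ab.
have -> : S' @^-1` `]a, b]%classic = `]T a, T b]%classic.
  have Ex x y : (S' x <= y) = (x <= T y) by rewrite -{1}(S'T y) S'_le.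
  by apply/seteqP; split => x /=; rewrite !in_itv/= !ltNge !Ex.
rewrite integral_itv_obnd_cbnd; last first.
  by apply/measurable_EFinP; exact: measurable_funTS.
rewrite (JintE mf f0 f1) -S'_sub ?S'T//; exact: T_mono (ltW ab).
Qed.

Lemma reparam : exists ga, [/\ arclength dY ga (S l), ga 0 = iota (g 0),
  ga (S l) = iota (g l) & forall gr : Y -> \bar R, dmeasE dY gr -> (forall y, 0 <= gr y)%E ->
    line_int gr ga (S l) = line_int (fun x => gr (iota x) * (rho x)%:E)%E g l].
Proof.
exists (fun v => iota (g (T v))); split; first exact: arclength_reparam.
- by rewrite -{1}S'0 TS'.
- by rewrite -S'_rlen// TS'.
- exact: line_int_reparam.
Qed.

End Curve.

Lemma upper_gradient_pullback (u : Y -> R) (gr : Y -> \bar R) :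
  dmeasE dY gr -> (forall y, 0 <= gr y)%E -> upper_gradient dY u gr ->
  upper_gradient d (u \o iota) (fun x => gr (iota x) * (rho x)%:E)%E.
Proof.
move=> mg g0 ug g l H; have [ga [A ga0 gal <-//]] := reparam H.
by have := ug _ _ A; rewrite ga0 gal.
Qed.

Lemma iota_dopen U : dopen dY U -> dopen d (iota @^-1` U).
Proof.
move=> oU x /oU[r [r0 rU]]; exists (Num.min (r / 4) eps^-1); split.
  by rewrite lt_min divr_gt0//= invr_gt0.
move=> y; rewrite /dball /= lt_min => /andP[h1 h2]; apply: rU; rewrite /dball /= iso.
apply: le_lt_trans (de_ub z0 md eps0 geo x y) _.
have e4 : expR (eps * d x y) <= 4.
  by apply: (@le_trans _ _ (expR 1)); [rewrite ler_expR -(mulfV (lt0r_neq0 eps0)) ler_pM2l// ltW|exact: expR1_le4].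
have d0 := mdist_ge0 md x y; have := rho_le1 z0 md eps0 x; have := rho_ge0 d z0 eps x.
move: (rho x) (expR _) (expR_ge0 (eps * d x y)) e4 => q e e0 e4 q0 q1.
apply: (@le_lt_trans _ _ (d x y * 4)); last by rewrite -ltr_pdivlMr.
rewrite -mulrA ler_wpM2l//; apply: (le_trans (y := e * 1)); first by rewrite ler_wpM2l.
by rewrite mulr1.
Qed.

End Reparametrization.

(** * Covering lemmas *)

Lemma exists_maximal_separated {T : Type} (B : set T) (sep : T -> T -> Prop) :
  (forall x y, sep x y -> sep y x) ->
  exists A, [/\ A `<=` B, (forall x y, A x -> A y -> x <> y -> sep x y) &
    forall x, B x -> exists a, A a /\ (a = x \/ ~ sep a x)].
Proof.
move=> sym.
pose P : set (set T) := [set A | A `<=` B /\ forall x y, A x -> A y -> x <> y -> sep x y].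
have [F FP tot|A [[AB As] Amax]] := @Zorn_bigcup T P.
  split; first by move=> x [C FC Cx]; exact: (FP _ FC).1.
  move=> x y [C FC Cx] [D FD Dy] xy; have [CD|DC] := tot _ _ FC FD.
    by apply: (FP _ FD).2 => //; exact: CD.
  by apply: (FP _ FC).2 => //; exact: DC.
exists A; split => // x Bx; apply: contrapT => N.
have nAx : ~ A x by move=> Ax; apply: N; exists x; split => //; left.
apply: (Amax (A `|` [set x])).
  split; first by move=> y Ay; left.
  by move=> H; apply: nAx; apply: H; right.
split; first by move=> y [/AB//|->].
have sx a : A a -> sep a x.
  by move=> Aa; apply: contrapT => ns; apply: N; exists a; split => //; right.
move=> a b [Aa|->] [Ab|->] ab //; [exact: As|exact: sx|exact/sym/sx].
Qed.

Section MeasureLemmas.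
Context {R : realType} {dd : measure_display} {X : measurableType dd}.
Variable m : {measure set X -> \bar R}.

Lemma sum_disjoint_le (s : seq X) (F : X -> set X) E : uniq s -> measurable E ->
  (forall a, measurable (F a)) -> (forall a, a \in s -> F a `<=` E) ->
  (forall a b, a \in s -> b \in s -> a <> b -> F a `&` F b = set0) ->
  (\sum_(a <- s) m (F a) <= m E)%E.
Proof.
move=> + + mF; elim: s E => [|a s IH] E; first by rewrite big_nil.
move=> /= /andP[as_ us] mE FE dis; rewrite big_cons.
have -> : m E = (m (E `&` F a) + m (E `\` F a))%E by rewrite [LHS](measureDI m mE (mF a)) addeC.
apply: leeD.
  by rewrite setIC setIidl//; apply: FE; rewrite mem_head.
apply: IH => //; first exact: measurableD.
  move=> b bs x Fx; split; first by apply: FE Fx; rewrite inE bs orbT.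
  move=> Fax; have : (F a `&` F b) x by [].
  rewrite dis ?mem_head// ?inE ?bs ?orbT// => ab.
  by move: as_; rewrite ab bs.
by move=> b c bs cs; apply: dis; rewrite inE ?bs ?cs orbT.
Qed.

(** For each n only finitely many of the disjoint sets have measure at least 1 / (n + 1). *)
Lemma countable_disjoint (A : set X) (F : X -> set X) E : measurable E ->
  (forall a, measurable (F a)) -> (forall a, A a -> F a `<=` E) ->
  (forall a b, A a -> A b -> a <> b -> F a `&` F b = set0) ->
  (forall a, A a -> (0 < m (F a))%E) -> (m E < +oo)%E -> countable A.
Proof.
move=> mE mF FE dis pos fin.
have -> : A = \bigcup_n (A `&` [set a | ((n.+1%:R^-1)%:E <= m (F a))%E]).
  apply/seteqP; split => [a Aa|a [n _ []//]].
  have [Ey|nf] := eqVneq (m (F a)) +oo%E.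
    by exists 0%N => //; split => //=; rewrite Ey leey.
  have fa : m (F a) \is a fin_num by rewrite ge0_fin_numE// lt_neqAle nf leey.
  have := pos a Aa; rewrite -(fineK fa) lte_fin => p.
  exists (Num.truncn (fine (m (F a)))^-1) => //; split => //=.
  rewrite -(fineK fa) lee_fin -[leRHS]invrK lef_pV2 ?posrE ?invr_gt0//.
  by rewrite ltW// truncnS_gt.
apply: bigcup_countable => // n _; apply: finite_set_countable.
apply: contrapT => inf.
have Efin : m E \is a fin_num by rewrite ge0_fin_numE.
have [B BA cB] := infinite_set_fset (Num.truncn (fine (m E) * n.+1%:R)).+1 inf.
have BA' a : a \in B -> A a /\ ((n.+1%:R^-1)%:E <= m (F a))%E by move=> /BA[].
have : (\sum_(a <- enum_fset B) m (F a) <= m E)%E.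
  apply: sum_disjoint_le; [exact: fset_uniq|exact: mE|exact: mF|by move=> a /BA'[/FE]|].
  by move=> a b /BA'[? _] /BA'[? _]; exact: dis.
apply/negP; rewrite -ltNge; apply: (@lt_le_trans _ _ (\sum_(a <- enum_fset B) (n.+1%:R^-1)%:E)%E).
  rewrite sumEFin -(fineK Efin) lte_fin big_const_seq count_predT iter_addr_0 -[_ *+ size _]mulr_natr.
  rewrite -ltr_pdivrMl ?invr_gt0// invrK mulrC; apply: lt_le_trans (truncnS_gt _) _.
  by rewrite ler_nat.
rewrite !big_seq; apply: lee_sum => a aB; exact: (BA' a aB).2.
Qed.

Lemma countable_enum {T : Type} (A : set T) : countable A ->
  exists e : nat -> option T, [/\ forall a, A a -> exists n, e n = Some a,
    forall n a, e n = Some a -> A a & forall i j a, e i = Some a -> e j = Some a -> i = j].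
Proof.
move=> /countable_injP[f finj].
pose P n a := A a /\ f a = n.
exists (fun n => match pselect (exists a, P n a) with left h => Some (projT1 (cid h)) | _ => None end).
have H n a : (match pselect (exists a, P n a) with left h => Some (projT1 (cid h)) | _ => None end) = Some a -> P n a.
  by case: pselect => // h [<-]; exact: projT2 (cid h).
split.
- move=> a Aa; exists (f a); case: pselect => [h|]; last by case; exists a.
  by case: cid => b [Ab fb] /=; congr Some; apply: finj; [exact/mem_set|exact/mem_set|].
- by move=> n a /H[].
- by move=> i j a /H[_ <-] /H[_ <-].
Qed.

(** Reduces a bound over a countable cover to its finite subfamilies, so that later sums run over
    duplicate-free sequences and can be exchanged freely. *)
Lemma measure_cover_le (A : set X) (G : X -> set X) E M : countable A -> measurable E ->
  (forall a, measurable (G a)) -> (forall x, E x -> exists a, A a /\ G a x) ->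
  (forall s : seq X, uniq s -> (forall a, a \in s -> A a) -> (\sum_(a <- s) m (G a) <= M)%E) ->
  (m E <= M)%E.
Proof.
move=> /countable_enum[e [e1 e2 e3]] mE mG cov H.
pose F n := if e n is Some a then G a else set0.
have mF n : measurable (F n) by rewrite /F; case: (e n).
have EF : E `<=` \bigcup_n F n.
  by move=> x /cov[a [/e1[n en] Gx]]; exists n => //; rewrite /F en.
apply: le_trans (measure_sigma_subadditive m mF mE EF) _.
apply: lime_le; first exact: is_cvg_nneseries.
apply: nearW => N; rewrite -/(index_iota 0 N).
have -> : (\sum_(0 <= i < N) m (F i) = \sum_(a <- pmap e (index_iota 0 N)) m (G a))%E.
  rewrite big_pmap; apply: eq_bigr => i _; rewrite /F.
  by case: (e i) => //=; rewrite measure0.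
apply: H.
  have := iota_uniq 0 (N - 0); rewrite -/(index_iota 0 N).
  elim: (index_iota 0 N) => //= i s IH /andP[is_ us].
  case ei: (e i) => [a|] /=; last exact: IH.
  rewrite IH// andbT; apply/negP; rewrite mem_pmap => /mapP[j js ej].
  by move: is_; rewrite (e3 i j a)// js.
by move=> a; rewrite mem_pmap => /mapP[j _ /esym/e2].
Qed.

End MeasureLemmas.

(** * Growth of the measure *)

Section DensityBounds.
Context {R : realType} {dd : measure_display} {X : measurableType dd}.
Variables (mu : {measure set X -> \bar R}) (w : X -> R).
Hypothesis mw : measurable_fun [set: X] w.
Hypothesis w0 : forall x, 0 <= w x.

Lemma dens_le E c : measurable E -> 0 <= c -> (forall x, E x -> w x <= c) ->
  (density mu mw w0 E <= c%:E * mu E)%E.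
Proof.
move=> mE c0 H; rewrite -integral_cst//; apply: ge0_le_integral => //.
- by move=> x _; rewrite lee_fin.
- by apply/measurable_EFinP; exact: measurable_funTS.
Qed.

Lemma dens_ge E c : measurable E -> 0 <= c -> (forall x, E x -> c <= w x) ->
  (c%:E * mu E <= density mu mw w0 E)%E.
Proof.
move=> mE c0 H; rewrite -integral_cst//; apply: ge0_le_integral => //.
by apply/measurable_EFinP; exact: measurable_funTS.
Qed.

End DensityBounds.

Lemma sum_geometric_le {R : realType} (q : R) N : 0 <= q -> q < 1 ->
  \sum_(0 <= i < N) q ^+ i <= (1 - q)^-1.
Proof.
move=> q0 q1; rewrite -[leRHS]mul1r ler_pdivlMr ?subr_gt0//.
have -> : (\sum_(0 <= i < N) q ^+ i) * (1 - q) = 1 - q ^+ N.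
  elim: N => [|N IH]; first by rewrite big_nil mul0r expr0 subrr.
  by rewrite big_nat_recr//= mulrDl IH exprS; ring.
by have := exprn_ge0 N q0; lra.
Qed.

Section Growth.
Context {R : realType} {dd : measure_display} {X : measurableType dd}.
Variables (d : X -> X -> R) (mu : {measure set X -> \bar R}) (Cd R0 : R).
Hypothesis md : is_metric d.
Hypothesis geo : geodesic_space d.
Hypothesis mX : @measurable _ X = dborel d.
Hypothesis R00 : 0 < R0.
Notation ball := (dball d).
Hypothesis dbl : forall x r, 0 < r -> r <= R0 ->
  [/\ (0 < mu (ball x (2 * r)))%E, (mu (ball x (2 * r)) <= Cd%:E * mu (ball x r))%E &
      (mu (ball x (2 * r)) < +oo)%E].

Lemma dopen_measurable U : dopen d U -> measurable U.
Proof. by move=> oU; rewrite mX; exact: sub_sigma_algebra. Qed.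

Lemma ball_measurable x r : measurable (ball x r).
Proof. by apply: dopen_measurable; exact: dball_dopen. Qed.

Lemma ball_sub x y r s : d x y + s <= r -> ball y s `<=` ball x r.
Proof. by move=> h z; rewrite /dball /= => yz; have := mdist_tri md x y z; lra. Qed.

Lemma ball_mono x s r : s <= r -> ball x s `<=` ball x r.
Proof. by move=> h; apply: ball_sub; rewrite (mdist0 md) add0r. Qed.

Lemma ball_le x y r s : d x y + s <= r -> (mu (ball y s) <= mu (ball x r))%E.
Proof.
by move=> h; apply: le_measure; [exact/mem_set/ball_measurable|exact/mem_set/ball_measurable|exact: ball_sub].
Qed.

Lemma lip_measurable (u : X -> R) (L : R) : 0 < L -> (forall x y, `|u x - u y| <= L * d x y) ->
  measurable_fun [set: X] u.
Proof.
move=> L0 H; apply: (measurability _ (RGenOInfty.measurableE R)) => //.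
move=> _ [_ [r ->] <-]; rewrite setTI; apply: dopen_measurable => x /=.
rewrite in_itv/= andbT => ux; exists ((u x - r) / L); split; first by rewrite divr_gt0// subr_gt0.
move=> y; rewrite /dball /= ltr_pdivlMr// => xy; rewrite in_itv/= andbT.
by have := H x y; have := ler_norm (u x - u y); lra.
Qed.

Lemma mu_ball_fin x r : r <= 2 * R0 -> (mu (ball x r) < +oo)%E.
Proof.
move=> r2; have [_ _ fin] := dbl x R00 (lexx R0).
apply: le_lt_trans fin; apply: ball_le; rewrite (mdist0 md); lra.
Qed.

Lemma mu_ball_gt0 x r : 0 < r -> r <= 2 * R0 -> (0 < mu (ball x r))%E.
Proof.
move=> r0 r2; have h0 : 0 < r / 2 by rewrite divr_gt0.
have hR : r / 2 <= R0 by lra.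
by have [+ _ _] := dbl x h0 hR; have -> : 2 * (r / 2) = r by lra.
Qed.

Definition mb x r := fine (mu (ball x r)).

Lemma mbE x r : r <= 2 * R0 -> mu (ball x r) = (mb x r)%:E.
Proof. by move=> r2; rewrite /mb fineK// ge0_fin_numE// mu_ball_fin. Qed.

Lemma mb_gt0 x r : 0 < r -> r <= 2 * R0 -> 0 < mb x r.
Proof. by move=> r0 r2; rewrite -lte_fin -mbE// mu_ball_gt0. Qed.

Lemma mb_ge0 x r : 0 <= mb x r. Proof. exact: fine_ge0. Qed.

Lemma mb_le x y r s : d x y + s <= r -> r <= 2 * R0 -> mb y s <= mb x r.
Proof.
by move=> h r2; rewrite -lee_fin -!mbE ?ball_le//; have := mdist_ge0 md x y; lra.
Qed.

Lemma Cd_ge1 : 1 <= Cd.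
Proof.
have R00_ := R00.
have [_ + _] := dbl point R00 (lexx R0); rewrite !mbE ?lexx//; last lra.
have := @mb_le point point (2 * R0) R0; rewrite (mdist0 md) -EFinM lee_fin => h1 h2.
have p : 0 < mb point R0 by apply: mb_gt0; lra.
rewrite -(ler_pM2r p) mul1r; apply: le_trans h2; apply: h1; lra.
Qed.

Lemma mb_double x r : 0 < r -> r <= R0 -> mb x (2 * r) <= Cd * mb x r.
Proof.
move=> r0 r2; have R00_ := R00; have [_ + _] := dbl x r0 r2.
by rewrite !mbE; [rewrite -EFinM lee_fin|lra|lra].
Qed.

Lemma mb_pow k x r : 0 < r -> 2 ^+ k * r <= 2 * R0 -> mb x (2 ^+ k * r) <= Cd ^+ k * mb x r.
Proof.
move=> r0; elim: k => [|k IH] h; first by rewrite !expr0 !mul1r.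
have p : 0 < 2 ^+ k * r by rewrite mulr_gt0// exprn_gt0.
rewrite exprS -mulrA in h *; apply: le_trans (mb_double _ p _) _; first lra.
by rewrite exprS -mulrA ler_wpM2l ?IH//; have := Cd_ge1; lra.
Qed.

Lemma mb_small c : 0 < c -> c <= 2 * R0 -> exists C, 0 < C /\ forall x, mb x (2 * R0) <= C * mb x c.
Proof.
move=> c0 cR; have R00_ := R00; have C1 := Cd_ge1.
pose k := Num.truncn (R0 / c).
have kc : R0 / 2 ^+ k <= c.
  rewrite ler_pdivrMr ?exprn_gt0// mulrC -ler_pdivrMr//.
  apply: (@le_trans _ _ k.+1%:R); first by rewrite ltW// truncnS_gt.
  by rewrite -natrX ler_nat ltn_expl.
exists (Cd ^+ k.+1); split; first by rewrite exprn_gt0//; lra.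
move=> x; have r0 : 0 < R0 / 2 ^+ k by rewrite divr_gt0// exprn_gt0.
have E : 2 ^+ k.+1 * (R0 / 2 ^+ k) = 2 * R0.
  by rewrite exprS; field; rewrite expf_neq0.
have := mb_pow (k := k.+1) x r0; rewrite E => /(_ (lexx _)) h.
apply: le_trans h _; rewrite ler_wpM2l ?exprn_ge0//; first lra.
by apply: mb_le; rewrite ?(mdist0 md) ?add0r.
Qed.

(** With s = R0 / 2, take a maximal 2s-separated set in the closed ball of radius r - s. The s-balls
    at its points are disjoint inside the r-ball, and the 4s-balls cover the ball of radius r + s
    because geodesics lead back into radius r - s. Two doublings pass from s to 4s = 2 R0. *)
Lemma growth_step x r : R0 <= r -> (mu (ball x r) < +oo)%E ->
  (mu (ball x (r + R0 / 2)) <= (Cd ^+ 2)%:E * mu (ball x r))%E.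
Proof.
move=> rR fin; have R00_ := R00; pose s := R0 / 2.
have s0 : 0 < s by rewrite divr_gt0.
have sepC a b : 2 * s <= d a b -> 2 * s <= d b a by rewrite (mdistC md).
have [A [AB As Amax]] := @exists_maximal_separated X [set z | d x z <= r - s]
  (fun a b => 2 * s <= d a b) sepC.
have Bs a : A a -> ball a s `<=` ball x r.
  by move=> /AB /= h; apply: ball_sub; lra.
have dis a b : A a -> A b -> a <> b -> ball a s `&` ball b s = set0.
  move=> Aa Ab ab; apply/seteqP; split => // z []; rewrite /dball /= => h1 h2.
  by have := As _ _ Aa Ab ab; have := mdist_tri md a z b; rewrite (mdistC md z b); lra.
have s2 : s <= 2 * R0 by rewrite /s; lra.
have cA : countable A.
  apply: (countable_disjoint (m := mu) (ball_measurable x r) (fun a => ball_measurable a s) Bs dis) => //.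
  by move=> a _; exact: mu_ball_gt0.
apply: (measure_cover_le (m := mu) (G := fun a => ball a (2 * R0)) cA) => [|a|y|u uu uA].
- exact: ball_measurable.
- exact: ball_measurable.
- rewrite /dball /= -/s => xy.
  have [y' [y'1 y'2]] : exists y', d x y' <= r - s /\ d y' y < 2 * s.
    case: (leP (d x y) (r - s)) => h; first by exists y; rewrite (mdist0 md); split => //; lra.
    have [g G] := geo x y.
    have p0 : 0 <= r - s by rewrite /s; lra.
    have [E1 E2] := geod_dist md G p0 (ltW h).
    by exists (g (r - s)); rewrite E1 E2; split => //; lra.
  have [a [Aa ay]] := Amax y' y'1; exists a; split => //.
  have ay' : d a y' < 2 * s.
    by case: ay => [->|/negP]; [rewrite (mdist0 md); lra|rewrite -ltNge].
  by have := mdist_tri md a y' y; rewrite /s in y'2 ay' *; lra.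
- apply: (@le_trans _ _ (\sum_(a <- u) (Cd ^+ 2)%:E * mu (ball a s))%E).
    apply: lee_sum => a _; rewrite !mbE//.
    rewrite -EFinM lee_fin; have := @mb_pow 2 a s s0.
    have -> : 2 ^+ 2 * s = 2 * R0 by rewrite /s; lra.
    by apply.
  rewrite -ge0_sume_distrr//; apply: lee_wpmul2l.
    by rewrite lee_fin exprn_ge0//; have := Cd_ge1; lra.
  apply: sum_disjoint_le => //; [exact: ball_measurable|move=> a; exact: ball_measurable| |].
    by move=> a /uA; exact: Bs.
  by move=> a b /uA Aa /uA Ab; exact: dis.
Qed.

Lemma growth n x : (mu (ball x (R0 + n%:R * (R0 / 2))) <= (Cd ^+ (2 * n) * mb x R0)%:E)%E.
Proof.
have R00_ := R00; elim: n => [|n IH].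
  by rewrite mul0r addr0 muln0 expr0 mul1r mbE//; lra.
have -> : R0 + n.+1%:R * (R0 / 2) = R0 + n%:R * (R0 / 2) + R0 / 2 by rewrite -natr1; lra.
apply: le_trans (growth_step _ _) _.
- by rewrite lerDl mulr_ge0// divr_ge0// ltW.
- exact: le_lt_trans IH (ltry _).
- have C2 : (0 <= (Cd ^+ 2)%:E)%E by rewrite lee_fin exprn_ge0//; have := Cd_ge1; lra.
  by apply: le_trans (lee_wpmul2l C2 IH) _; rewrite -EFinM mulrA -exprD mulnS.
Qed.

Variable beta : R.
Hypothesis beta_gt : 4 * ln Cd / R0 < beta.

Lemma beta_gt0 : 0 < beta.
Proof.
apply: le_lt_trans beta_gt; rewrite divr_ge0 ?(ltW R00)// mulr_ge0// ln_ge0//; exact: Cd_ge1.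
Qed.

Lemma tail_measurable x : measurable_fun [set: X] (fun y => expR (- (beta * d x y))).
Proof.
apply: measurableT_comp => //; apply: measurableT_comp => //.
apply: (lip_measurable beta_gt0) => y z; rewrite -mulrBr normrM gtr0_norm ?beta_gt0//.
rewrite ler_pM2l ?beta_gt0//; have := mdist_lip md x y z.
by rewrite (mdistC md y) (mdistC md z x).
Qed.

(** On shells of width R0 / 2 the weight decays by exp(-beta R0 / 2) while the measure grows by at
    most Cd ^ 2. The product [q] of these factors is below 1 exactly when beta > 4 log Cd / R0, and
    a geometric series remains. *)
Lemma tail_bound : exists C, 0 < C /\ forall x,
  (\int[mu]_y (expR (- (beta * d x y)))%:E <= (C * mb x R0)%:E)%E.
Proof.
have R00_ := R00; have C1 := Cd_ge1; have b0 := beta_gt0.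
pose tau := R0 / 2; pose q := expR (- (beta * tau)) * Cd ^+ 2.
have tau0 : 0 < tau by rewrite divr_gt0.
have q0 : 0 < q by rewrite mulr_gt0 ?expR_gt0// exprn_gt0//; lra.
have q1 : q < 1.
  rewrite /q expRN ltr_pdivrMl ?expR_gt0// mulr1 -[Cd]lnK ?posrE; last lra.
  rewrite -expRM_natl ltr_expR /tau; move: beta_gt; rewrite ltr_pdivrMr//; lra.
exists (expR (beta * tau) * (1 - q)^-1); split.
  by rewrite mulr_gt0 ?expR_gt0// invr_gt0 subr_gt0.
move=> x; pose D := density mu (tail_measurable x) (fun y => expR_ge0 (- (beta * d x y))).
pose F n := if n is k.+1 then ball x (R0 + n%:R * tau) `\` ball x (R0 + k%:R * tau) else ball x R0.
have mF n : measurable (F n).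
  case: n => [|n]; first exact: ball_measurable.
  by apply: measurableD; exact: ball_measurable.
have cov : [set: X] `<=` \bigcup_n F n.
  move=> y _.
  have [n ny] : exists n : nat, d x y < R0 + n%:R * tau.
    exists (Num.truncn (d x y / tau)).+1; have := truncnS_gt (d x y / tau).
    by rewrite ltr_pdivrMr//; lra.
  elim: n ny => [|n IH] ny; first by exists 0%N => //; rewrite /F /dball /=; lra.
  case: (ltP (d x y) (R0 + n%:R * tau)) => h; first exact: IH.
  by exists n.+1 => //; split => //; rewrite /dball /=; apply/negP; rewrite -leNgt.
rewrite -[leLHS]/(D setT).
apply: le_trans (measure_sigma_subadditive D mF measurableT cov) _.
apply: lime_le; first exact: is_cvg_nneseries.
have V0 := mb_ge0 x R0; have E0 := expR_gt0 (beta * tau).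
apply: nearW => N; rewrite -/(index_iota 0 N).
apply: (@le_trans _ _ (\sum_(0 <= i < N) (expR (beta * tau) * mb x R0 * q ^+ i)%:E)%E).
  apply: lee_sum => -[|n] _.
    apply: le_trans (dens_le _ _ _ (ball_measurable x R0) ler01 _) _.
      by move=> y _; rewrite -[leRHS]expR0 ler_expR oppr_le0 mulr_ge0 ?(ltW b0)// (mdist_ge0 md).
    rewrite mul1e mbE; last lra.
    rewrite lee_fin expr0 mulr1 ler_peMl// -[leLHS]expR0 ler_expR mulr_ge0 ?ltW//.
  apply: le_trans (dens_le _ _ _ (mF n.+1) (expR_ge0 (- (beta * (n%:R * tau)))) _) _.
    move=> y [_]; rewrite /dball /= => /negP; rewrite -leNgt => h.
    by rewrite ler_expR lerN2 ler_pM2l//; lra.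
  have sub : (mu (F n.+1) <= (Cd ^+ (2 * n.+1) * mb x R0)%:E)%E.
    apply: le_trans (growth n.+1 x); apply: le_measure; [exact/mem_set|exact/mem_set/ball_measurable|by move=> y []].
  apply: le_trans (lee_wpmul2l _ sub) _; first by rewrite lee_fin expR_ge0.
  rewrite -EFinM lee_fin le_eqVlt; apply/orP; left; apply/eqP.
  have -> : q ^+ n.+1 =
      expR (- (beta * tau)) * expR (- (beta * (n%:R * tau))) * Cd ^+ (2 * n.+1).
    rewrite /q exprMn -exprM -expRM_natl -expRD; congr (expR _ * _).
    by rewrite -natr1; ring.
  have E1 : expR (beta * tau) * expR (- (beta * tau)) = 1 by rewrite -expRD subrr expR0.
  transitivity (expR (beta * tau) * expR (- (beta * tau)) *
    (expR (- (beta * (n%:R * tau))) * (Cd ^+ (2 * n.+1) * mb x R0))); last by ring.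
  by rewrite E1 mul1r.
rewrite sumEFin lee_fin -mulr_sumr.
have -> : expR (beta * tau) / (1 - q) * mb x R0 = expR (beta * tau) * mb x R0 * (1 - q)^-1 by ring.
rewrite ler_wpM2l ?mulr_ge0 ?(ltW E0)//.
by apply: sum_geometric_le => //; exact: ltW.
Qed.

End Growth.

(** * Doubling of the weighted measure *)

Section WeightedMeasure.
Context {R : realType} {dd : measure_display} {X : measurableType dd}.
Variables (d : X -> X -> R) (mu : {measure set X -> \bar R}) (z0 : X) (eps beta Cd R0 : R).
Hypothesis md : is_metric d.
Hypothesis geo : geodesic_space d.
Hypothesis mX : @measurable _ X = dborel d.
Hypothesis R00 : 0 < R0.
Hypothesis eps0 : 0 < eps.
Hypothesis dbl : forall x r, 0 < r -> r <= R0 ->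
  [/\ (0 < mu (dball d x (2 * r)))%E, (mu (dball d x (2 * r)) <= Cd%:E * mu (dball d x r))%E &
      (mu (dball d x (2 * r)) < +oo)%E].
Hypothesis beta_gt : 4 * ln Cd / R0 < beta.
Notation rho := (rho_eps d z0 eps).
Notation de := (d_eps d z0 eps).
Hypothesis close : forall C, exists K, 2 <= K /\ forall x y,
  de x y <= C * rho x -> de x y <= C * rho y -> expR (eps * d x y) <= K.

Let beta0 : 0 < beta. Proof. exact: (beta_gt0 md mX R00 dbl beta_gt). Qed.
Let Cd1 : 1 <= Cd. Proof. exact: (Cd_ge1 md mX R00 dbl). Qed.
Let mde : is_metric de := de_metric z0 md eps0 geo.

Definition weight x := expR (- (beta * d x z0)).

Lemma weight_measurable : measurable_fun [set: X] weight.
Proof.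
rewrite (_ : weight = fun y => expR (- (beta * d z0 y))).
  exact: (tail_measurable md mX R00 dbl beta_gt z0).
by apply/funext => y; rewrite /weight (mdistC md).
Qed.

Lemma weight_ge0 x : 0 <= weight x. Proof. exact: expR_ge0. Qed.
Lemma weight_gt0 x : 0 < weight x. Proof. exact: expR_gt0. Qed.

Definition nu : {measure set X -> \bar R} := density mu weight_measurable weight_ge0.

Lemma weight_ratio x y D : d x y <= D -> weight y <= expR (beta * D) * weight x.
Proof.
move=> h; rewrite /weight -expRD ler_expR -!mulrN -mulrDr ler_pM2l//.
by have := mdist_tri md x y z0; lra.
Qed.

Lemma weight_ratioN x y D : d x y <= D -> expR (- (beta * D)) * weight x <= weight y.
Proof.
move=> h; rewrite expRN -ler_pdivlMl ?invr_gt0 ?expR_gt0// invrK.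
by apply: weight_ratio; rewrite (mdistC md).
Qed.

Lemma nu_le_mu x E D : measurable E -> (forall y, E y -> d x y <= D) ->
  (nu E <= (expR (beta * D) * weight x)%:E * mu E)%E.
Proof.
move=> mE H; apply: dens_le => //; first by rewrite mulr_ge0 ?expR_ge0 ?weight_ge0.
by move=> y /H; exact: weight_ratio.
Qed.

Lemma nu_ge_mu x E D : measurable E -> (forall y, E y -> d x y <= D) ->
  ((expR (- (beta * D)) * weight x)%:E * mu E <= nu E)%E.
Proof.
move=> mE H; apply: dens_ge => //; first by rewrite mulr_ge0 ?expR_ge0 ?weight_ge0.
by move=> y /H; exact: weight_ratioN.
Qed.

Lemma eball_dopen x r : dopen d (dball de x r).
Proof.
apply: (@iota_dopen R X X d z0 eps md geo eps0 de id _ (dball de x r)) => //.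
exact: dball_dopen.
Qed.

Lemma eball_measurable x r : measurable (dball de x r).
Proof. exact: (dopen_measurable mX (@eball_dopen x r)). Qed.

Lemma expR_eps_le4 s : s <= eps^-1 -> expR (eps * s) <= 4.
Proof.
move=> h; apply: (@le_trans _ _ (expR 1)); last exact: expR1_le4.
by rewrite ler_expR -(mulfV (lt0r_neq0 eps0)) ler_pM2l.
Qed.

Lemma de_lt x y s : d x y < s -> s <= eps^-1 -> de x y < 4 * (s * rho x).
Proof.
move=> xs s1; apply: le_lt_trans (de_leK z0 md geo eps0 (K := 4) _) _.
  by apply: expR_eps_le4; lra.
by rewrite ltr_pM2l// ltr_pM2r// rho_gt0.
Qed.

(** By [de_initial] with L = 1 / eps, a point farther than 1 / eps in d is at least rho / (e eps) >=
    rho / (4 eps) away in d_eps. *)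
Lemma d_le x y r : de x y < r -> r <= rho x / (4 * eps) -> d x y <= eps^-1 /\ d x y * rho x < 4 * r.
Proof.
move=> xr r1; have h : d x y <= eps^-1.
  rewrite leNgt; apply/negP => h.
  have ie : 0 <= eps^-1 by rewrite invr_ge0 ltW.
  have := de_initial z0 md eps0 geo ie (ltW h).
  have e1 : expR (- (eps * eps^-1)) >= 4^-1.
    by rewrite mulfV ?lt0r_neq0// expRN lef_pV2 ?posrE ?expR_gt0//; exact: expR1_le4.
  have : eps^-1 * 4^-1 * rho x <= eps^-1 * expR (- (eps * eps^-1)) * rho x.
    by rewrite ler_wpM2r ?rho_ge0// ler_wpM2l.
  have -> : eps^-1 * 4^-1 * rho x = rho x / (4 * eps) by field; rewrite lt0r_neq0.
  lra.
split => //; apply: le_lt_trans (de_geK z0 md geo eps0 (K := 4) _) _.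
  exact: expR_eps_le4.
by rewrite ltr_pM2l.
Qed.

Lemma nu_fin E : measurable E -> (nu E < +oo)%E.
Proof.
move=> mE; have [C [C0 H]] := tail_bound md geo mX R00 dbl beta_gt.
apply: (@le_lt_trans _ _ (nu setT)); first by apply: le_measure; [exact/mem_set|exact/mem_set/measurableT|exact: subsetT].
apply: le_lt_trans (ltry (C * mb d mu z0 R0)); apply: le_trans (H z0).
rewrite le_eqVlt; apply/orP; left; apply/eqP.
by rewrite /nu /density /= /dens; apply: eq_integral => y _; rewrite /weight (mdistC md).
Qed.

Lemma nu_ball_gt0 x s : 0 < s -> s <= R0 -> (0 < nu (dball d x s))%E.
Proof.
move=> s0 sR; have p : (0 < mu (dball d x s))%E.
  by apply: (mu_ball_gt0 dbl x s0); have := R00; lra.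
apply: lt_le_trans (nu_ge_mu (x := x) (D := s) (ball_measurable md mX x s) _).
  by rewrite mule_gt0// lte_fin mulr_gt0 ?expR_gt0 ?weight_gt0.
by move=> y /ltW.
Qed.

Lemma nu_eball_gt0 x r : 0 < r -> (0 < nu (dball de x r))%E.
Proof.
move=> r0; have r0' := rho_gt0 d z0 eps x; have R00_ := R00.
pose s := Num.min (Num.min R0 eps^-1) (r / (4 * rho x)).
have s0 : 0 < s by rewrite !lt_min R00 invr_gt0 eps0 divr_gt0// mulr_gt0.
have s1 : s <= R0 by rewrite !ge_min lexx.
have s2 : s <= eps^-1 by rewrite !ge_min lexx orbT.
have s3 : s <= r / (4 * rho x) by rewrite !ge_min lexx !orbT.
apply: lt_le_trans (nu_ball_gt0 x s0 s1) _.
apply: le_measure; [exact/mem_set/ball_measurable|exact/mem_set/eball_measurable|].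
move=> y xy; rewrite /dball /=; apply: lt_le_trans (de_lt xy s2) _.
by move: s3; rewrite ler_pdivlMr ?mulr_gt0//; lra.
Qed.

(* Points deep inside: the ball is comparable to a ball of [d] of radius at most [R0]. *)
Lemma nu_doubling_small : exists c, 0 < c /\ exists C, 0 < C /\
  forall x r, 0 < r -> r <= c * rho x -> (nu (dball de x (6 * r)) <= C%:E * nu (dball de x r))%E.
Proof.
have R00_ := R00; have ie : 0 < eps^-1 by rewrite invr_gt0.
(* The first bound makes [6 * r] admissible in [d_le], which gives d < 24 r / rho = 96 s, below 2 ^
   7 s; the second keeps 2 ^ 7 s within 2 R0. *)
pose c := Num.min (eps^-1 / 24) (R0 / 16).
have c0 : 0 < c by rewrite lt_min !divr_gt0.
have c1 : c <= eps^-1 / 24 by rewrite ge_min lexx.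
have c2 : c <= R0 / 16 by rewrite ge_min lexx orbT.
exists c; split => //; exists (expR (beta * eps^-1) * expR (beta * eps^-1) * Cd ^+ 7); split.
  by apply: mulr_gt0; [rewrite mulr_gt0 ?expR_gt0|apply: exprn_gt0; have := Cd1; lra].
move=> x r r0 rc; have q0 := rho_gt0 d z0 eps x.
pose s := r / (4 * rho x).
have sr : s * rho x = r / 4 by rewrite /s; field; rewrite lt0r_neq0.
have s0 : 0 < s by rewrite divr_gt0// mulr_gt0.
have sc : s <= c / 4 by rewrite /s ler_pdivrMr ?mulr_gt0//; lra.
have big : dball de x (6 * r) `<=` dball d x (2 ^+ 7 * s).
  move=> y xy.
  have h : 6 * r <= rho x / (4 * eps).
    have : c * rho x <= eps^-1 / 24 * rho x by rewrite ler_pM2r.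
    have -> : rho x / (4 * eps) = 6 * (eps^-1 / 24 * rho x) by field; rewrite lt0r_neq0.
    lra.
  have [_] := d_le xy h; rewrite /dball /= => h2; rewrite -(ltr_pM2r q0) -mulrA sr.
  by apply: lt_le_trans h2 _; rewrite !exprS expr0; lra.
have small : dball d x s `<=` dball de x r.
  move=> y xy; rewrite /dball /=; apply: lt_le_trans (de_lt xy _) _; first lra.
  by rewrite sr; lra.
have h7 : 2 ^+ 7 * s <= 2 * R0 by rewrite !exprS expr0; lra.
have dbig y : dball de x (6 * r) y -> d x y <= eps^-1.
  move=> xy; apply: (d_le xy _).1.
  have : c * rho x <= eps^-1 / 24 * rho x by rewrite ler_pM2r.
  have -> : rho x / (4 * eps) = 6 * (eps^-1 / 24 * rho x) by field; rewrite lt0r_neq0.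
  lra.
apply: le_trans (nu_le_mu (eball_measurable x (6 * r)) dbig) _.
have m7 := mb_pow md mX R00 dbl (k := 7) x s0 h7.
have s2 : s <= 2 * R0 by lra.
have lo : ((expR (- (beta * eps^-1)) * weight x * mb d mu x s)%:E <= nu (dball de x r))%E.
  rewrite EFinM -(mbE md mX R00 dbl)//.
  apply: le_trans (nu_ge_mu (D := eps^-1) (ball_measurable md mX x s) _) _.
    by move=> y; rewrite /dball /=; lra.
  by apply: le_measure; [exact/mem_set/ball_measurable|exact/mem_set/eball_measurable|].
have C70 : (0 <= (expR (beta * eps^-1) * expR (beta * eps^-1) * Cd ^+ 7)%:E)%E.
  rewrite lee_fin; apply: mulr_ge0; first by rewrite mulr_ge0 ?expR_ge0.
  by apply: exprn_ge0; have := Cd1; lra.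
apply: le_trans (lee_wpmul2l C70 lo).
apply: (@le_trans _ _ ((expR (beta * eps^-1) * weight x)%:E * (Cd ^+ 7 * mb d mu x s)%:E)%E).
  apply: lee_wpmul2l; first by rewrite lee_fin mulr_ge0 ?expR_ge0 ?weight_ge0.
  apply: le_trans (_ : _ <= (mb d mu x (2 ^+ 7 * s))%:E)%E _; last by rewrite lee_fin.
  rewrite -(mbE md mX R00 dbl)//; apply: le_measure => //.
    exact/mem_set/eball_measurable.
  exact/mem_set/ball_measurable.
rewrite -!EFinM lee_fin le_eqVlt; apply/orP; left; apply/eqP.
have E1 : expR (beta * eps^-1) * expR (- (beta * eps^-1)) = 1 by rewrite -expRD subrr expR0.
transitivity (expR (beta * eps^-1) * expR (- (beta * eps^-1)) *
  (expR (beta * eps^-1) * weight x * (Cd ^+ 7 * mb d mu x s))); last by ring.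
by rewrite E1 mul1r.
Qed.

(* Balls reaching far towards the boundary: compare with a unit ball of [d] around an
   ancestor of the center, using that all far away points of the ball lie behind it. *)
Lemma nu_doubling_large c rmax : 0 < c -> 0 < rmax -> exists C, 0 < C /\
  forall x r, 0 < r -> c * rho x < r -> r <= rmax ->
    (nu (dball de x (6 * r)) <= C%:E * nu (dball de x r))%E.
Proof.
move=> c0 rm0; have R00_ := R00; have ie : 0 < eps^-1 by rewrite invr_gt0.
(* Ancestors are taken at height rho = c2 r: the first bound keeps this at most 1, the second places
   the ancestor within r / 2 of its point. *)
pose c2 := Num.min rmax^-1 (eps / 4).
have c20 : 0 < c2 by rewrite lt_min invr_gt0 rm0 divr_gt0.
have c2a : c2 <= rmax^-1 by rewrite ge_min lexx.
have c2b : c2 <= eps / 4 by rewrite ge_min lexx orbT.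
have c2e : 2 / eps * c2 <= 2^-1.
  have -> : 2^-1 = 2 / eps * (eps / 4) :> R by field; rewrite lt0r_neq0.
  by rewrite ler_pM2l// divr_gt0.
(* The ancestors of the center and of a point of the ball are at most r / 2 + 6 r + r / 2 = 7 r
   apart and have rho at least c2 r, so [kap] bounds their d-distance. *)
have [K [K2 HK]] := close (7 / c2).
have K0 : 0 < K by lra.
pose kap := ln K / eps.
have kap_le x y : expR (eps * d x y) <= K -> d x y <= kap.
  move=> h; rewrite /kap ler_pdivlMr// mulrC -[leLHS]expRK ler_ln ?posrE// expR_gt0//.
(* The ancestor [w] of the center has rho at most C3 r. The d-ball of radius [c3] around it then has
   d_eps-size at most 4 c3 rho(w) <= r / 2 and stays in the r-ball of [x]. *)
pose C3 := Num.max c^-1 c2.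
have C30 : 0 < C3 by rewrite lt_max c20 orbT.
pose c3 := Num.min (Num.min R0 eps^-1) (8 * C3)^-1.
have c30 : 0 < c3 by rewrite !lt_min R00 ie invr_gt0 mulr_gt0.
have c3a : c3 <= R0 by rewrite !ge_min lexx.
have c3b : c3 <= eps^-1 by rewrite !ge_min lexx orbT.
have c3c : c3 * (8 * C3) <= 1 by rewrite -ler_pdivlMr ?mulr_gt0// mul1r !ge_min lexx !orbT.
have [Ct [Ct0 tail]] := tail_bound md geo mX R00 dbl beta_gt.
have [Cs [Cs0 small]] := mb_small md mX R00 dbl c30 ltac:(lra).
exists (expR (2 * (beta * kap)) * Ct * Cs * expR (beta * c3)); split.
  by rewrite !mulr_gt0 ?expR_gt0.
move=> x r r0 cr rm.
have c2r : c2 * r <= 1.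
  apply: (@le_trans _ _ (rmax^-1 * rmax)); last by rewrite mulVf ?lt0r_neq0.
  by apply: ler_pM => //; exact: ltW.
have anc y : exists v, [/\ c2 * r <= rho v, rho v <= Num.max (rho y) (c2 * r),
    d y z0 = d v z0 + d v y & de y v <= r / 2].
  case: (leP (c2 * r) (rho y)) => h.
    by exists y; rewrite (mdist0 mde) (mdist0 md) addr0 lexx divr_ge0 ?(ltW r0).
  have [v [rv dv ev]] := ancestor md geo eps0 (ltW h) c2r.
  exists v; split => //; [by rewrite rv|by rewrite rv|].
  apply: le_trans ev _; rewrite mulrA; have : 2 / eps * c2 * r <= 2^-1 * r by rewrite ler_pM2r.
  lra.
have [w [w1 w2 _ w4]] := anc x.
have rw : rho w <= C3 * r.
  apply: le_trans w2 _; rewrite ge_max; apply/andP; split.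
    apply: (@le_trans _ _ (c^-1 * r)); first by rewrite ler_pdivlMl// ltW.
    by rewrite ler_pM2r// le_max lexx.
  by rewrite ler_pM2r// le_max lexx orbT.
(* A geodesic from [z0] to [y] passes through the ancestor [v], which is within [kap] of [w]; hence
   d(y,z0) is at least d(w,z0) + d(w,y) - 2 kap, and [tail_bound] at [w] applies. *)
have far y : dball de x (6 * r) y -> weight y <= expR (2 * (beta * kap)) * weight w * expR (- (beta * d w y)).
  rewrite /dball /= => xy; have [v [v1 v2 v3 v4]] := anc y.
  have vw : de v w <= 7 * r.
    have := mdist_tri mde v y w; have := mdist_tri mde y x w.
    by rewrite (mdistC mde v y) (mdistC mde y x); lra.
  have P q : c2 * r <= q -> de v w <= 7 / c2 * q.
    move=> h; apply: le_trans vw _.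
    have -> : 7 * r = 7 / c2 * (c2 * r) by field; rewrite lt0r_neq0.
    by rewrite ler_pM2l// divr_gt0.
  have dk := kap_le _ _ (HK _ _ (P _ v1) (P _ w1)).
  rewrite /weight -!expRD ler_expR v3.
  have h : d w z0 + d w y - 2 * kap <= d v z0 + d v y.
    have := mdist_tri md w v z0; have := mdist_tri md w v y.
    by rewrite (mdistC md w v); lra.
  have : beta * (d w z0 + d w y - 2 * kap) <= beta * (d v z0 + d v y) by rewrite ler_pM2l.
  lra.
have lo : ((expR (- (beta * c3)) * weight w * mb d mu w c3)%:E <= nu (dball de x r))%E.
  have c3R : c3 <= 2 * R0 by lra.
  rewrite EFinM -(mbE md mX R00 dbl)//.
  apply: le_trans (nu_ge_mu (D := c3) (ball_measurable md mX w c3) _) _.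
    by move=> y; rewrite /dball /=; lra.
  apply: le_measure; [exact/mem_set/ball_measurable|exact/mem_set/eball_measurable|].
  move=> y wy; rewrite /dball /=; have := de_lt wy c3b; have := mdist_tri mde x w y.
  have : c3 * rho w <= c3 * (C3 * r) by rewrite ler_pM2l.
  have : c3 * (8 * C3) * r <= 1 * r by rewrite ler_pM2r.
  lra.
have up : (nu (dball de x (6 * r)) <= (expR (2 * (beta * kap)) * weight w * (Ct * mb d mu w R0))%:E)%E.
  pose F y := expR (2 * (beta * kap)) * weight w * expR (- (beta * d w y)).
  have mF : measurable_fun [set: X] F.
    apply: measurable_funM => //; exact: (tail_measurable md mX R00 dbl beta_gt w).
  have A0 : 0 <= expR (2 * (beta * kap)) * weight w by rewrite mulr_ge0 ?expR_ge0 ?weight_ge0.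
  apply: (@le_trans _ _ (\int[mu]_(y in dball de x (6 * r)) (F y)%:E)%E).
    apply: ge0_le_integral => //.
    - exact: eball_measurable.
    - by move=> y _; rewrite lee_fin weight_ge0.
    - by apply/measurable_EFinP; apply: measurable_funTS; exact: weight_measurable.
    - by apply/measurable_EFinP; apply: measurable_funTS.
  apply: (@le_trans _ _ (\int[mu]_y (F y)%:E)%E).
    apply: ge0_subset_integral => //; first exact: eball_measurable.
      by apply/measurable_EFinP.
    by move=> y _; rewrite lee_fin mulr_ge0 ?expR_ge0.
  rewrite /F; under eq_integral do rewrite EFinM.
  rewrite ge0_integralZl_EFin//.
  - by rewrite [leRHS]EFinM; apply: lee_wpmul2l; [rewrite lee_fin|exact: tail].
  - by apply/measurable_EFinP; exact: (tail_measurable md mX R00 dbl beta_gt w).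
have CC0 : (0 <= (expR (2 * (beta * kap)) * Ct * Cs * expR (beta * c3))%:E)%E.
  by rewrite lee_fin !mulr_ge0 ?expR_ge0 ?ltW.
apply: le_trans up _; apply: le_trans (lee_wpmul2l CC0 lo); rewrite -EFinM lee_fin.
have E1 : expR (beta * c3) * expR (- (beta * c3)) = 1 by rewrite -expRD subrr expR0.
have mRs : mb d mu w R0 <= Cs * mb d mu w c3.
  apply: le_trans (small w); apply: (mb_le md mX R00 dbl); rewrite ?(mdist0 md); lra.
have -> : expR (2 * (beta * kap)) * Ct * Cs * expR (beta * c3) *
   (expR (- (beta * c3)) * weight w * mb d mu w c3) =
   (expR (beta * c3) * expR (- (beta * c3))) *
   (expR (2 * (beta * kap)) * weight w * (Ct * (Cs * mb d mu w c3))) by ring.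
rewrite E1 mul1r ler_wpM2l ?mulr_ge0 ?expR_ge0 ?weight_ge0// ler_pM2l//.
Qed.

(** The factor 6 instead of 2 leaves room for moving the center of a ball of the extension into
    X. *)
Lemma nu_doubling rmax : 0 < rmax -> exists C, 1 <= C /\ forall x r, 0 < r -> r <= rmax ->
  (nu (dball de x (6 * r)) <= C%:E * nu (dball de x r))%E.
Proof.
move=> rm0; have [c [c0 [C1 [C10 H1]]]] := nu_doubling_small.
have [C2 [C20 H2]] := nu_doubling_large c0 rm0.
exists (1 + C1 + C2); split; first lra.
move=> x r r0 rm; case: (leP r (c * rho x)) => h.
  apply: le_trans (H1 x r r0 h) _; apply: lee_wpmul2r => //; rewrite lee_fin; lra.
apply: le_trans (H2 x r r0 h rm) _; apply: lee_wpmul2r => //; rewrite lee_fin; lra.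
Qed.

Lemma nu_doubling_iter rmax k : 0 < rmax -> exists C, 1 <= C /\ forall x r, 0 < r -> r <= rmax ->
  (nu (dball de x (6 ^+ k * r)) <= C%:E * nu (dball de x r))%E.
Proof.
move=> rm0; elim: k => [|k [C [C1 IH]]].
  by exists 1; split => // x r _ _; rewrite expr0 !mul1e mul1r.
have rk : 0 < 6 ^+ k * rmax by rewrite mulr_gt0// exprn_gt0.
have [C' [C1' H]] := nu_doubling rk.
exists (C' * C); split; first by rewrite mulr_ege1.
move=> x r r0 rm; rewrite exprS -mulrA; apply: le_trans (H _ _ _ _) _.
- by rewrite mulr_gt0// exprn_gt0.
- by rewrite ler_pM2l// exprn_gt0.
- rewrite EFinM -muleA; apply: lee_wpmul2l; last exact: IH.
  by rewrite lee_fin; lra.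
Qed.

Lemma de_bounded x y : de x y <= 4 / eps.
Proof.
suff H u : de z0 u <= 2 / eps.
  have := mdist_tri mde x z0 y; have := H x; have := H y; rewrite (mdistC mde x z0); lra.
have [g G] := geo z0 u; have := de_radial md geo eps0 G (lexx 0) (mdist_ge0 md z0 u) (lexx _).
by case: (G) => -> -> _; rewrite mulr0 oppr0 expR0 mulr1.
Qed.

End WeightedMeasure.

(** * Chaining along a Whitney cover *)

Lemma linked_last {R : realType} {X : Type} (d : X -> X -> R) (P : X -> Prop) s x y :
  linked d P s x y -> P y.
Proof. by elim. Qed.

Section Whitney.
Context {R : realType} {dd : measure_display} {X : measurableType dd}.
Variables (d : X -> X -> R) (mu : {measure set X -> \bar R}) (Cd R0 : R).
Hypothesis md : is_metric d.
Hypothesis mX : @measurable _ X = dborel d.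
Hypothesis R00 : 0 < R0.
Notation ball := (dball d).
Hypothesis dbl : forall x r, 0 < r -> r <= R0 ->
  [/\ (0 < mu (ball x (2 * r)))%E, (mu (ball x (2 * r)) <= Cd%:E * mu (ball x r))%E &
      (mu (ball x (2 * r)) < +oo)%E].
Notation mb := (mb d mu).

Variables (w : X -> R) (W : R).
Hypothesis mw : measurable_fun [set: X] w.
Hypothesis w0 : forall x, 0 <= w x.
Hypothesis wpos : forall x, 0 < w x.
Hypothesis W1 : 1 <= W.
Notation nu := (density mu mw w0).
Hypothesis nu_fin : forall E, measurable E -> (nu E < +oo)%E.

Variables (Omega : set X) (s : X -> R) (Lam : R) (k : nat).
Hypothesis mOmega : measurable Omega.
Hypothesis Lam16 : 16 <= Lam.
Hypothesis kLam : 4 * (5 * Lam + 4) <= 2 ^+ k.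
Hypothesis s_gt0 : forall x, Omega x -> 0 < s x.
Hypothesis s_R0 : forall x, Omega x -> 2 ^+ k * (s x / 4) <= 2 * R0.
Hypothesis s_near : forall x y, Omega x -> d x y <= Lam * s x ->
  [/\ Omega y, s y <= 2 * s x & s x <= 2 * s y].
Hypothesis w_near : forall x y, Omega x -> d x y <= Lam * s x -> w y <= W * w x /\ w x <= W * w y.

Let Cd1 : 1 <= Cd. Proof. exact: (Cd_ge1 md mX R00 dbl). Qed.
Let mball x r : measurable (ball x r). Proof. exact: ball_measurable. Qed.
Notation sb x := (s x / 4).
Let V x := fine (nu (ball x (sb x))).

Let nuE E : measurable E -> nu E = (fine (nu E))%:E.
Proof. by move=> mE; rewrite fineK// ge0_fin_numE// nu_fin. Qed.

Let VE x : nu (ball x (sb x)) = (V x)%:E. Proof. by apply: nuE. Qed.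

Let V_ge0 x : 0 <= V x. Proof. exact: fine_ge0. Qed.

Let sb_gt0 x : Omega x -> 0 < sb x. Proof. by move=> /s_gt0 h; rewrite divr_gt0. Qed.

Let pow2k : 1 <= 2 ^+ k :> R. Proof. by rewrite exprn_ege1// ler1n. Qed.

Let rad_le x c : Omega x -> c <= 2 ^+ k / 4 -> c * s x <= 2 * R0.
Proof.
move=> Ox h; apply: le_trans (s_R0 Ox); have := s_gt0 Ox => sx.
by rewrite (mulrC (s x)) mulrA ler_pM2r.
Qed.

Let mb_sb x c : Omega x -> c <= 2 ^+ k / 4 -> mb x (c * s x) <= Cd ^+ k * mb x (sb x).
Proof.
move=> Ox h; have sx := s_gt0 Ox.
apply: le_trans (mb_pow md mX R00 dbl _ (sb_gt0 Ox) (s_R0 Ox)).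
apply: (mb_le md mX R00 dbl); last exact: s_R0.
by rewrite (mdist0 md) add0r (mulrC (s x)) mulrA ler_pM2r.
Qed.

Let sb_le2 x : Omega x -> sb x <= 2 * R0.
Proof.
move=> Ox; apply: le_trans (s_R0 Ox); rewrite ler_peMl//.
by apply: ltW; exact: sb_gt0.
Qed.

Let nu_up x c : Omega x -> c <= Lam -> (nu (ball x (c * s x)) <= (W * w x * mb x (c * s x))%:E)%E.
Proof.
move=> Ox cL; have sx := s_gt0 Ox; have L16 := Lam16; have kL := kLam.
have c2 : c * s x <= 2 * R0 by apply: rad_le => //; lra.
rewrite EFinM -(mbE md mX R00 dbl)//; apply: dens_le => //.
  by rewrite mulr_ge0// (le_trans ler01).
move=> y; rewrite /dball /= => xy; apply: (w_near Ox _).1.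
by apply: le_trans (ltW xy) _; rewrite ler_pM2r.
Qed.

Let nu_lo x : Omega x -> w x * mb x (sb x) <= W * V x.
Proof.
move=> Ox; have sx := s_gt0 Ox; have L16 := Lam16.
have W0 : 0 < W by apply: lt_le_trans W1.
rewrite mulrC -ler_pdivrMl// mulrCA -lee_fin -VE mulrC mulrC EFinM muleC.
rewrite -(mbE md mX R00 dbl) ?sb_le2//; apply: dens_ge => //.
  by rewrite mulr_ge0// invr_ge0 ltW.
move=> y; rewrite /dball /= => xy; rewrite ler_pdivrMl//.
by apply: (w_near Ox _).2; apply: le_trans (ltW xy) _; rewrite ler_pdivrMr//; nra.
Qed.

Let C1 := W ^+ 2 * Cd ^+ k.

Let C1_ge1 : 1 <= C1.
Proof. by rewrite /C1 mulr_ege1// exprn_ege1. Qed.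

Let nu_sb x c : Omega x -> c <= Lam -> (nu (ball x (c * s x)) <= (C1 * V x)%:E)%E.
Proof.
move=> Ox cL; have L16 := Lam16; have kL := kLam.
apply: le_trans (nu_up Ox cL) _; rewrite lee_fin.
have W0 : 0 < W by apply: lt_le_trans W1.
have h : mb x (c * s x) <= Cd ^+ k * mb x (sb x) by apply: mb_sb => //; lra.
have A0 : 0 <= W * w x by rewrite mulr_ge0// ltW.
apply: le_trans (ler_wpM2l A0 h) _.
have -> : W * w x * (Cd ^+ k * mb x (sb x)) = W * Cd ^+ k * (w x * mb x (sb x)) by ring.
have -> : C1 * V x = W * Cd ^+ k * (W * V x) by rewrite /C1; ring.
rewrite ler_wpM2l ?nu_lo// mulr_ge0 ?(ltW W0)// exprn_ge0//; have := Cd1; lra.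
Qed.

Let V_gt0 x : Omega x -> 0 < V x.
Proof.
move=> Ox; have W0 : 0 < W by apply: lt_le_trans W1.
rewrite -(pmulr_rgt0 _ W0); apply: lt_le_trans (nu_lo Ox).
rewrite mulr_gt0//; apply: (mb_gt0 md mX R00 dbl) => //; [exact: sb_gt0|exact: sb_le2].
Qed.

Variables (u m : X -> R) (G : X -> \bar R) (h kk : R).
Hypothesis mu_u : measurable_fun [set: X] u.
Hypothesis mG : measurable_fun [set: X] G.
Hypothesis G0 : forall x, (0 <= G x)%E.
Hypothesis h0 : 0 <= h.
Hypothesis kk0 : 0 <= kk.
Variable J : R.
Hypothesis GJ : (\int[mu]_(x in Omega) (G x * (w x)%:E) = J%:E)%E.

Definition locE x := fine (\int[mu]_(y in ball x (Lam * s x)) (G y * (w y)%:E))%E.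
(** The local bound is affine in the average energy, the p-th root being already linearized;
    multiplied by the mass of a Whitney ball it sums to a multiple of h nu(Omega) + kk J. *)
Definition osc x := h + kk * (locE x / fine (nu (ball x (Lam * s x)))).

Hypothesis loc : forall x, Omega x ->
  (\int[mu]_(y in ball x (16 * s x)) (`|u y - m x|)%:E <= (mb x (16 * s x) * osc x)%:E)%E.

Let mGw E : measurable_fun E (fun x => (G x * (w x)%:E)%E).
Proof.
apply: (@measurable_funS _ _ _ _ setT) => //; apply: emeasurable_funM => //.
exact/measurable_EFinP.
Qed.

Let Gw0 x : (0 <= G x * (w x)%:E)%E. Proof. by rewrite mule_ge0// lee_fin. Qed.

Let big_sub x : Omega x -> ball x (Lam * s x) `<=` Omega.
Proof. by move=> Ox y; rewrite /dball /= => /ltW xy; case: (s_near Ox xy). Qed.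

Let locEE x : Omega x -> (\int[mu]_(y in ball x (Lam * s x)) (G y * (w y)%:E) = (locE x)%:E)%E.
Proof.
move=> Ox; rewrite /locE fineK// ge0_fin_numE; last exact: integral_ge0.
apply: (@le_lt_trans _ _ (\int[mu]_(y in Omega) (G y * (w y)%:E))%E); last by rewrite GJ ltry.
by apply: ge0_subset_integral => //; exact: big_sub.
Qed.

Let locE_ge0 x : 0 <= locE x.
Proof. by apply: fine_ge0; exact: integral_ge0. Qed.

Let osc_ge0 x : 0 <= osc x.
Proof. by rewrite /osc addr_ge0// mulr_ge0// divr_ge0// ?locE_ge0// fine_ge0. Qed.

Let mabs c E : measurable_fun E (fun x => (`|u x - c|)%:E).
Proof.
apply/measurable_EFinP; apply: measurableT_comp => //.
by apply: measurable_funB => //; exact: measurable_funTS.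
Qed.

(** The relation between covering balls that contain consecutive vertices of a chain. *)
Definition adj a b := exists z z', [/\ d a z < 2 * s a, d b z' < 2 * s b & d z z' <= s z].

Let adj_dist a b : Omega a -> Omega b -> adj a b ->
  [/\ d a b <= 12 * s a, s b <= 2 * s a & s a <= 2 * s b].
Proof.
move=> Oa Ob [z [z' [az bz zz]]]; have L16 := Lam16.
have sa := s_gt0 Oa; have sb_ := s_gt0 Ob.
have h1 : 16 * s a <= Lam * s a by rewrite ler_pM2r.
have h2 : 16 * s b <= Lam * s b by rewrite ler_pM2r.
have h3 : d a z <= Lam * s a by lra.
have [_ sz _] := s_near Oa h3.
have h4 : d a z' <= Lam * s a by have := mdist_tri md a z z'; lra.
have [_ sz' _] := s_near Oa h4.
have h5 : d b z' <= Lam * s b by lra.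
have [_ _ sbz] := s_near Ob h5.
have dab : d a b <= 12 * s a.
  by have := mdist_tri md a z z'; have := mdist_tri md a z' b; rewrite (mdistC md z' b); lra.
have h6 : d a b <= Lam * s a by lra.
by have [_ ? ?] := s_near Oa h6.
Qed.

Let C2 := Cd ^+ k.

Let C2_ge0 : 0 <= C2. Proof. by rewrite exprn_ge0//; have := Cd1; lra. Qed.

(** Both constants are compared with [u] on the small ball around [b], which lies in both balls of
    radius 16 s and has comparable measure. *)
Let adj_mean a b : Omega a -> Omega b -> adj a b -> `|m a - m b| <= C2 * (osc a + osc b).
Proof.
move=> Oa Ob ab; have [dab sba sab] := adj_dist Oa Ob ab; have L16 := Lam16; have kL := kLam.
have sa := s_gt0 Oa; have sb_ := s_gt0 Ob.
pose B := ball b (sb b).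
have mB : measurable B by exact: mball.
have p := mb_gt0 md mX R00 dbl b (sb_gt0 Ob) (sb_le2 Ob).
have Ba : B `<=` ball a (16 * s a) by apply: ball_sub => //; lra.
have Bb : B `<=` ball b (16 * s b) by apply: ball_sub => //; rewrite (mdist0 md); lra.
have pa : mb a (16 * s a) <= C2 * mb b (sb b).
  apply: (@le_trans _ _ (mb b (56 * s b))); last by apply: mb_sb => //; lra.
  apply: (mb_le md mX R00 dbl); last by apply: rad_le => //; lra.
  by rewrite (mdistC md b a); lra.
have pb : mb b (16 * s b) <= C2 * mb b (sb b) by apply: mb_sb => //; lra.
have int : ((`|m a - m b| * mb b (sb b))%:E <=
    (mb a (16 * s a) * osc a)%:E + (mb b (16 * s b) * osc b)%:E)%E.
  rewrite EFinM -(mbE md mX R00 dbl) ?sb_le2// -integral_cst//.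
  apply: (@le_trans _ _ (\int[mu]_(y in B) ((`|u y - m a|)%:E + (`|u y - m b|)%:E))%E).
    apply: ge0_le_integral => //.
    - by move=> y _; rewrite lee_fin.
    - by apply: emeasurable_funD.
    - move=> y _; rewrite -EFinD lee_fin; have := ler_distD (u y) (m a) (m b).
      by rewrite (distrC (m a) (u y)).
  rewrite ge0_integralD//; apply: leeD.
    by apply: le_trans (loc Oa); apply: ge0_subset_integral.
  by apply: le_trans (loc Ob); apply: ge0_subset_integral.
move: int; rewrite -EFinD lee_fin => int.
rewrite -(ler_pM2r p); apply: le_trans int _.
have := ler_wpM2r (osc_ge0 a) pa; have := ler_wpM2r (osc_ge0 b) pb; lra.
Qed.

Let path_mean a p : Omega a -> (forall b, b \in p -> Omega b) ->
  path (fun a b => `[< adj a b >]) a p ->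
  `|m a - m (last a p)| <= 2 * C2 * \sum_(b <- a :: p) osc b - C2 * osc a.
Proof.
elim: p a => [|b p IH] a Oa Op /=.
  rewrite subrr normr0 big_seq1 => _; have : 0 <= C2 * osc a by rewrite mulr_ge0.
  by lra.
case/andP=> /asboolP ab pp.
have Ob : Omega b by apply: Op; rewrite mem_head.
have := IH b Ob (fun c cp => Op c (mem_behead (s := b :: p) cp)) pp.
have := adj_mean Oa Ob ab; have := ler_distD (m b) (m a) (m (last b p)).
rewrite [\sum_(_ <- a :: _) _]big_cons; lra.
Qed.

Section Cover.
Variable A : set X.
Hypothesis AO : A `<=` Omega.
Hypothesis Asep : forall a b, A a -> A b -> a <> b -> s a <= d a b /\ s b <= d a b.
Hypothesis Acov : forall x, Omega x -> exists a, A a /\ d a x < 2 * s a.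

Let Adis a b : A a -> A b -> a <> b -> ball a (sb a) `&` ball b (sb b) = set0.
Proof.
move=> Aa Ab ab; apply/seteqP; split => // z []; rewrite /dball /= => h1 h2.
have [h3 h4] := Asep Aa Ab ab; have := mdist_tri md a z b; rewrite (mdistC md z b).
by have := s_gt0 (AO Aa); have := s_gt0 (AO Ab); lra.
Qed.

Let sumV (l : seq X) E : uniq l -> (forall a, a \in l -> A a) -> measurable E ->
  (forall a, a \in l -> ball a (sb a) `<=` E) -> \sum_(a <- l) V a <= fine (nu E).
Proof.
move=> ul lA mE lE; rewrite -lee_fin -nuE// -sumEFin.
under eq_bigr do rewrite -VE.
by apply: sum_disjoint_le => // a b /lA ? /lA ?; exact: Adis.
Qed.

Let sb_sub a : Omega a -> ball a (sb a) `<=` Omega.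
Proof.
move=> Oa; apply: subset_trans (big_sub Oa); apply: ball_mono => //.
by have := Lam16; have := s_gt0 Oa; nra.
Qed.

Lemma whitney_countable : countable A.
Proof.
apply: (countable_disjoint (m := nu) mOmega (fun a => mball a (sb a)) _ Adis) => //.
- by move=> a Aa; exact: sb_sub (AO Aa).
- by move=> a Aa; rewrite VE lte_fin V_gt0//; exact: AO.
- exact: nu_fin.
Qed.

(* Bounded overlap: the centers whose enlarged ball contains a given point have disjoint
   balls of comparable measure inside a common ball. *)
Let overlap (l : seq X) z : uniq l -> (forall a, a \in l -> A a) ->
  (forall a, a \in l -> d a z < Lam * s a) -> (size l)%:R <= C2.
Proof.
case: l => [|a0 l'] //; set l := a0 :: l' => ul lA lz.
have L16 := Lam16; have kL := kLam.
have a0l : a0 \in l by rewrite mem_head.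
pose rz := 2 * (Lam + 1) * s z.
have Oz a : a \in l -> [/\ Omega z, s z <= 2 * s a & s a <= 2 * s z].
  by move=> al; apply: s_near; [exact: AO (lA _ al)|exact: ltW (lz _ al)].
have near a : a \in l -> mb z rz <= C2 * mb a (sb a).
  move=> al; have Oa := AO (lA _ al); have [_ h1 h2] := Oz _ al; have sa := s_gt0 Oa.
  apply: le_trans (mb_sb Oa (c := 5 * Lam + 4) _); last by lra.
  apply: (mb_le md mX R00 dbl); last by apply: rad_le => //; lra.
  have := lz _ al; rewrite /rz.
  have : 2 * (Lam + 1) * s z <= 2 * (Lam + 1) * (2 * s a) by rewrite ler_pM2l//; lra.
  lra.
have [Oz0 _ _] := Oz _ a0l; have sz := s_gt0 Oz0.
have rz2 : rz <= 2 * R0 by rewrite /rz; apply: rad_le => //; lra.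
have rz0 : 0 < rz by rewrite /rz !mulr_gt0//; lra.
have P : 0 < mb z rz by apply: (mb_gt0 md mX R00 dbl).
have S : \sum_(a <- l) mb a (sb a) <= mb z rz.
  rewrite -lee_fin -(mbE md mX R00 dbl)// -sumEFin.
  rewrite big_seq (eq_bigr (fun a => mu (ball a (sb a)))) -?big_seq; last first.
    by move=> a al; rewrite (mbE md mX R00 dbl)// sb_le2//; exact: AO (lA _ al).
  apply: sum_disjoint_le => //.
    move=> a al; apply: ball_sub => //; have := lz _ al; rewrite (mdistC md z a) /rz.
    have [_ h1 h2] := Oz _ al; have : (Lam + 1) * s a <= (Lam + 1) * (2 * s z) by rewrite ler_pM2l//; lra.
    by have := s_gt0 (AO (lA _ al)); lra.
  by move=> a b /lA ? /lA ?; exact: Adis.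
rewrite -(ler_pM2r P); apply: (@le_trans _ _ (\sum_(a <- l) C2 * mb a (sb a))).
  rewrite mulr_natl -[size l](count_predT) -iter_addr_0 -big_const_seq.
  by rewrite big_seq [leRHS]big_seq; apply: ler_sum => a al; exact: near.
by rewrite -mulr_sumr ler_wpM2l.
Qed.

(** Under the integral, the energy density at a point is counted once for each enlarged ball
    containing it, that is, at most [C2] times by [overlap]. *)
Let sum_locE (l : seq X) : uniq l -> (forall a, a \in l -> A a) ->
  \sum_(a <- l) locE a <= C2 * J.
Proof.
move=> ul lA; rewrite -lee_fin -sumEFin EFinM -GJ.
pose F a x := (((fun y => G y * (w y)%:E) \_ (ball a (Lam * s a))) x)%E.
have F0 a x : (0 <= F a x)%E by apply: erestrict_ge0.
have mF a : measurable_fun Omega (F a).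
  apply: (@measurable_funS _ _ _ _ setT) => //.
  by apply/(measurable_restrictT _ (mball _ _)).
have -> : (\sum_(a <- l) (locE a)%:E = \int[mu]_(x in Omega) (\sum_(a <- l) F a x))%E.
  rewrite ge0_integral_sum// big_seq [RHS]big_seq; apply: eq_bigr => a /lA/AO Oa.
  rewrite -locEE// -integral_mkcondr; congr (integral _ _ _).
  by rewrite setIidr//; exact: big_sub.
rewrite -ge0_integralZl_EFin//; apply: ge0_le_integral => //.
- by move=> x _; apply: sume_ge0.
- exact: emeasurable_sum.
- by apply: emeasurable_funM => //; exact: mGw.
move=> x Ox; pose lx := [seq a <- l | `[< d a x < Lam * s a >]].
have E : (\sum_(a <- l) F a x = \sum_(a <- lx) (G x * (w x)%:E))%E.
  rewrite big_filter [RHS]big_mkcond; apply: eq_bigr => a _; rewrite /F patchE.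
  case: asboolP => hx; first by rewrite mem_set.
  by rewrite memNset.
rewrite E big_const_seq count_predT.
have -> n (y : \bar R) : iter n (+%E y) 0%E = (n%:R%:E * y)%E.
  by elim: n => [|n IHn]; rewrite ?mul0e//= IHn -natr1 EFinD ge0_muleDl ?lee_fin// mul1e addeC.
apply: lee_wpmul2r => //; rewrite lee_fin; apply: (@overlap lx x).
- exact: filter_uniq.
- by move=> a; rewrite mem_filter => /andP[_ /lA].
- by move=> a; rewrite mem_filter => /andP[/asboolP].
Qed.

Variables (xs : X) (P : X -> X -> Prop) (Sh : X -> set X) (CS : R).
Hypothesis Oxs : Omega xs.
Hypothesis mSh : forall a, measurable (Sh a).
Hypothesis CS0 : 0 <= CS.
Hypothesis nuSh : forall a, Omega a -> (nu (Sh a) <= CS%:E * nu (ball a (sb a)))%E.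
Hypothesis POmega : forall y z, P y z -> Omega z.
Hypothesis PSh : forall y z a, Omega y -> P y z -> Omega a -> d a z < 2 * s a ->
  ball y (sb y) `<=` Sh a.
Hypothesis link : forall y, Omega y -> linked d (P y) s y xs.

(** Turns a chain of points into a path of covering balls; each ball remembers a vertex [z] of the
    chain, which later locates its shadow. *)
Let chain_path (Q : X -> Prop) y x a : linked d Q s y x -> (forall z, Q z -> Omega z) ->
  A a -> d a y < 2 * s a ->
  exists p, [/\ path (fun a b => `[< adj a b >]) a p, d (last a p) x < 2 * s (last a p) &
    forall b, b \in a :: p -> A b /\ exists z, Q z /\ d b z < 2 * s b].
Proof.
move=> L QO; elim: L a => [z Qz|{}y z x' Qy dyz _ IH] a Aa day.
  exists [::]; split => // b; rewrite inE => /eqP ->; split => //; by exists z.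
have [b [Ab dbz]] : exists b, A b /\ d b z < 2 * s b.
  apply: Acov; have Oy := QO _ Qy; have sy := s_gt0 Oy.
  have dL : d y z <= Lam * s y.
    by apply: le_trans dyz _; rewrite ler_peMl ?(ltW sy)//; have := Lam16; lra.
  by have [] := s_near Oy dL.
have [p [pp pl pA]] := IH b Ab dbz.
exists (b :: p); split => //=.
  by rewrite pp andbT; apply/asboolP; exists y, z.
move=> c; rewrite inE => /predU1P[->|]; last exact: pA.
by split => //; exists y.
Qed.

Let astar_ex : exists a, A a /\ d a xs < 2 * s a. Proof. exact: Acov. Qed.

Let mean_chain astar i : A astar -> d astar xs < 2 * s astar -> A i ->
  exists l, [/\ uniq l, i \in l,
    forall b, b \in l -> A b /\ ball i (sb i) `<=` Sh b &
    `|m i - m astar| <= 2 * C2 * \sum_(b <- l) osc b].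
Proof.
move=> As ds Ai; have Oi := AO Ai.
have sxs := s_gt0 Oxs.
have dii : d i i < 2 * s i by rewrite (mdist0 md) mulr_gt0// s_gt0.
have [p [pp pl pA]] := chain_path (link Oi) (@POmega i) Ai dii.
have Pxs : P i xs := linked_last (link Oi).
have adjl : adj (last i p) astar.
  by exists xs, xs; split => //; rewrite (mdist0 md) ltW.
have pp' : path (fun a b => `[< adj a b >]) i (rcons p astar).
  by rewrite rcons_path pp /=; apply/asboolP.
have pA' b : b \in i :: rcons p astar -> A b /\ exists z, P i z /\ d b z < 2 * s b.
  rewrite -rcons_cons mem_rcons inE => /predU1P[->|]; last exact: pA.
  by split => //; exists xs.
have El : last i (rcons p astar) = astar by rewrite last_rcons.
(* Loops are removed so that a ball is charged at most once per chain; a sum along the path is then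
   a sum over a set of balls. *)
move: El; case: (shortenP pp') => q qp uq qsub El.
have qA b : b \in i :: q -> A b /\ exists z, P i z /\ d b z < 2 * s b.
  rewrite inE => /predU1P[->|/qsub bq]; first by apply: pA'; rewrite mem_head.
  by apply: pA'; rewrite inE bq orbT.
exists (i :: q); split => //; first by rewrite mem_head.
  move=> b /qA[Ab [z [Pz dz]]]; split => //; exact: PSh Pz (AO Ab) dz.
have qO b : b \in q -> Omega b.
  by move=> bq; apply: AO; apply: (qA b _).1; rewrite inE bq orbT.
have := path_mean Oi qO qp; rewrite El => hm; apply: le_trans hm _.
by rewrite gerBl mulr_ge0.
Qed.

Let local_bound c i : Omega i ->
  (\int[mu]_(y in ball i (2 * s i)) (`|u y - c| * w y)%:E <=
   (C1 * V i * (osc i + `|m i - c|))%:E)%E.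
Proof.
move=> Oi; have L16 := Lam16; have kL := kLam; have si := s_gt0 Oi.
have W0 : 0 < W by apply: lt_le_trans W1.
have A0 : 0 <= W * w i by rewrite mulr_ge0// ltW.
have mwE E : measurable_fun E (EFin \o w) by apply/measurable_EFinP; exact: measurable_funTS.
have wi y : ball i (2 * s i) y -> w y <= W * w i.
  rewrite /dball /= => iy; apply: (w_near Oi _).1; apply: le_trans (ltW iy) _.
  by rewrite ler_pM2r//; lra.
apply: (@le_trans _ _ (\int[mu]_(y in ball i (2 * s i))
   ((W * w i)%:E * (`|u y - m i|)%:E + `|m i - c|%:E * (w y)%:E))%E).
  apply: ge0_le_integral => //.
  - by move=> y _; rewrite lee_fin mulr_ge0.
  - apply/measurable_EFinP; apply: measurable_funM; last exact: measurable_funTS.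
    by apply/measurable_EFinP; exact: mabs.
  - by apply: emeasurable_funD; apply: emeasurable_funM.
  - move=> y /wi wy; rewrite -!EFinM -EFinD lee_fin.
    have := ler_wpM2r (w0 y) (ler_distD (m i) (u y) c).
    have := ler_wpM2l (normr_ge0 (u y - m i)) wy; lra.
rewrite ge0_integralD//; first last.
- by apply: emeasurable_funM.
- by move=> y _; rewrite -EFinM lee_fin mulr_ge0.
- by apply: emeasurable_funM.
- by move=> y _; rewrite -EFinM lee_fin mulr_ge0.
rewrite mulrDr EFinD; apply: leeD.
  rewrite ge0_integralZl_EFin//.
  apply: (@le_trans _ _ ((W * w i)%:E * (mb i (16 * s i) * osc i)%:E)%E).
    apply: lee_wpmul2l; first by rewrite lee_fin.
    apply: le_trans (loc Oi); apply: ge0_subset_integral => //.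
    by apply: ball_mono => //; rewrite ler_pM2r//; lra.
  rewrite -EFinM lee_fin mulrA ler_wpM2r//.
  have hm : mb i (16 * s i) <= Cd ^+ k * mb i (sb i) by apply: mb_sb => //; lra.
  apply: le_trans (ler_wpM2l A0 hm) _.
  have -> : W * w i * (Cd ^+ k * mb i (sb i)) = W * Cd ^+ k * (w i * mb i (sb i)) by ring.
  have -> : C1 * V i = W * Cd ^+ k * (W * V i) by rewrite /C1; ring.
  by rewrite ler_wpM2l ?nu_lo// mulr_ge0 ?(ltW W0).
rewrite ge0_integralZl_EFin//; last by move=> y _; rewrite lee_fin.
rewrite [C1 * V i * _]mulrC EFinM; apply: lee_wpmul2l => //.
by apply: nu_sb => //; lra.
Qed.

Definition whitney_const := C1 * (1 + 2 * C2) * CS * C2.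

Let C2_ge1 : 1 <= C2. Proof. by rewrite /C2 exprn_ege1. Qed.

Let sum_osc (l : seq X) : uniq l -> (forall a, a \in l -> A a) ->
  \sum_(a <- l) V a * osc a <= C2 * (h * fine (nu Omega) + kk * J).
Proof.
move=> ul lA; have hV := sumV ul lA mOmega (fun a al => sb_sub (AO (lA a al))).
have hL := sum_locE ul lA.
apply: (@le_trans _ _ (\sum_(a <- l) (h * V a + kk * locE a))).
  rewrite big_seq [leRHS]big_seq; apply: ler_sum => a /lA/AO Oa.
  rewrite /osc mulrDr [V a * h]mulrC lerD2l mulrCA; apply: ler_wpM2l => //.
  have Va := V_gt0 Oa.
  have VL : V a <= fine (nu (ball a (Lam * s a))).
    rewrite -lee_fin -VE -nuE//; apply: le_measure; [exact/mem_set|exact/mem_set|].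
    by apply: ball_mono => //; have := Lam16; have := s_gt0 Oa; nra.
  rewrite mulrCA ler_piMr// ler_pdivrMr ?mul1r//; exact: lt_le_trans VL.
rewrite big_split /= -!mulr_sumr.
have nO : 0 <= h * fine (nu Omega) by rewrite mulr_ge0// fine_ge0.
have h1 : h * \sum_(a <- l) V a <= h * fine (nu Omega) by rewrite ler_wpM2l.
have h2 : kk * \sum_(a <- l) locE a <= kk * (C2 * J) by rewrite ler_wpM2l.
have : 0 <= (C2 - 1) * (h * fine (nu Omega)) by rewrite mulr_ge0// subr_ge0.
lra.
Qed.

(** The sum of V i * osc b over pairs with [b] on the chain of [i] is regrouped by [b]. The small
    balls of such [i] are disjoint and lie in [Sh b], so they contribute at most CS * V b, and
    [sum_osc] finishes. *)
Lemma whitney_cover_bound : exists c,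
  (\int[mu]_(y in Omega) (`|u y - c| * w y)%:E <=
    (whitney_const * (h * fine (nu Omega) + kk * J))%:E)%E.
Proof.
have [astar [As ds]] := astar_ex; exists (m astar).
have mF : measurable_fun [set: X] (fun y => `|u y - m astar| * w y).
  apply: measurable_funM => //; apply: measurableT_comp => //; exact: measurable_funB.
have F0 y : 0 <= `|u y - m astar| * w y by rewrite mulr_ge0.
(* The left side is read as a measure of Omega, so the covering bound reduces it to finitely many
   Whitney balls. *)
rewrite -[leLHS]/(density mu mF F0 Omega).
apply: (measure_cover_le (m := density mu mF F0) (G := fun a => ball a (2 * s a)) whitney_countable) => //.
move=> l ul lA.
have C10 : 0 <= C1 by apply: le_trans C1_ge1.
have ch i : A i -> exists l', [/\ uniq l', i \in l',
    forall b, b \in l' -> A b /\ ball i (sb i) `<=` Sh b &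
    `|m i - m astar| <= 2 * C2 * \sum_(b <- l') osc b] by exact: mean_chain.
pose L i := if pselect (A i) is left Ai then projT1 (cid (ch i Ai)) else [::].
have LP i : A i -> [/\ uniq (L i), i \in L i,
    forall b, b \in L i -> A b /\ ball i (sb i) `<=` Sh b &
    `|m i - m astar| <= 2 * C2 * \sum_(b <- L i) osc b].
  by move=> Ai; rewrite /L; case: pselect => // Ai'; exact: projT2 (cid (ch i Ai')).
pose F := undup (flatten [seq L i | i <- l]).
have FA b : b \in F -> A b.
  by rewrite mem_undup => /flattenP[_ /mapP[i il ->]] bL; have [_ _ /(_ _ bL)[]] := LP i (lA _ il).
have LF i : i \in l -> forall b, b \in L i -> b \in F.
  by move=> il b bL; rewrite mem_undup; apply/flattenP; exists (L i) => //; apply/mapP; exists i.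
apply: (@le_trans _ _ (\sum_(i <- l) (C1 * (1 + 2 * C2) * (V i * \sum_(b <- L i) osc b))%:E)%E).
  rewrite big_seq [leRHS]big_seq; apply: lee_sum => i il; have Ai := lA _ il.
  apply: le_trans (local_bound (m astar) (AO Ai)) _; rewrite lee_fin.
  have [uL iL _ hm] := LP i Ai.
  have hi : osc i <= \sum_(b <- L i) osc b.
    by rewrite (bigD1_seq i)//= lerDl sumr_ge0.
  have -> : C1 * (1 + 2 * C2) * (V i * \sum_(b <- L i) osc b) =
     C1 * V i * ((1 + 2 * C2) * \sum_(b <- L i) osc b) by ring.
  apply: ler_wpM2l; first exact: mulr_ge0.
  by rewrite mulrDl mul1r; apply: lerD.
rewrite sumEFin lee_fin -mulr_sumr /whitney_const.
have -> : C1 * (1 + 2 * C2) * CS * C2 * (h * fine (nu Omega) + kk * J) =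
  C1 * (1 + 2 * C2) * (CS * (C2 * (h * fine (nu Omega) + kk * J))) by ring.
apply: ler_wpM2l; first by rewrite mulr_ge0// addr_ge0// mulr_ge0.
have uF : uniq F by exact: undup_uniq.
apply: le_trans (ler_wpM2l CS0 (sum_osc uF FA)).
have E1 : \sum_(i <- l) V i * \sum_(b <- L i) osc b =
    \sum_(i <- l) \sum_(b <- F | b \in L i) V i * osc b.
  rewrite big_seq [RHS]big_seq; apply: eq_bigr => i il; rewrite mulr_sumr.
  have [uL _ _ _] := LP i (lA _ il).
  rewrite -[RHS]big_filter; apply: perm_big; apply: uniq_perm => //; first exact: filter_uniq.
  move=> b; rewrite mem_filter; case bL: (b \in L i) => //=.
  by rewrite (LF i il).
rewrite E1 (exchange_big_dep xpredT)//= mulr_sumr.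
rewrite big_seq [leRHS]big_seq; apply: ler_sum => b bF.
rewrite -mulr_suml mulrA; apply: ler_wpM2r => //.
have Ab := FA b bF; have Ob := AO Ab.
rewrite -big_filter; apply: (@le_trans _ _ (fine (nu (Sh b)))).
  apply: sumV => //; first exact: filter_uniq.
  - by move=> a; rewrite mem_filter => /andP[_ /lA].
  - move=> a; rewrite mem_filter => /andP[ba al].
    by have [_ _ /(_ _ ba)[]] := LP a (lA _ al).
by rewrite -lee_fin EFinM -VE -nuE//; exact: nuSh.
Qed.

End Cover.

Variables (xs : X) (P : X -> X -> Prop) (Sh : X -> set X) (CS : R).
Hypothesis Oxs : Omega xs.
Hypothesis mSh : forall a, measurable (Sh a).
Hypothesis CS0 : 0 <= CS.
Hypothesis nuSh : forall a, Omega a -> (nu (Sh a) <= CS%:E * nu (ball a (sb a)))%E.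
Hypothesis POmega : forall y z, P y z -> Omega z.
Hypothesis PSh : forall y z a, Omega y -> P y z -> Omega a -> d a z < 2 * s a ->
  ball y (sb y) `<=` Sh a.
Hypothesis link : forall y, Omega y -> linked d (P y) s y xs.

Lemma whitney_bound : exists c,
  (\int[mu]_(y in Omega) (`|u y - c| * w y)%:E <=
    (whitney_const CS * (h * fine (nu Omega) + kk * J))%:E)%E.
Proof.
have sepC a b : s a <= d a b /\ s b <= d a b -> s b <= d b a /\ s a <= d b a.
  by rewrite (mdistC md b a) => -[].
have [A [AO As Amax]] := @exists_maximal_separated X Omega
  (fun a b => s a <= d a b /\ s b <= d a b) sepC.
apply: (@whitney_cover_bound A AO As _ xs P Sh CS) => // x Ox.
have [a [Aa ax]] := Amax x Ox; exists a; split => //.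
have sa := s_gt0 (AO _ Aa); have sx := s_gt0 Ox; have L16 := Lam16.
case: ax => [->|]; first by rewrite (mdist0 md) mulr_gt0.
(* Separation fails when the distance is below [s a] or below [s x]; in the second case
   [s x <= 2 * s a], hence the covering radius 2 s. *)
move=> /not_andP[|] /negP; rewrite -ltNge => h1; first lra.
have dL : d x a <= Lam * s x by rewrite (mdistC md); nra.
by have [_ _ ?] := s_near Ox dL; lra.
Qed.

End Whitney.

(** * The Poincare inequality on balls *)

Section Unweighted.
Context {R : realType} {dd : measure_display} {X : measurableType dd}.
Variable mu : {measure set X -> \bar R}.

Lemma wvol1 A : measurable A -> wvol mu (fun=> 1) id A = mu A.
Proof.
move=> mA; rewrite /wvol preimage_id -[LHS]/(\int[mu]_(x in A) cst 1%:E x)%E.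
by rewrite integral_cst// mul1e.
Qed.

Lemma wint1 A f : wint mu (fun=> 1) id A f = (\int[mu]_(x in A) f x)%E.
Proof. by rewrite /wint preimage_id; apply: eq_integral => x _; rewrite mule1. Qed.

End Unweighted.

Section LocalPoincare.
Context {R : realType} {dd : measure_display} {X : measurableType dd}.
Variables (d : X -> X -> R) (mu : {measure set X -> \bar R}) (z0 : X) (eps beta Cd R0 : R).
Hypothesis md : is_metric d.
Hypothesis geo : geodesic_space d.
Hypothesis mX : @measurable _ X = dborel d.
Hypothesis R00 : 0 < R0.
Hypothesis eps0 : 0 < eps.
Hypothesis dbl : forall x r, 0 < r -> r <= R0 ->
  [/\ (0 < mu (dball d x (2 * r)))%E, (mu (dball d x (2 * r)) <= Cd%:E * mu (dball d x r))%E &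
      (mu (dball d x (2 * r)) < +oo)%E].
Hypothesis beta_gt : 4 * ln Cd / R0 < beta.
Notation rho := (rho_eps d z0 eps).
Notation de := (d_eps d z0 eps).
Notation w := (weight d z0 beta).
Notation nu := (nu z0 md mX R00 dbl beta_gt).
Context {Y : Type} (dY : Y -> Y -> R) (iota : X -> Y).
Hypothesis mdY : is_metric dY.
Hypothesis iso : forall x y, dY (iota x) (iota y) = de x y.
Variables (p lam0 CPI : R).
Hypothesis p1 : 1 <= p.
Hypothesis lam1 : 1 <= lam0.
Hypothesis PI : poincare d (wvol mu (fun=> 1) id) (wint mu (fun=> 1) id) p lam0 CPI
  (fun r => r <= R0).
Variables (u : Y -> R) (gr : Y -> \bar R).
Hypothesis mu_ : dmeasR dY u.
Hypothesis bu : exists M, forall y, `|u y| <= M.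
Hypothesis mg : dmeasE dY gr.
Hypothesis g0 : forall y, (0 <= gr y)%E.
Hypothesis ug : upper_gradient dY u gr.

Lemma iota_measurable A : dopen dY A -> measurable (iota @^-1` A).
Proof. by move=> oA; apply: (dopen_measurable mX); exact: (iota_dopen md geo eps0 iso oA). Qed.

Lemma u_iota_measurable : measurable_fun [set: X] (u \o iota).
Proof. exact: (dmeasR_comp iota_measurable mu_). Qed.

Lemma gr_iota_measurable : measurable_fun [set: X] (gr \o iota).
Proof. exact: (dmeasE_comp iota_measurable mg). Qed.

Lemma rho_measurable : measurable_fun [set: X] rho.
Proof. exact: (lip_measurable mX eps0 (rho_lip z0 md eps0)). Qed.

Definition grp x := poweR (gr (iota x)) p.

Lemma grp_measurable : measurable_fun [set: X] grp.
Proof. exact: (measurableT_comp (measurable_poweR p) gr_iota_measurable). Qed.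

Lemma grp_ge0 x : (0 <= grp x)%E. Proof. exact: poweR_ge0. Qed.

Let p0 : 0 < p. Proof. exact: lt_le_trans p1. Qed.

Lemma poweR_le (a b : \bar R) q : 0 <= q -> (0 <= a)%E -> (a <= b)%E -> (poweR a q <= poweR b q)%E.
Proof.
move=> q0 a0 ab; apply: gt0_ler_poweR => //; rewrite in_itv/= leey andbT//.
exact: le_trans ab.
Qed.

Lemma ddiam_ball x r : 0 < r -> (0 <= ddiam d (dball d x r))%E /\
  (ddiam d (dball d x r) <= (2 * r)%:E)%E.
Proof.
move=> r0; split.
  apply: ereal_sup_ubound; exists x; rewrite /dball /= ?(mdist0 md)//.
  by exists x; rewrite /= ?(mdist0 md).
apply: ge_ereal_sup => _ [y xy [z xz <-]]; rewrite lee_fin.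
have := mdist_tri md y x z; move: xy xz; rewrite /dball /= (mdistC md x y); lra.
Qed.

(** 128 = 32 * 4: the diameter is at most 2 * 16 s, and rho on the dilated ball is at most 4 times
    its value at the center. The maximum with 1 makes the constant positive whatever the sign of
    [CPI]. *)
Definition local_const := 128 * Num.max CPI 1.

Lemma local_const_gt0 : 0 < local_const.
Proof. by rewrite /local_const mulr_gt0// lt_max ltr01 orbT. Qed.

(* The Poincare inequality at unit scale, rewritten in terms of [nu] and of the upper
   gradient with respect to [d_eps]. *)
Lemma local_oscillation x (s W : R) : 0 < s -> lam0 * (16 * s) <= eps^-1 -> lam0 * (16 * s) <= R0 ->
  1 <= W -> (forall y, d x y <= lam0 * (16 * s) -> w x <= W * w y /\ w y <= W * w x) ->
  exists m, (\int[mu]_(y in dball d x (16 * s)) (`|u (iota y) - m|)%:E <=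
    (mb d mu x (16 * s))%:E * ((local_const * s * rho x * W ^+ 2)%:E *
     poweR (((fine (nu (dball d x (lam0 * (16 * s)))))^-1)%:E *
        \int[mu]_(y in dball d x (lam0 * (16 * s))) (grp y * (w y)%:E)) p^-1))%E.
Proof.
move=> s0 Le LR W1 Ww; set L := lam0 * (16 * s).
have R00_ := R00; have s16 : 0 < 16 * s by rewrite mulr_gt0.
have sL : 16 * s <= L by rewrite ler_peMl ?(ltW s16).
have sR : 16 * s <= R0 by apply: le_trans sL LR.
have L0 : 0 < L by lra.
have mB r : measurable (dball d x r) by exact: ball_measurable.
pose gr' y := (gr (iota y) * (rho y)%:E)%E.
have mgr' : measurable_fun [set: X] gr'.
  apply: emeasurable_funM; first exact: gr_iota_measurable.
  by apply/measurable_EFinP; exact: rho_measurable.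
have gr'0 y : (0 <= gr' y)%E by rewrite mule_ge0// lee_fin rho_ge0.
have ug' := upper_gradient_pullback md geo eps0 mdY iso mg g0 ug.
have bu' : exists M, forall y, `|(u \o iota) y| <= M.
  by have [M hM] := bu; exists M => y; exact: hM.
have R02 : R0 <= 2 * R0 by rewrite ler_peMl ?(ltW R00)// ler1n.
have mb0 : 0 < mb d mu x (16 * s) by apply: (mb_gt0 md mX R00 dbl) => //; exact: le_trans sR R02.
have mbL0 : 0 < mb d mu x L by apply: (mb_gt0 md mX R00 dbl) => //; exact: le_trans LR R02.
have := @PI x _ s16 sR _ _ (measurable_dmeasR mX u_iota_measurable) bu' (measurable_dmeasE mX mgr') gr'0 ug'.
move=> /=; rewrite !wint1 !wvol1//; set m := _ / _; rewrite -/L => H.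
exists m; rewrite -lee_pdivrMl//; apply: le_trans H _.
rewrite -/(mb d mu x L).
have [dd0 dd1] := ddiam_ball x s16.
have r0 := rho_gt0 d z0 eps x.
have W0 : 0 < W by lra.
have wx0 := weight_gt0 d z0 beta x.
set Gw := (\int[mu]_(y in dball d x L) (grp y * (w y)%:E))%E.
have Gw0 : (0 <= Gw)%E.
  by apply: integral_ge0 => y _; rewrite mule_ge0 ?grp_ge0// lee_fin weight_ge0.
set v := fine (nu (dball d x L)).
have v0 : 0 < v.
  by rewrite fine_gt0// (nu_ball_gt0 z0 md mX R00 dbl beta_gt)//= (nu_fin z0 md geo mX R00 dbl beta_gt).
have vE : nu (dball d x L) = v%:E.
  by rewrite fineK// ge0_fin_numE// (nu_fin z0 md geo mX R00 dbl beta_gt).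
have int : (\int[mu]_(y in dball d x L) poweR (gr' y) p <=
    (powR (4 * rho x) p * (W / w x))%:E * Gw)%E.
  rewrite -ge0_integralZl_EFin//; last first.
  - by rewrite mulr_ge0 ?powR_ge0// divr_ge0 ?ltW.
  - apply: emeasurable_funM; first exact: (measurable_funTS grp_measurable).
    by apply/measurable_EFinP; apply: measurable_funTS; exact: (weight_measurable z0 md mX R00 dbl beta_gt).
  - by move=> y _; rewrite mule_ge0 ?grp_ge0// lee_fin weight_ge0.
  apply: ge0_le_integral => //.
  - by move=> y _; exact: poweR_ge0.
  - by apply: measurable_funTS; exact: (measurableT_comp (measurable_poweR p) mgr').
  - apply: emeasurable_funM => //; apply: emeasurable_funM.
      exact: (measurable_funTS grp_measurable).
    by apply/measurable_EFinP; apply: measurable_funTS; exact: (weight_measurable z0 md mX R00 dbl beta_gt).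
  move=> y; rewrite /dball /= => xy; rewrite /gr' poweRM ?lee_fin ?rho_ge0//.
  rewrite muleCA; apply: lee_wpmul2l; first exact: poweR_ge0.
  rewrite -EFinM lee_fin -mulrA.
  have h1 : powR (rho y) p <= powR (4 * rho x) p.
    apply: ge0_ler_powR; rewrite ?nnegrE ?mulr_ge0 ?rho_ge0 ?(ltW p0)//.
    apply: le_trans (rho_mul z0 md eps0 x y) _; rewrite ler_wpM2r ?rho_ge0//.
    by apply: expR_eps_le4 => //; exact: le_trans (ltW xy) Le.
  apply: le_trans h1 _; rewrite ler_peMr ?powR_ge0//.
  have [h2 _] := Ww y (ltW xy).
  by rewrite mulrAC ler_pdivlMr// mul1r.
have vmb : v <= W * w x * mb d mu x L.
  rewrite -lee_fin -vE EFinM -(mbE md mX R00 dbl); last exact: le_trans LR R02.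
  apply: dens_le => //; first by rewrite mulr_ge0 ?ltW.
  by move=> y; rewrite /dball /= => /ltW xy; exact: (Ww y xy).2.
set q := ((v^-1)%:E * Gw)%E.
have q0 : (0 <= q)%E by rewrite mule_ge0// lee_fin invr_ge0 ltW.
(* One factor [W] comes from inserting the weight in the integral, the other from replacing the
   mu-mass by the nu-mass. *)
have inner : (((mb d mu x L)^-1)%:E * \int[mu]_(y in dball d x L) poweR (gr' y) p <=
   (powR (4 * rho x) p * W ^+ 2)%:E * q)%E.
  apply: (@le_trans _ _ (((mb d mu x L)^-1)%:E * ((powR (4 * rho x) p * (W / w x))%:E * Gw))%E).
    by apply: lee_wpmul2l => //; rewrite lee_fin invr_ge0 ltW.
  rewrite /q !muleA -!EFinM; apply: lee_wpmul2r => //; rewrite lee_fin.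
  rewrite mulrCA -mulrA; apply: ler_wpM2l; first exact: powR_ge0.
  rewrite ler_pdivlMr// mulrAC.
  rewrite (_ : W ^+ 2 = W / w x * (W * w x)); last by field; rewrite lt0r_neq0.
  rewrite mulrC ler_wpM2l//; first by rewrite divr_ge0 ?ltW.
  by rewrite ler_pdivrMl// mulrC.
have P1 : (poweR (((mb d mu x L)^-1)%:E * \int[mu]_(y in dball d x L) poweR (gr' y) p) p^-1 <=
   (4 * rho x * W ^+ 2)%:E * poweR q p^-1)%E.
  have pi0 : 0 <= p^-1 by rewrite invr_ge0 ltW.
  apply: le_trans (poweR_le pi0 _ inner) _.
    rewrite mule_ge0// ?lee_fin ?invr_ge0 ?(ltW mbL0)//.
    by apply: integral_ge0 => y _; exact: poweR_ge0.
  rewrite poweRM//; last by rewrite lee_fin mulr_ge0 ?powR_ge0// exprn_ge0// ltW.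
  apply: lee_wpmul2r; first exact: poweR_ge0.
  rewrite poweR_EFin lee_fin powRM ?powR_ge0//; last by rewrite exprn_ge0// ltW.
  rewrite -powRrM mulfV ?lt0r_neq0// powRr1 ?mulr_ge0 ?rho_ge0//.
  (* The root of W ^ 2 is bounded by W ^ 2 itself, as W >= 1 and 1 / p <= 1. *)
  rewrite ler_wpM2l ?mulr_ge0 ?rho_ge0//; apply: ler1_powR.
    by rewrite exprn_ege1.
  by rewrite invf_le1.
have C0 : 0 <= Num.max CPI 1 by rewrite le_max ler01 orbT.
have P0 : (0 <= poweR q p^-1)%E by exact: poweR_ge0.
apply: (@le_trans _ _ ((Num.max CPI 1)%:E * ((2 * (16 * s))%:E * ((4 * rho x * W ^+ 2)%:E * poweR q p^-1)))%E).
  rewrite -muleA; apply: (@le_trans _ _ ((Num.max CPI 1)%:E * (ddiam d (dball d x (16 * s)) *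
     poweR (((mb d mu x L)^-1)%:E * \int[mu]_(y in dball d x L) poweR (gr' y) p) p^-1))%E).
    apply: lee_wpmul2r; first by rewrite mule_ge0// poweR_ge0.
    by rewrite lee_fin le_max lexx.
  by apply: lee_wpmul2l; rewrite ?lee_fin//; apply: lee_pmul => //; exact: poweR_ge0.
rewrite !muleA -!EFinM; apply: lee_wpmul2r => //; rewrite lee_fin /local_const.
rewrite le_eqVlt; apply/orP; left; apply/eqP; ring.
Qed.

End LocalPoincare.

(** * Traces on X of the balls of an isometric extension with dense image *)

Section Extension.
Context {R : realType} {dd : measure_display} {X : measurableType dd}.
Variables (d : X -> X -> R) (mu : {measure set X -> \bar R}) (z0 : X) (eps beta Cd R0 : R).
Hypothesis md : is_metric d.
Hypothesis geo : geodesic_space d.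
Hypothesis mX : @measurable _ X = dborel d.
Hypothesis R00 : 0 < R0.
Hypothesis eps0 : 0 < eps.
Hypothesis dbl : forall x r, 0 < r -> r <= R0 ->
  [/\ (0 < mu (dball d x (2 * r)))%E, (mu (dball d x (2 * r)) <= Cd%:E * mu (dball d x r))%E &
      (mu (dball d x (2 * r)) < +oo)%E].
Hypothesis beta_gt : 4 * ln Cd / R0 < beta.
Notation rho := (rho_eps d z0 eps).
Notation de := (d_eps d z0 eps).
Hypothesis close : forall C, exists K, 2 <= K /\ forall x y,
  de x y <= C * rho x -> de x y <= C * rho y -> expR (eps * d x y) <= K.
Notation w := (weight d z0 beta).
Notation nu := (nu z0 md mX R00 dbl beta_gt).
Context {Y : Type} (dY : Y -> Y -> R) (iota : X -> Y).
Hypothesis mdY : is_metric dY.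
Hypothesis iso : forall x y, dY (iota x) (iota y) = de x y.
Hypothesis dense : forall y e, 0 < e -> exists x, dY (iota x) y < e.

Let mde : is_metric de := de_metric z0 md eps0 geo.

Lemma trace_measurable xi r : measurable (iota @^-1` dball dY xi r).
Proof. by apply: (iota_measurable md geo mX eps0 iso); exact: dball_dopen. Qed.

Lemma trace_sub xi x e r : dY (iota x) xi < e ->
  iota @^-1` dball dY xi r `<=` dball de x (e + r).
Proof.
move=> xe y; rewrite /dball /= -iso => h; apply: le_lt_trans (mdist_tri mdY _ xi _) _.
exact: ltrD.
Qed.

Lemma sub_trace xi x e r : dY (iota x) xi < e ->
  dball de x r `<=` iota @^-1` dball dY xi (e + r).
Proof.
move=> xe y; rewrite /dball /= -iso => h; apply: le_lt_trans (mdist_tri mdY _ (iota x) _) _.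
by rewrite ltrD// (mdistC mdY).
Qed.

(** d_eps is bounded by 4 / eps; approximating both points from X adds less than 2 / eps. *)
Lemma ball_setT xi r : 7 / eps <= r -> dball dY xi r = setT.
Proof.
move=> h; apply/seteqP; split => // y _; rewrite /dball /=.
have ie : 0 < eps^-1 by rewrite invr_gt0.
have [a ha] := dense xi ie; have [b hb] := dense y ie.
have := mdist_tri mdY xi (iota a) y; have := mdist_tri mdY (iota a) (iota b) y.
have := de_bounded z0 md geo eps0 a b; rewrite iso (mdistC mdY xi (iota a)); lra.
Qed.

Lemma nu_trace_gt0 xi r : 0 < r -> (0 < nu (iota @^-1` dball dY xi r))%E.
Proof.
move=> r0; have r2 : 0 < r / 2 by rewrite divr_gt0.
have [x hx] := dense xi r2.
apply: lt_le_trans (nu_eball_gt0 z0 md geo mX R00 eps0 dbl beta_gt x r2) _.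
apply: le_measure; [exact/mem_set/eball_measurable|exact/mem_set/trace_measurable|].
by rewrite [r in X in _ `<=` X](splitr r); exact: sub_trace.
Qed.

(** With [x] in X within r / 2 of [xi], the 2r-ball of [xi] lies in the 3r-ball of [x], and the r /
    2-ball of [x] in the r-ball of [xi]: the ratio is 6. Large balls are the whole space. *)
Lemma nu_trace_doubling : exists C, 1 <= C /\ forall xi r, 0 < r ->
  (nu (iota @^-1` dball dY xi (2 * r)) <= C%:E * nu (iota @^-1` dball dY xi r))%E.
Proof.
have rm : 0 < 7 / eps by rewrite divr_gt0.
have [C [C1 H]] := nu_doubling md geo mX R00 eps0 dbl beta_gt close rm.
exists C; split => // xi r r0; case: (leP (7 / eps) r) => h.
  rewrite !ball_setT//; last by lra.
  by rewrite lee_pemull// lee_fin.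
have r2 : 0 < r / 2 by rewrite divr_gt0.
have [x hx] := dense xi r2.
apply: (@le_trans _ _ (nu (dball de x (6 * (r / 2))))).
  apply: le_measure; [exact/mem_set/trace_measurable|exact/mem_set/eball_measurable|].
  apply: subset_trans (trace_sub hx) _; apply: (ball_mono mde) => //; lra.
apply: le_trans (H _ _ _ _) _ => //; first lra.
apply: lee_wpmul2l; first by rewrite lee_fin; lra.
apply: le_measure; [exact/mem_set/eball_measurable|exact/mem_set/trace_measurable|].
by rewrite [r in X in _ `<=` X](splitr r); exact: sub_trace.
Qed.

Lemma extension_doubling : exists C, doubling dY (wvol mu w iota) C (fun=> True).
Proof.
have [C [C1 H]] := nu_trace_doubling; exists C => xi r r0 _; split.
- by apply: nu_trace_gt0; rewrite mulr_gt0.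
- exact: H.
- by apply: (nu_fin z0 md geo mX R00 dbl beta_gt); exact: trace_measurable.
Qed.

Hypothesis unb : dunbounded d.

(** If rho x >= 1/2, a point at d-distance over 1 / eps will do, as any curve to it pays for its
    start near [x]; otherwise [z0], where rho = 1, is far by the Lipschitz bound on rho. *)
Lemma far_point x : exists y, (8 * eps)^-1 <= de x y.
Proof.
have ie : 0 < eps^-1 by rewrite invr_gt0.
have i8 : (8 * eps)^-1 = eps^-1 / 8 by field; rewrite lt0r_neq0.
case: (leP 2^-1 (rho x)) => h.
  have [y hy] := unb x eps^-1; exists y.
  have := de_initial z0 md eps0 geo (ltW ie) (ltW hy); apply: le_trans.
  rewrite i8 -mulrA ler_pM2l// mulfV ?lt0r_neq0// expRN.
  have : (expR 1 : R)^-1 >= 4^-1 by rewrite lef_pV2 ?posrE ?expR_gt0//; exact: expR1_le4.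
  have : (expR 1 : R)^-1 > 0 by rewrite invr_gt0 expR_gt0.
  by nra.
exists z0; have := rho_de_lip z0 md geo eps0 z0 x.
have -> : rho z0 = 1 by rewrite /rho_eps (mdist0 md) mulr0 oppr0 expR0.
rewrite (mdistC mde z0 x) => hl; have : 1 - rho x <= 4 * eps * de x z0.
  by apply: le_trans hl; exact: ler_norm.
move=> hl2; rewrite i8 ler_pdivrMr// -[leLHS]mulr1 ler_pdivrMl//; lra.
Qed.

(** The Poincare inequality is scaled by the diameter, while chaining produces the radius. A far
    point is at distance at least 1 / (8 eps) >= r / 56; cutting a curve to it at t = r / 56 with
    slack t / 2 gives a point of the ball at distance at least r / 112. *)
Lemma ddiam_lower xi r : 0 < r -> r <= 7 / eps -> ((r / 112)%:E <= ddiam dY (dball dY xi r))%E.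
Proof.
move=> r0 rm; have r4 : 0 < r / 4 by rewrite divr_gt0.
have [x hx] := dense xi r4; have [y0 hy] := far_point x.
have ie : 0 < eps^-1 by rewrite invr_gt0.
have i8 : (8 * eps)^-1 = eps^-1 / 8 by field; rewrite lt0r_neq0.
pose t := r / 56.
have t0 : 0 < t by rewrite /t; lra.
have td : t <= de x y0 by rewrite /t; lra.
have [z [z1 z2]] := de_between md eps0 geo (ltW t0) td (divr_gt0 t0 (ltr0Sn _ 1)).
apply: (@le_trans _ _ (dY (iota x) (iota z))%:E).
  rewrite lee_fin iso; have := mdist_tri mde x z y0; move: z1 z2; rewrite /t; lra.
apply: ereal_sup_ubound; exists (iota x).
  by rewrite /dball /= (mdistC mdY); lra.
exists (iota z) => //; rewrite /dball /=; have := mdist_tri mdY xi (iota x) (iota z).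
rewrite iso (mdistC mdY xi (iota x)); move: z1; rewrite /t; lra.
Qed.

End Extension.

Lemma expR_third (R : realType) : expR 3^-1 <= 3 / 2 :> R.
Proof.
have h : 1 - 3^-1 <= expR (- 3^-1) :> R by apply: (@expR_ge1Dx R (- 3^-1)).
rewrite -[expR 3^-1]invrK -expRN.
have -> : 3 / 2 = (1 - 3^-1)^-1 :> R by field.
rewrite lef_pV2 ?posrE ?expR_gt0//; lra.
Qed.

(** * The Whitney scale of a ball and the shadows of Whitney balls *)

Section Scale.
Context {R : realType} {X Y : Type} (d : X -> X -> R) (z0 : X) (eps : R).
Hypothesis md : is_metric d.
Hypothesis geo : geodesic_space d.
Hypothesis eps0 : 0 < eps.
Notation rho := (rho_eps d z0 eps).
Notation de := (d_eps d z0 eps).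
Variables (dY : Y -> Y -> R) (iota : X -> Y).
Hypothesis mdY : is_metric dY.
Hypothesis iso : forall x y, dY (iota x) (iota y) = de x y.
Variables (eta : R) (xi : Y) (r c Lam : R).
Hypothesis eta0 : 0 < eta.
Notation b := (depth dY iota xi r).
Notation D := (jdist d z0 eps dY iota eta xi r).
Let theta := eta * eps / 100.
Hypothesis c0 : 0 < c.
Hypothesis Lc : eps * (Lam * c) <= 3^-1.
Hypothesis Lam1 : 1 <= Lam.
Hypothesis Lth : 16 * (Lam * c * theta) <= 1.

(** Dividing by [rho] converts the d_eps-size c D into a d-radius; since D <= rho, this radius never
    exceeds [c]. *)
Definition wscale x := c * D x / rho x.
Notation s := wscale.

Let th0 : 0 < theta. Proof. by rewrite /theta divr_gt0// mulr_gt0. Qed.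

Lemma wscale_rho x : s x * rho x = c * D x.
Proof. by rewrite /s mulfVK// lt0r_neq0// rho_gt0. Qed.

Lemma wscale_gt0 x : 0 < b x -> 0 < s x.
Proof. by move=> bx; rewrite divr_gt0 ?rho_gt0// mulr_gt0// jdist_gt0. Qed.

Lemma wscale_le x : s x <= c.
Proof. by rewrite ler_pdivrMr ?rho_gt0// ler_pM2l// jdist_lerho. Qed.

(** Within d-distance Lam * s, rho changes at most by exp(1/3) <= 3/2 and the depth by at most an
    eighth. Both parts of the minimum being controlled, the scale changes at most by the factor
    (3/2)(8/7) < 2. *)
Lemma wscale_near x y : 0 < b x -> d x y <= Lam * s x ->
  [/\ 0 < b y, s y <= 2 * s x, s x <= 2 * s y, rho y <= 3 / 2 * rho x &
      de x y <= 3 / 2 * (d x y * rho x)].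
Proof.
move=> bx dxy; have L1 := Lam1; have c0_ := c0; have th := th0.
have q : expR (eps * d x y) <= 3 / 2.
  apply: le_trans (expR_third R); rewrite ler_expR; apply: le_trans Lc.
  rewrite ler_pM2l//; apply: le_trans dxy _; rewrite ler_pM2l ?wscale_le//; lra.
have q' : expR (eps * d y x) <= 3 / 2 by rewrite (mdistC md).
have rxy := rho_leK z0 md eps0 q; have ryx := rho_leK z0 md eps0 q'.
have dxy' := de_leK z0 md geo eps0 q.
have rx := rho_gt0 d z0 eps x; have ry := rho_gt0 d z0 eps y.
have D0 := jdist_gt0 d z0 eps0 eta0 bx.
have dD : d x y * rho x <= Lam * c * D x.
  apply: (@le_trans _ _ (Lam * s x * rho x)); first by rewrite ler_pM2r.
  by rewrite -mulrA wscale_rho mulrA.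
have Db : D x <= theta * b x := jdist_ledepth _ _ _ _ _ _ _ _ _.
have small : de x y <= 8^-1 * b x.
  have : Lam * c * D x <= Lam * c * (theta * b x).
    by rewrite ler_pM2l// mulr_gt0//; lra.
  have : 16 * (Lam * c * theta) * b x <= 1 * b x by rewrite ler_pM2r.
  lra.
have b1 := depth_lip mdY iso xi r x y; have b2 := depth_lip mdY iso xi r y x.
have mde := de_metric z0 md eps0 geo; rewrite (mdistC mde y x) in b2.
have by0 : 0 < b y by lra.
have Dy0 := jdist_gt0 d z0 eps0 eta0 by0.
have Dy1 : D y <= theta * b y := jdist_ledepth _ _ _ _ _ _ _ _ _.
have Dy2 : D y <= rho y := jdist_lerho _ _ _ _ _ _ _ _ _.
have Dx2 : D x <= rho x := jdist_lerho _ _ _ _ _ _ _ _ _.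
have tb : theta * b y <= 8^-1 * 9 * (theta * b x).
  have : theta * b y <= theta * (8^-1 * 9 * b x) by rewrite ler_pM2l//; lra.
  lra.
have tb' : theta * b x <= 7^-1 * 8 * (theta * b y).
  have : theta * b x <= theta * (7^-1 * 8 * b y) by rewrite ler_pM2l//; lra.
  lra.
have H u v Du Dv (ru rv : R) : 0 < ru -> 0 < rv -> 0 < Du -> 0 < Dv ->
    Dv <= rv -> Dv <= theta * b v -> Du = Num.min ru (theta * b u) ->
    theta * b v <= 7^-1 * 8 * (theta * b u) -> ru <= 3 / 2 * rv ->
    c * Dv / rv <= 2 * (c * Du / ru).
  move=> ru0 rv0 Du0 Dv0 h1 h2 h3 h4 h5.
  have -> : 2 * (c * Du / ru) = c * (2 * Du / ru) by field; rewrite lt0r_neq0.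
  rewrite -mulrA ler_pM2l// ler_pdivrMr// mulrAC ler_pdivlMr//.
  case: (leP ru (theta * b u)) h3 => _ ->.
    by have : Dv * ru <= rv * ru; [rewrite ler_pM2r|nra].
  have : Dv * ru <= 7^-1 * 8 * (theta * b u) * (3 / 2 * rv).
    by apply: ler_pM => //; [exact: ltW|exact: ltW|exact: le_trans h2 h4].
  have : 0 <= theta * b u * rv.
    have := lt_le_trans Dv0 h2 => k1; rewrite mulr_ge0 ?(ltW rv0)//; lra.
  lra.
split => //.
- by apply: (H x y) => //; lra.
- by apply: (H y x) => //; lra.
Qed.

Lemma wscale_le_mul A R1 x : 0 < A -> A * c <= 8 * R1 -> A * (s x / 4) <= 2 * R1.
Proof. by move=> A0 h; have : A * s x <= A * c; [rewrite ler_pM2l// wscale_le|lra]. Qed.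

(** If the chain of [y] has a vertex [z] near [a], then D z <= 3 D a, and the path from [a] through
    [z] and [y] to a point of the ball of [y] has three parts, at most 3 D a, 3 M D a and 3 M D
    a. *)
Lemma wscale_shadow M y z a : 0 < M -> 2 <= Lam -> c <= 1 ->
  0 < b y -> D y <= M * D z -> de y z <= M * D z -> 0 < b a -> d a z < 2 * s a ->
  dball d y (s y / 4) `<=` dball de a ((9 + 6 * M) * D a).
Proof.
move=> M0 L2 c1 by0 yz1 yz2 ba az v; rewrite /dball /= => yv.
have sa := wscale_gt0 ba; have sy := wscale_gt0 by0.
have Da := jdist_gt0 d z0 eps0 eta0 ba; have Dy := jdist_gt0 d z0 eps0 eta0 by0.
have az' : d a z <= Lam * s a.
  by apply: le_trans (ltW az) _; rewrite ler_pM2r.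
have yv' : d y v <= Lam * s y.
  have L1 : 1 * s y <= Lam * s y by rewrite ler_pM2r.
  lra.
have [bz z1 _ z2 z3] := wscale_near ba az'.
have [_ _ _ _ v3] := wscale_near by0 yv'.
have ra := rho_gt0 d z0 eps a; have ry := rho_gt0 d z0 eps y.
have Dz : D z <= 3 * D a.
  rewrite -(ler_pM2l c0) -wscale_rho.
  apply: (@le_trans _ _ (2 * s a * (3 / 2 * rho a))).
    by apply: ler_pM => //; [exact: ltW (wscale_gt0 bz)|exact: rho_ge0].
  have -> : 2 * s a * (3 / 2 * rho a) = 3 * (s a * rho a) by field.
  by rewrite wscale_rho; lra.
have e1 : de a z <= 3 * D a.
  apply: le_trans z3 _; have : d a z * rho a <= 2 * s a * rho a by rewrite ler_pM2r// ltW.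
  have := wscale_rho a; have : c * D a <= 1 * D a by rewrite ler_pM2r.
  lra.
have e2 : de y v < D y.
  apply: le_lt_trans v3 _; have : d y v * rho y <= s y / 4 * rho y by rewrite ler_pM2r// ltW.
  have := wscale_rho y; have : c * D y <= 1 * D y by rewrite ler_pM2r.
  lra.
have e3 : M * D z <= M * (3 * D a) by rewrite ler_pM2l.
have mde := de_metric z0 md eps0 geo.
have := mdist_tri mde a z v; have := mdist_tri mde z y v; rewrite (mdistC mde z y).
lra.
Qed.

End Scale.

(** The power of x / tau is at most 1 or at most x / tau, according to the position of x / tau
    relative to 1. *)
Lemma powR_le_affine {R : realType} (x tau q : R) : 0 <= x -> 0 < tau -> 0 < q -> q <= 1 ->
  powR x q <= powR tau q * (1 + x / tau).
Proof.
move=> x0 t0 q0 q1; have y0 : 0 <= x / tau by rewrite divr_ge0// ltW.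
have -> : powR x q = powR tau q * powR (x / tau) q.
  by rewrite -powRM ?(ltW t0)// mulrC divfK// lt0r_neq0.
rewrite ler_wpM2l ?powR_ge0//; case: (leP (x / tau) 1) => h.
  apply: (@le_trans _ _ (powR 1 q)); last by rewrite powR1 lerDl.
  by apply: ge0_ler_powR; rewrite ?nnegrE// ltW.
apply: (@le_trans _ _ (powR (x / tau) 1)); last by rewrite powRr1// lerDr.
by apply: ler_powR => //; exact: ltW.
Qed.

Section WeightedMean.
Context {R : realType} {dd : measure_display} {X : measurableType dd}.
Variables (mu : {measure set X -> \bar R}) (w : X -> R).
Hypothesis mw : measurable_fun [set: X] w.
Hypothesis w0 : forall x, 0 <= w x.
Variables (A : set X) (N : R).
Hypothesis mA : measurable A.
Hypothesis N0 : 0 < N.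
Hypothesis AN : (\int[mu]_(x in A) (w x)%:E = N%:E)%E.
Variables (v : X -> R) (M : R).
Hypothesis mv : measurable_fun [set: X] v.
Hypothesis vM : forall x, `|v x| <= M.

Let mwA B : measurable_fun B (EFin \o w).
Proof. by apply/measurable_EFinP; exact: measurable_funTS. Qed.

Let bounded_integrable (f : X -> R) L : measurable_fun [set: X] f -> (forall x, `|f x| <= L) ->
  mu.-integrable A (fun x => (f x * w x)%:E).
Proof.
move=> mf fL; apply/integrableP; split.
  by apply/measurable_EFinP; apply: measurable_funM; exact: measurable_funTS.
apply: (@le_lt_trans _ _ (\int[mu]_(x in A) (L%:E * (w x)%:E))%E); last first.
  rewrite integralZl//; last first.
    apply/integrableP; split => //; under eq_integral do rewrite gee0_abs ?lee_fin//.
    by rewrite AN ltry.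
  by rewrite AN -EFinM ltry.
apply: ge0_le_integral => //.
- apply: measurableT_comp => //; apply/measurable_EFinP.
  by apply: measurable_funM; exact: measurable_funTS.
- by apply: emeasurable_funM.
- by move=> x _; rewrite -EFinM lee_fin normrM (ger0_norm (w0 x)) ler_wpM2r.
Qed.

(** Integrating v - c shows that |m - c| N is at most the oscillation around [c]; so the mean value
    is optimal up to the factor 2, and chaining may use any constant. *)
Lemma weighted_mean_optimal (c T m : R) :
  (\int[mu]_(x in A) (`|v x - c| * w x)%:E <= T%:E)%E ->
  m = fine (\int[mu]_(x in A) ((v x)%:E * (w x)%:E))%E / N ->
  (\int[mu]_(x in A) ((`|v x - m|)%:E * (w x)%:E) <= (2 * T)%:E)%E.
Proof.
move=> hT mdef.
have iv := bounded_integrable mv vM.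
have ic : mu.-integrable A (fun x => (c * w x)%:E).
  by apply: (bounded_integrable (L := `|c|)) => //; exact: measurable_cst.
have mE : (\int[mu]_(x in A) (v x * w x)%:E = (m * N)%:E)%E.
  rewrite mdef mulfVK ?lt0r_neq0// fineK//.
  exact: (integrable_fin_num mA iv).
have cE : (\int[mu]_(x in A) (c * w x)%:E = (c * N)%:E)%E.
  under eq_integral do rewrite EFinM.
  rewrite integralZl// ?AN//; apply/integrableP; split => //.
  by under eq_integral do rewrite gee0_abs ?lee_fin//; rewrite AN ltry.
have mN : `|m - c| * N <= T.
  rewrite -lee_fin; apply: le_trans hT.
  have <- : (`|\int[mu]_(x in A) ((v x * w x)%:E - (c * w x)%:E)| = (`|m - c| * N)%:E)%E.
    rewrite integralB// mE cE -EFinB -mulrBl abse_EFin normrM.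
    by rewrite (gtr0_norm N0).
  apply: le_trans (le_abse_integral _ _ _) _ => //.
    by apply: emeasurable_funB; [exact: (measurable_int mu iv)|exact: (measurable_int mu ic)].
  rewrite le_eqVlt; apply/orP; left; apply/eqP; apply: eq_integral => x _.
  by rewrite -EFinB -mulrBl abse_EFin normrM (ger0_norm (w0 x)).
have mabs e : measurable_fun A (fun x => (`|v x - e|)%:E).
  apply/measurable_EFinP; apply: measurableT_comp => //; apply: measurable_funB => //.
  exact: measurable_funTS.
apply: (@le_trans _ _ (\int[mu]_(x in A) ((`|v x - c| * w x)%:E + `|m - c|%:E * (w x)%:E))%E).
  apply: ge0_le_integral => //.
  - by move=> x _; rewrite mule_ge0// lee_fin.
  - exact: emeasurable_funM.
  - apply: emeasurable_funD; last exact: emeasurable_funM.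
    by apply/measurable_EFinP; apply: measurable_funM; [apply/measurable_EFinP; exact: mabs|exact: measurable_funTS].
  move=> x _; rewrite -!EFinM -EFinD lee_fin -mulrDl ler_wpM2r//.
  by rewrite (distrC m c); exact: ler_distD.
rewrite ge0_integralD//; first last.
- exact: emeasurable_funM.
- by move=> x _; rewrite mule_ge0// lee_fin.
- by apply/measurable_EFinP; apply: measurable_funM; [apply/measurable_EFinP; exact: mabs|exact: measurable_funTS].
- by move=> x _; rewrite lee_fin mulr_ge0.
rewrite ge0_integralZl_EFin//; last by move=> x _; rewrite lee_fin.
rewrite AN -EFinM; apply: (@le_trans _ _ (T%:E + T%:E)%E).
  by apply: leeD => //; rewrite lee_fin.
by rewrite -EFinD lee_fin; lra.
Qed.

End WeightedMean.

Lemma exp_archi {R : realType} (a : R) (n : nat) : (1 < n)%N -> exists k, a <= n%:R ^+ k.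
Proof.
move=> n1; exists (Num.truncn a).+1; apply: ltW; apply: lt_le_trans (truncnS_gt a) _.
by rewrite -natrX ler_nat ltnW// ltn_expl.
Qed.

Lemma small_scale {R : realType} (eps theta Lam R0 A : R) : 0 < eps -> 0 < theta -> 0 < Lam ->
  0 < R0 -> 0 < A -> exists c, [/\ 0 < c, eps * (Lam * c) <= 3^-1, 16 * (Lam * c * theta) <= 1,
    A * c <= 8 * R0 & Lam * c <= R0] /\ [/\ c <= 1, c * eps <= 1 & Lam * c <= eps^-1].
Proof.
move=> e0 th0 L0 R00 A0.
(* Each requirement on [c] has the form c t <= 1 for one summand [t]; the reciprocal of the sum
   meets them all. *)
pose S := 3 * eps * Lam + 16 * Lam * theta + A / (8 * R0) + Lam / R0 + 1 + eps.
have t1 : 0 < 3 * eps * Lam by rewrite !mulr_gt0.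
have t2 : 0 < 16 * Lam * theta by rewrite !mulr_gt0.
have t3 : 0 < A / (8 * R0) by rewrite divr_gt0// mulr_gt0.
have t4 : 0 < Lam / R0 by rewrite divr_gt0.
have S0 : 0 < S by rewrite /S; lra.
have cS t : t <= S -> S^-1 * t <= 1.
  by move=> h; rewrite -(mulVf (lt0r_neq0 S0)) ler_pM2l ?invr_gt0.
exists S^-1.
have c1 : S^-1 * (3 * eps * Lam) <= 1 by apply: cS; rewrite /S; lra.
have c2 : S^-1 * (16 * Lam * theta) <= 1 by apply: cS; rewrite /S; lra.
have c3 : S^-1 * (A / (8 * R0)) <= 1 by apply: cS; rewrite /S; lra.
have c4 : S^-1 * (Lam / R0) <= 1 by apply: cS; rewrite /S; lra.
have c5 : S^-1 * 1 <= 1 by apply: cS; rewrite /S; lra.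
have c6 : S^-1 * eps <= 1 by apply: cS; rewrite /S; lra.
split; split => //.
- by rewrite invr_gt0.
- lra.
- lra.
- by move: c3; rewrite mulrA ler_pdivrMr ?mulr_gt0// mul1r mulrC.
- by move: c4; rewrite mulrA ler_pdivrMr// mul1r mulrC.
- by rewrite -[leLHS]mulr1.
- by rewrite -[leRHS]mulr1 ler_pdivlMl//; lra.
Qed.

(** Places a d_eps-ball of radius comparable to [D a] in the small Whitney ball, so that doubling on
    d_eps-balls can compare the shadow with it. *)
Lemma eball_sub_ball {R : realType} {dd : measure_display} {X : measurableType dd} {Y : Type}
    (d : X -> X -> R) z0 eps (dY : Y -> Y -> R) (iota : X -> Y) eta xi r c a :
  is_metric d -> geodesic_space d -> 0 < eps -> 0 < eta -> 0 < c -> c * eps <= 1 ->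
  0 < depth dY iota xi r a ->
  dball (d_eps d z0 eps) a (c * jdist d z0 eps dY iota eta xi r a / 16) `<=`
  dball d a (wscale d z0 eps dY iota eta xi r c a / 4).
Proof.
move=> md geo eps0 eta0 c0 ce ba y; rewrite /dball /=.
set D := jdist _ _ _ _ _ _ _ _ _; set rho := rho_eps d z0 eps a => ay.
have ra : 0 < rho by exact: rho_gt0.
have D0 : 0 < D by exact: jdist_gt0.
have h1 : c * D / 16 <= rho / (4 * eps).
  rewrite ler_pdivlMr ?mulr_gt0//.
  have : c * eps * D <= 1 * rho by apply: ler_pM => //; [rewrite mulr_ge0 ?ltW|exact: ltW|exact: jdist_lerho].
  lra.
have [_ h2] := d_le md geo eps0 ay h1.
rewrite -(ltr_pM2r ra) mulrAC wscale_rho -/D; apply: lt_le_trans h2 _; lra.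
Qed.

(** * Oscillation on an arbitrary ball of the extension *)

Section GlobalPoincare.
Context {R : realType} {dd : measure_display} {X : measurableType dd}.
Variables (d : X -> X -> R) (mu : {measure set X -> \bar R}) (z0 : X) (eps beta Cd R0 : R).
Hypothesis md : is_metric d.
Hypothesis geo : geodesic_space d.
Hypothesis mX : @measurable _ X = dborel d.
Hypothesis R00 : 0 < R0.
Hypothesis eps0 : 0 < eps.
Hypothesis dbl : forall x r, 0 < r -> r <= R0 ->
  [/\ (0 < mu (dball d x (2 * r)))%E, (mu (dball d x (2 * r)) <= Cd%:E * mu (dball d x r))%E &
      (mu (dball d x (2 * r)) < +oo)%E].
Hypothesis beta_gt : 4 * ln Cd / R0 < beta.
Notation rho := (rho_eps d z0 eps).
Notation de := (d_eps d z0 eps).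
Hypothesis close : forall C, exists K, 2 <= K /\ forall x y,
  de x y <= C * rho x -> de x y <= C * rho y -> expR (eps * d x y) <= K.
Notation w := (weight d z0 beta).
Notation nu := (nu z0 md mX R00 dbl beta_gt).
Context {Y : Type} (dY : Y -> Y -> R) (iota : X -> Y).
Hypothesis mdY : is_metric dY.
Hypothesis iso : forall x y, dY (iota x) (iota y) = de x y.
Hypothesis dense : forall y e, 0 < e -> exists x, dY (iota x) y < e.
Variables (p lam0 CPI : R).
Hypothesis p1 : 1 <= p.
Hypothesis lam1 : 1 <= lam0.
Hypothesis PI : poincare d (wvol mu (fun=> 1) id) (wint mu (fun=> 1) id) p lam0 CPI
  (fun r => r <= R0).

Let mde : is_metric de := de_metric z0 md eps0 geo.
Let p0 : 0 < p. Proof. exact: lt_le_trans p1. Qed.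
Let nuE A : measurable A -> nu A = (fine (nu A))%:E.
Proof.
by move=> mA; rewrite fineK// ge0_fin_numE// (nu_fin z0 md geo mX R00 dbl beta_gt).
Qed.

(** All parameters, including [CW], are fixed before [u], [gr] and the ball. The energy [J] is
    assumed finite, and the comparison constant [a] is arbitrary; the mean value enters later. *)
Lemma ball_oscillation : exists CW, 0 <= CW /\ forall (u : Y -> R) (gr : Y -> \bar R),
  dmeasR dY u -> (exists M, forall y, `|u y| <= M) -> dmeasE dY gr ->
  (forall y, (0 <= gr y)%E) -> upper_gradient dY u gr ->
  forall xi (r J : R), 0 < r -> r <= 7 / eps ->
  (\int[mu]_(x in iota @^-1` dball dY xi r) (grp iota p gr x * (w x)%:E) = J%:E)%E ->
  exists a, (\int[mu]_(x in iota @^-1` dball dY xi r) (`|u (iota x) - a| * w x)%:E <=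
    (CW * r * powR (J / fine (nu (iota @^-1` dball dY xi r))) p^-1 *
      fine (nu (iota @^-1` dball dY xi r)))%:E)%E.
Proof.
have [K [K2 closeK]] := close (1600 / eps).
have K20 : 0 < 32 * K ^+ 2 by rewrite mulr_gt0// exprn_gt0//; lra.
pose eta := (32 * K ^+ 2)^-1.
have eta0 : 0 < eta by rewrite invr_gt0.
have etaK : eta * (32 * K ^+ 2) <= 1 by rewrite mulVf// lt0r_neq0.
have eta1 : eta <= 1.
  have : 1 * eta <= 32 * K ^+ 2 * eta by rewrite ler_pM2r//; nra.
  rewrite mulfV ?lt0r_neq0//; lra.
pose theta := eta * eps / 100.
have theta0 : 0 < theta by rewrite divr_gt0// mulr_gt0.
have thr : theta * (7 / eps) <= 4^-1.
  have -> : theta * (7 / eps) = 7 * eta / 100 by rewrite /theta; field; rewrite lt0r_neq0.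
  by lra.
have [Lam LamE] : exists L, L = 16 * lam0 by exists (16 * lam0).
have lam1_ := lam1; have R00_ := R00; have eps0_ := eps0.
have Lam16 : 16 <= Lam by rewrite LamE; lra.
have Lam0 : 0 < Lam by lra.
have Lam1 : 1 <= Lam by lra.
have Lam2 : 2 <= Lam by lra.
have [k kLam] := exp_archi (4 * (5 * Lam + 4)) (isT : (1 < 2)%N).
have k0 : 0 < 2 ^+ k :> R by rewrite exprn_gt0.
have [c [[c0 Lc Lth kc LR] [c1 ce Le]]] := small_scale eps0 theta0 Lam0 R00 k0.
have cth : c * theta <= 1.
  have : c * theta <= Lam * (c * theta) by rewrite ler_peMl// mulr_ge0// ltW.
  lra.
pose W := expR (beta * (Lam * c)).
have beta0 : 0 < beta by exact: (beta_gt0 md mX R00 dbl beta_gt).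
have W1 : 1 <= W.
  by rewrite -[leLHS]expR0 ler_expR mulr_ge0 ?(ltW beta0)// mulr_ge0 ?ltW.
have W0 : 0 < W by exact: lt_le_trans W1.
pose M := john_const eps K 1600 eta.
have M0 : 0 < M by exact: (john_const_gt0 eps0 K2 (lexx _) eta0 ltr01).
(* [j] enlargements by 6 take the d_eps-ball of radius c D / 16, contained in the small Whitney
   ball, to the shadow of radius (9 + 6 M) D. *)
have [j hj] := exp_archi ((9 + 6 * M) * 16 / c) (isT : (1 < 6)%N).
have [CS [CS1 HCS]] := nu_doubling_iter md geo mX R00 eps0 dbl beta_gt close j c0.
have CS0 : 0 <= CS by exact: le_trans ler01 CS1.
have lc0 := local_const_gt0 CPI.
exists (`|whitney_const Cd W k CS| * (2 * (local_const CPI * W ^+ 2))); split.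
  by rewrite mulr_ge0// mulr_ge0// mulr_ge0 ?exprn_ge0 ?(ltW lc0) ?(ltW W0).
move=> u gr mu_ bu mg g0 ug xi r J r0 rm HJ.
set Omega := iota @^-1` dball dY xi r in HJ *.
have mO : measurable Omega by exact: (trace_measurable md geo mX eps0 mdY iso).
set N := fine (nu Omega).
have NE : nu Omega = N%:E by exact: nuE.
have N0 : 0 < N.
  by rewrite -lte_fin -NE; exact: (nu_trace_gt0 md geo mX R00 eps0 dbl beta_gt mdY iso dense).
have Gw0 x : (0 <= grp iota p gr x * (w x)%:E)%E by rewrite mule_ge0 ?grp_ge0// lee_fin weight_ge0.
have J0 : 0 <= J by rewrite -lee_fin -HJ; exact: integral_ge0.
pose D := jdist d z0 eps dY iota eta xi r.
pose s := wscale d z0 eps dY iota eta xi r c.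
have OE x : Omega x <-> 0 < depth dY iota xi r x by rewrite /depth subr_gt0.
have near x y : Omega x -> d x y <= Lam * s x ->
  [/\ Omega y, s y <= 2 * s x, s x <= 2 * s y, rho y <= 3 / 2 * rho x & de x y <= 3 / 2 * (d x y * rho x)].
  move=> /OE bx dxy.
  by have [/OE h1 h2 h3 h4 h5] := wscale_near md geo eps0 mdY iso eta0 c0 Lc Lam1 Lth bx dxy.
have s0 x : Omega x -> 0 < s x by move=> /OE; exact: wscale_gt0.
have sc x : s x <= c by exact: wscale_le.
have sD x : s x * rho x = c * D x by exact: wscale_rho.
have Drho x : D x <= rho x by exact: jdist_lerho.
have rho1 x : rho x <= 1 by exact: rho_le1.
have D0 x : Omega x -> 0 < D x by move=> /OE; exact: jdist_gt0.
have sc' x : 0 < depth dY iota xi r x -> c * D x <= s x.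
  move=> /OE Ox; rewrite -sD ler_piMr//; exact: ltW (s0 _ Ox).
have [xs [bxs link]] := john_linked md geo eps0 mdY iso dense K2 (lexx _) closeK eta0 etaK thr r0 rm c0 sc'.
have Wn x y : d x y <= Lam * c -> w x <= W * w y /\ w y <= W * w x.
  move=> h; split; last exact: (weight_ratio z0 md mX R00 dbl beta_gt).
  by apply: (weight_ratio z0 md mX R00 dbl beta_gt); rewrite (mdistC md).
have Lsc x : Lam * s x <= Lam * c by rewrite ler_pM2l.
have L16 (t : R) : lam0 * (16 * t) = Lam * t by rewrite LamE; ring.
pose kap := local_const CPI * W ^+ 2 * r.
have kap0 : 0 <= kap by rewrite mulr_ge0 ?(ltW r0)// mulr_ge0 ?exprn_ge0 ?(ltW lc0) ?(ltW W0).
have mw := weight_measurable z0 md mX R00 dbl beta_gt.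
have mgrp := grp_measurable md geo mX eps0 iso p mg.
(* Chaining for any affine majorant of the p-th root. The majorant is only tested at averages [q]
   that can occur: if J = 0, they all vanish. *)
have main h kk : 0 <= h -> 0 <= kk ->
  (forall q, 0 <= q -> (J = 0 -> q = 0) -> kap * powR q p^-1 <= h + kk * q) ->
  exists a, (\int[mu]_(x in Omega) (`|u (iota x) - a| * w x)%:E <=
    (whitney_const Cd W k CS * (h * N + kk * J))%:E)%E.
  move=> h0 kk0 Hq.
  pose P x m := (\int[mu]_(y in dball d x (16 * s x)) (`|u (iota y) - m|)%:E <=
    (mb d mu x (16 * s x) * osc d mu mw (weight_ge0 d z0 beta) s Lam (grp iota p gr) h kk x)%:E)%E.
  have /choice [m Hm] : forall x, exists m, Omega x -> P x m.
    move=> x; case: (pselect (Omega x)) => Ox; last by exists 0.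
    have sx := s0 _ Ox.
    have e1 : lam0 * (16 * s x) <= eps^-1 by rewrite L16; apply: le_trans (Lsc x) Le.
    have e2 : lam0 * (16 * s x) <= R0 by rewrite L16; apply: le_trans (Lsc x) LR.
    have e3 y : d x y <= lam0 * (16 * s x) -> w x <= W * w y /\ w y <= W * w x.
      by rewrite L16 => h1; apply: Wn; exact: le_trans h1 (Lsc x).
    have [m Hm] := local_oscillation md geo mX R00 eps0 dbl beta_gt mdY iso p1 lam1 PI mu_ bu mg g0 ug
      sx e1 e2 W1 e3.
    exists m => _; rewrite /P; apply: le_trans Hm _.
    rewrite [leRHS]EFinM; apply: lee_wpmul2l; first by rewrite lee_fin (mb_ge0 d mu).
    rewrite L16 /osc; set B := dball d x (Lam * s x).
    have mB : measurable B by exact: ball_measurable.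
    have BO : B `<=` Omega by move=> y /ltW yB; have [] := near x y Ox yB.
    have lJ : (\int[mu]_(y in B) (grp iota p gr y * (w y)%:E) <= J%:E)%E.
      rewrite -HJ; apply: ge0_subset_integral => //.
      by apply: emeasurable_funM; [exact: measurable_funTS|apply/measurable_EFinP; exact: measurable_funTS].
    have lE : (\int[mu]_(y in B) (grp iota p gr y * (w y)%:E) =
        (locE d mu w s Lam (grp iota p gr) x)%:E)%E.
      rewrite /locE fineK// ge0_fin_numE; last exact: integral_ge0.
      exact: le_lt_trans lJ (ltry _).
    rewrite lE -EFinM lee_fin.
    have l0 : 0 <= locE d mu w s Lam (grp iota p gr) x by rewrite -lee_fin -lE; exact: integral_ge0.
    have lJ' : locE d mu w s Lam (grp iota p gr) x <= J by rewrite -lee_fin -lE.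
    rewrite mulrC [X in powR X _]mulrC mulrC.
    set q := locE _ _ _ _ _ _ _ / _.
    have q0 : 0 <= q by rewrite divr_ge0// fine_ge0.
    have qJ : J = 0 -> q = 0.
      move=> J00; rewrite /q; have -> : locE d mu w s Lam (grp iota p gr) x = 0; last by rewrite mul0r.
      by apply/eqP; rewrite eq_le l0 andbT (le_trans lJ')// J00.
    apply: le_trans (Hq q q0 qJ); rewrite ler_wpM2r ?powR_ge0//.
    have -> : local_const CPI * s x * rho x * W ^+ 2 = local_const CPI * W ^+ 2 * (s x * rho x) by ring.
    rewrite sD /kap ler_pM2l; last exact: mulr_gt0 lc0 (exprn_gt0 2 W0).
    have h1 : D x <= theta * r.
      apply: (le_trans (jdist_ledepth _ _ _ _ _ _ _ _ _)); rewrite ler_pM2l//; exact: depth_le.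
    apply: (@le_trans _ _ (c * (theta * r))); first by rewrite ler_pM2l.
    by rewrite mulrA ler_piMl// ltW.
  have sR0 x : Omega x -> 2 ^+ k * (s x / 4) <= 2 * R0 by move=> _; exact: wscale_le_mul.
  have sn x y : Omega x -> d x y <= Lam * s x -> [/\ Omega y, s y <= 2 * s x & s x <= 2 * s y].
    by move=> Ox xy; have [] := near x y Ox xy.
  have wn x y : Omega x -> d x y <= Lam * s x -> w y <= W * w x /\ w x <= W * w y.
    by move=> Ox xy; have [] := Wn x y (le_trans xy (Lsc x)).
  have mS a : measurable (dball de a ((9 + 6 * M) * D a)) by exact: eball_measurable.
  have nuS a : Omega a -> (density mu mw (weight_ge0 d z0 beta) (dball de a ((9 + 6 * M) * D a)) <=
      CS%:E * density mu mw (weight_ge0 d z0 beta) (dball d a (s a / 4)))%E.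
    move=> Oa; have Da := D0 _ Oa.
    have r10 : 0 < c * D a / 16 by rewrite divr_gt0// mulr_gt0.
    have r1c : c * D a / 16 <= c.
      by rewrite ler_pdivrMr// ler_pM2l// (le_trans (Drho a))// (le_trans (rho1 a))// ler1n.
    apply: (@le_trans _ _ (nu (dball de a (6 ^+ j * (c * D a / 16))))).
      apply: le_measure; [exact/mem_set|exact/mem_set/eball_measurable|].
      apply: (ball_mono mde) => //.
      have -> : 6 ^+ j * (c * D a / 16) = 6 ^+ j * c / 16 * D a by ring.
      rewrite ler_pM2r// ler_pdivlMr//; move: hj; rewrite ler_pdivrMr//.
    apply: le_trans (HCS a _ r10 r1c) _; apply: lee_wpmul2l; first by rewrite lee_fin.
    apply: le_measure; [exact/mem_set/eball_measurable|exact/mem_set/ball_measurable|].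
    exact: (eball_sub_ball md geo eps0 eta0 c0 ce (proj1 (OE a) Oa)).
  have PO y z : [/\ 0 < depth dY iota xi r z, D y <= M * D z & de y z <= M * D z] -> Omega z.
    by move=> [/OE].
  have PS y z a : Omega y -> [/\ 0 < depth dY iota xi r z, D y <= M * D z & de y z <= M * D z] ->
      Omega a -> d a z < 2 * s a -> dball d y (s y / 4) `<=` dball de a ((9 + 6 * M) * D a).
    move=> /OE by0 [_ yz1 yz2] /OE ba az.
    exact: (wscale_shadow md geo eps0 mdY iso eta0 c0 Lc Lam1 Lth M0 Lam2 c1 by0 yz1 yz2 ba az).
  have Oxs : Omega xs by apply/OE.
  have link' y : Omega y -> linked d (fun z => [/\ 0 < depth dY iota xi r z, D y <= M * D z & de y z <= M * D z]) s y xs.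
    by move=> /OE; exact: link.
  have mu_u := u_iota_measurable md geo mX eps0 iso mu_.
  have nf E : measurable E -> (density mu mw (weight_ge0 d z0 beta) E < +oo)%E.
    exact: (nu_fin z0 md geo mX R00 dbl beta_gt).
  exact: (whitney_bound md mX R00 dbl (weight_gt0 d z0 beta) W1 nf mO Lam16 kLam s0 sR0 sn wn
    mu_u mgrp (grp_ge0 iota p gr) h0 kk0 HJ Hm Oxs mS CS0 nuS PO PS link').
have pi0 : 0 < p^-1 by rewrite invr_gt0.
(* Without energy there is no positive point at which to linearize, but the zero majorant
   suffices. *)
case: (eqVneq J 0) => [J00|Jn].
  have [//|//|q _ /(_ J00) ->|a Ha] := main 0 0.
    by rewrite powR0 ?lt0r_neq0// !mulr0 addr0.
  exists a; apply: le_trans Ha _.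
  by rewrite J00 !mul0r addr0 mulr0 powR0 ?lt0r_neq0// mulr0 mul0r.
have Jp : 0 < J by rewrite lt_neqAle eq_sym Jn.
(* Linearizing at the average of g^p over the whole ball balances the two terms: h N and (h / tau) J
   are equal. *)
pose tau := J / N.
have tau0 : 0 < tau by rewrite divr_gt0.
pose h := kap * powR tau p^-1.
have h0 : 0 <= h by rewrite mulr_ge0// powR_ge0.
have [//||q q0 _|a Ha] := main h (h / tau).
- by rewrite divr_ge0// ltW.
- have -> : h + h / tau * q = kap * (powR tau p^-1 * (1 + q / tau)).
    by rewrite /h; field; rewrite lt0r_neq0.
  rewrite ler_wpM2l// powR_le_affine// invf_le1//.
exists a; apply: le_trans Ha _; rewrite lee_fin.
have -> : h * N + h / tau * J = 2 * h * N by rewrite /tau; field; rewrite !lt0r_neq0.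
apply: (@le_trans _ _ (`|whitney_const Cd W k CS| * (2 * h * N))).
  by rewrite ler_wpM2r ?ler_norm// mulr_ge0 ?(ltW N0)// mulr_ge0.
rewrite /h /kap -/tau le_eqVlt; apply/orP; left; apply/eqP; ring.
Qed.

End GlobalPoincare.

(** * Poincare inequalities on the extension with dilation 1 and with larger dilation *)

Section Conclusion.
Context {R : realType} {dd : measure_display} {X : measurableType dd}.
Variables (d : X -> X -> R) (mu : {measure set X -> \bar R}) (z0 : X) (eps beta Cd R0 : R).
Hypothesis md : is_metric d.
Hypothesis geo : geodesic_space d.
Hypothesis unb : dunbounded d.
Hypothesis mX : @measurable _ X = dborel d.
Hypothesis R00 : 0 < R0.
Hypothesis eps0 : 0 < eps.
Hypothesis dbl : forall x r, 0 < r -> r <= R0 ->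
  [/\ (0 < mu (dball d x (2 * r)))%E, (mu (dball d x (2 * r)) <= Cd%:E * mu (dball d x r))%E &
      (mu (dball d x (2 * r)) < +oo)%E].
Hypothesis beta_gt : 4 * ln Cd / R0 < beta.
Notation rho := (rho_eps d z0 eps).
Notation de := (d_eps d z0 eps).
Hypothesis close : forall C, exists K, 2 <= K /\ forall x y,
  de x y <= C * rho x -> de x y <= C * rho y -> expR (eps * d x y) <= K.
Notation w := (weight d z0 beta).
Notation nu := (nu z0 md mX R00 dbl beta_gt).
Context {Y : Type} (dY : Y -> Y -> R) (iota : X -> Y).
Hypothesis mdY : is_metric dY.
Hypothesis iso : forall x y, dY (iota x) (iota y) = de x y.
Hypothesis dense : forall y e, 0 < e -> exists x, dY (iota x) y < e.
Variables (p lam0 CPI : R).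
Hypothesis p1 : 1 <= p.
Hypothesis lam1 : 1 <= lam0.
Hypothesis PI : poincare d (wvol mu (fun=> 1) id) (wint mu (fun=> 1) id) p lam0 CPI
  (fun r => r <= R0).

Let p0 : 0 < p. Proof. exact: lt_le_trans p1. Qed.

Let mtrace xi r : measurable (iota @^-1` dball dY xi r).
Proof. exact: (trace_measurable md geo mX eps0 mdY iso). Qed.

Let nuE A : measurable A -> nu A = (fine (nu A))%:E.
Proof.
by move=> mA; rewrite fineK// ge0_fin_numE// (nu_fin z0 md geo mX R00 dbl beta_gt).
Qed.

Let trace_gt0 xi r : 0 < r -> 0 < fine (nu (iota @^-1` dball dY xi r)).
Proof.
move=> r0; rewrite -lte_fin -nuE//.
exact: (nu_trace_gt0 md geo mX R00 eps0 dbl beta_gt mdY iso dense).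
Qed.

Lemma extension_poincare : exists C, 0 <= C /\
  poincare dY (wvol mu w iota) (wint mu w iota) p 1 C (fun=> True).
Proof.
have [CW [CW0 H]] := ball_oscillation md geo mX R00 eps0 dbl beta_gt close mdY iso dense p1 lam1 PI.
(* 2 is the price of the mean value, and 112 that of replacing the radius by the diameter. Adding 1
   below makes the constant positive, which the case of infinite energy needs. *)
have [A [A0 AE]] : exists A : R, 0 <= A /\ A = 2 * 112 by exists (2 * 112); split; first lra.
have C0 : 0 < A * CW + 1 by exact: ltr_wpDl (mulr_ge0 A0 CW0) ltr01.
exists (A * CW + 1); split; first exact: ltW.
have rm : 0 < 7 / eps by rewrite divr_gt0.
move=> xi r r0 _ u gr mu_ bu mg g0 ug.
(* A larger ball is the whole space, and so is the ball of radius 7 / eps; the two inequalities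
   coincide. *)
wlog rle : r r0 / r <= 7 / eps.
  move=> hw; case: (leP r (7 / eps)) => h; first exact: hw.
  have := hw _ rm (lexx _); rewrite !mul1r !(ball_setT md geo eps0 mdY iso dense)//.
  exact: ltW.
rewrite mul1r; lazy zeta; set B := dball dY xi r; set uB := fine _ / fine _.
pose N := fine (nu (iota @^-1` B)); have N0 : 0 < N by exact: trace_gt0.
rewrite -[fine (wvol mu w iota B)]/N in uB *.
have Gw0 x : (0 <= grp iota p gr x * (w x)%:E)%E by rewrite mule_ge0 ?grp_ge0// lee_fin weight_ge0.
have I0 : (0 <= \int[mu]_(x in iota @^-1` B) (grp iota p gr x * (w x)%:E))%E by exact: integral_ge0.
rewrite -[wint mu w iota B (fun y => poweR (gr y) p)]/(\int[mu]_(x in iota @^-1` B) (grp iota p gr x * (w x)%:E))%E.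
have diam := ddiam_lower md geo eps0 mdY iso dense unb xi r0 rle.
have diam0 : (0 < ddiam dY B)%E by apply: lt_le_trans diam; rewrite lte_fin divr_gt0.
(* With infinite energy the right side is infinite, since the constant and the diameter are
   positive. *)
case E : (\int[mu]_(x in iota @^-1` B) (grp iota p gr x * (w x)%:E))%E I0 => [J| |] I0 //; last first.
  rewrite gt0_muley ?lte_fin ?invr_gt0// poweRyr ?invr_eq0 ?lt0r_neq0// gt0_muley ?leey//.
  by rewrite mule_gt0.
have [a Ha] := H u gr mu_ bu mg g0 ug xi r J r0 rle E.
have mw := weight_measurable z0 md mX R00 dbl beta_gt.
have mv := u_iota_measurable md geo mX eps0 iso mu_.
have [M hM] := bu; have bv x : `|(u \o iota) x| <= M by exact: hM.
have NE : (\int[mu]_(x in iota @^-1` B) (w x)%:E = N%:E)%E by exact: (nuE (mtrace xi r)).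
have Ho := weighted_mean_optimal mw (weight_ge0 d z0 beta) (mtrace xi r) N0 NE mv bv Ha (erefl uB).
rewrite -/(nu _) -/N in Ho.
apply: (@le_trans _ _ ((N^-1)%:E * (2 * (CW * r * powR (J / N) p^-1 * N))%:E)%E).
  by apply: lee_wpmul2l; [rewrite lee_fin invr_ge0 ltW|exact: Ho].
rewrite -!EFinM [N^-1 * J]mulrC.
have -> : N^-1 * (2 * (CW * r * powR (J / N) p^-1 * N)) = A * CW * (r / 112) * powR (J / N) p^-1.
  by rewrite AE; field; rewrite lt0r_neq0.
rewrite EFinM; apply: lee_wpmul2r; first by rewrite lee_fin powR_ge0.
rewrite EFinM; apply: lee_pmul => //.
- by rewrite lee_fin mulr_ge0.
- by rewrite lee_fin divr_ge0// ltW.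
- by rewrite lee_fin lerDl.
Qed.

Lemma nu_trace_dilate lam : exists K, 1 <= K /\ forall xi r, 0 < r ->
  (nu (iota @^-1` dball dY xi (lam * r)) <= K%:E * nu (iota @^-1` dball dY xi r))%E.
Proof.
have [C [C1 H]] := nu_trace_doubling md geo mX R00 eps0 dbl beta_gt close mdY iso dense.
have [k hk] := exp_archi lam (isT : (1 < 2)%N).
exists (C ^+ k); split; first by rewrite exprn_ege1.
move=> xi r r0; apply: (@le_trans _ _ (nu (iota @^-1` dball dY xi (2 ^+ k * r)))).
  apply: le_measure; [exact/mem_set|exact/mem_set|].
  by move=> x; rewrite /dball /= => h; apply: lt_le_trans h _; rewrite ler_pM2r.
elim: k {hk} => [|k IH]; first by rewrite !expr0 mul1r mul1e.
rewrite !exprS -mulrA; apply: le_trans (H _ _ _) _; first by rewrite mulr_gt0// exprn_gt0.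
rewrite EFinM -muleA; apply: lee_wpmul2l => //; rewrite lee_fin; exact: le_trans ler01 C1.
Qed.

(** Enlarging the ball on the right increases the integral, and doubling bounds the ratio of the
    masses by [K]; under the root it costs K ^ (1/p) <= K. *)
Lemma extension_poincare_dilate lam : 1 < lam -> exists C,
  poincare dY (wvol mu w iota) (wint mu w iota) p lam C (fun=> True).
Proof.
move=> lam_gt1; have [C [C0 H]] := extension_poincare.
have [K [K1 HK]] := nu_trace_dilate lam.
exists (C * K) => xi r r0 _ u gr mu_ bu mg g0 ug.
have := H xi r r0 I u gr mu_ bu mg g0 ug; rewrite mul1r; lazy zeta => h; apply: (le_trans h).
clear h; set B := dball dY xi r; set lB := dball dY xi (lam * r).
have l0 : 0 < lam by exact: lt_trans lam_gt1.
set V := fine (wvol mu w iota B); set V' := fine (wvol mu w iota lB).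
have V0 : 0 < V by exact: trace_gt0.
have V'0 : 0 < V' by apply: trace_gt0; rewrite mulr_gt0.
have VV : V' <= K * V.
  by have := HK xi r r0; rewrite (nuE (mtrace xi (lam * r))) (nuE (mtrace xi r)) -EFinM lee_fin.
have Gw0 x : (0 <= grp iota p gr x * (w x)%:E)%E by rewrite mule_ge0 ?grp_ge0// lee_fin weight_ge0.
have mG : measurable_fun setT (fun x => (grp iota p gr x * (w x)%:E)%E).
  apply: emeasurable_funM; first exact: (grp_measurable md geo mX eps0 iso p mg).
  by apply/measurable_EFinP; exact: (weight_measurable z0 md mX R00 dbl beta_gt).
set I1 := wint mu w iota B _; set I2 := wint mu w iota lB _.
have I10 : (0 <= I1)%E by apply: integral_ge0 => x _; exact: Gw0.
have I20 : (0 <= I2)%E by apply: integral_ge0 => x _; exact: Gw0.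
have I12 : (I1 <= I2)%E.
  apply: ge0_subset_integral => //; [exact: mtrace|exact: mtrace|exact: measurable_funTS mG|by move=> x _; exact: Gw0|].
  by move=> x; rewrite /B /lB /dball /= => hx; apply: lt_le_trans hx _; rewrite ler_peMl// ltW.
have K0 : 0 < K by exact: lt_le_trans ltr01 K1.
have pi0 : 0 <= p^-1 by rewrite invr_ge0 ltW.
have q0 : (0 <= (V'^-1)%:E * I2)%E by rewrite mule_ge0// lee_fin invr_ge0 ltW.
have le1 : ((V^-1)%:E * I1 <= K%:E * ((V'^-1)%:E * I2))%E.
  rewrite muleA -EFinM; apply: lee_pmul => //; first by rewrite lee_fin invr_ge0 ltW.
  by rewrite lee_fin ler_pdivlMr// ler_pdivrMl// mulrC.
have le2 : (poweR ((V^-1)%:E * I1) p^-1 <= K%:E * poweR ((V'^-1)%:E * I2) p^-1)%E.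
  apply: (@le_trans _ _ (poweR (K%:E * ((V'^-1)%:E * I2)) p^-1)).
    by apply: poweR_le => //; rewrite mule_ge0// lee_fin invr_ge0 ltW.
  rewrite (@poweRM _ K%:E) ?lee_fin ?(ltW K0)//; apply: lee_wpmul2r; first exact: poweR_ge0.
  by rewrite poweR_EFin lee_fin -[leRHS]powRr1 ?(ltW K0)// ler_powR// invf_le1.
have [dd0 _] : (0 <= ddiam dY B)%E /\ True.
  split => //; apply: ereal_sup_ubound; exists xi; rewrite /B /dball /= ?(mdist0 mdY)//.
  by exists xi; rewrite /= ?(mdist0 mdY).
apply: le_trans (lee_wpmul2l _ le2) _; first by rewrite mule_ge0.
by rewrite EFinM !muleA; apply: lee_wpmul2r; rewrite ?poweR_ge0// -!muleA [(K%:E * _)%E]muleC.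
Qed.

End Conclusion.

Unset Implicit Arguments.

Theorem theorem6p2 (R : realType) :
  exists eps0 : R -> R, (forall delta, 0 <= delta -> 0 < eps0 delta) /\
  forall (dd : measure_display) (X : measurableType dd) (d : X -> X -> R)
    (z0 : X) (delta : R) (mu : {measure set X -> \bar R})
    (p Cd R0 eps beta lam : R),
    is_metric d -> dcomplete d -> dunbounded d -> geodesic_space d ->
    0 <= delta -> gromov_hyperbolic d delta -> roughly_starlike d z0 ->
    dlocally_compact d ->
    (@measurable _ X = dborel d) ->
    1 <= p -> 0 < R0 ->
    doubling d (wvol mu (fun=> 1) id) Cd (fun r => r <= R0) ->
    (exists lam0 CPI, 1 <= lam0 /\
       poincare d (wvol mu (fun=> 1) id) (wint mu (fun=> 1) id) p lam0 CPI
         (fun r => r <= R0)) ->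
    0 < eps -> eps <= eps0 delta ->
    17 * ln Cd / (3 * R0) < beta -> 1 < lam ->
    let de := d_eps d z0 eps in
    let w := fun x => expR (- (beta * d x z0)) in
    (* on the completion \overline{X}_eps: global doubling, global PI, dilation 1 *)
    (forall (Y : Type) (dY : Y -> Y -> R) (iota : X -> Y),
       is_completion de dY iota ->
       (exists C, doubling dY (wvol mu w iota) C (fun=> True)) /\
       (exists C, poincare dY (wvol mu w iota) (wint mu w iota) p 1 C
                    (fun=> True))) /\
    (* on X_eps: global doubling, global PI with dilation lam *)
    (exists C, doubling de (wvol mu w id) C (fun=> True)) /\
    (exists C, poincare de (wvol mu w id) (wint mu w id) p lam C (fun=> True)).
Proof.
have q0 (delta : R) : 0 <= delta -> 0 < 2 * (3 * delta + 1) by move=> ?; lra.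
(* Equivalent to exp(eps (3 delta + 1)) <= sqrt 2 for all admissible eps. *)
exists (fun delta => ln 2 / (2 * (3 * delta + 1))); split.
  by move=> delta /q0 ?; rewrite divr_gt0// ln_gt0// ltr1n.
move=> dd X d z0 delta mu p Cd R0 eps beta lam md _ unb geo delta0 hyp _ _ mX p1 R00 dbl_
  [lam0 [CPI [lam1 PI]]] eps0 eps_le beta_gt_ lam_gt1 de w.
have dbl x r : 0 < r -> r <= R0 ->
  [/\ (0 < mu (dball d x (2 * r)))%E, (mu (dball d x (2 * r)) <= Cd%:E * mu (dball d x r))%E &
      (mu (dball d x (2 * r)) < +oo)%E].
  move=> r0 rR; have := dbl_ x r r0 rR; have mb s := @ball_measurable R dd X d md mX x s.
  by rewrite !wvol1.
have Cd1 : 1 <= Cd by exact: (Cd_ge1 md mX R00 dbl).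
(* 17 / 3 exceeds 4, and log Cd is nonnegative because Cd >= 1. *)
have beta_gt : 4 * ln Cd / R0 < beta.
  apply: le_lt_trans beta_gt_; rewrite -subr_ge0.
  have -> : 17 * ln Cd / (3 * R0) - 4 * ln Cd / R0 = 5 * ln Cd / (3 * R0).
    by field; rewrite lt0r_neq0.
  by rewrite divr_ge0// mulr_ge0 ?ln_ge0// ltW.
have eps_le2 : expR (eps * (3 * delta + 1)) * expR (eps * (3 * delta + 1)) <= 2.
  rewrite -expRD -[leRHS]lnK ?posrE// ler_expR.
  by move: eps_le; rewrite ler_pdivlMr ?q0//; lra.
have close C : exists K, 2 <= K /\ forall x y, de x y <= C * rho_eps d z0 eps x ->
    de x y <= C * rho_eps d z0 eps y -> expR (eps * d x y) <= K.
  exists (Num.max 2 (Num.max (expR 1) ((2 * expR 4 * eps * C) ^+ 2))); split.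
    by rewrite le_max lexx.
  move=> x y h1 h2; rewrite le_max; apply/orP; right.
  exact: (de_close md geo delta0 hyp eps0 eps_le2 h1 h2).
split.
  move=> Y dY iota [mdY _ iso dense]; split.
    exact: (extension_doubling md geo mX R00 eps0 dbl beta_gt close mdY iso dense).
  have [C [_ H]] := extension_poincare md geo unb mX R00 eps0 dbl beta_gt close mdY iso dense p1 lam1 PI.
  by exists C.
have mde := de_metric z0 md eps0 geo.
(* X_eps is treated as its own extension, by the identity. *)
have dense x e : 0 < e -> exists y, de (id y) x < e by move=> e0; exists x; have := mdist0 mde x; rewrite /de => ->.
split.
  exact: (extension_doubling md geo mX R00 eps0 dbl beta_gt close mde (fun x y => erefl) dense).
exact: (extension_poincare_dilate md geo unb mX R00 eps0 dbl beta_gt close mde (fun x y => erefl)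
  dense p1 lam1 PI lam_gt1).
Qed.
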